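(* Let $\delta\in(0,n]$, $p\in(1,\infty)$ and let $w$ be a ($\mathcal H^\delta_\infty$-)capacitary weight on $\mathbb R^n$. Then the following statements are equivalent: (i) $\mathcal M_{\mathcal H^\delta_\infty}: L^p_w(\mathbb R^n,\mathcal H^\delta_\infty)\to L^p_w(\mathbb R^n,\mathcal H^\delta_\infty)$ is bounded, i.e. there is a constant $K>0$ such that for all $f\in L^p_w(\mathbb R^n,\mathcal H^\delta_\infty)$, $$\int_{\mathbb R^n}\left[\mathcal M_{\mathcal H^\delta_\infty}f(x)\right]^p w(x)\,d\mathcal H^\delta_\infty\le K\int_{\mathbb R^n}|f(x)|^p w(x)\,d\mathcal H^\delta_\infty;$$ (ii) $\mathcal M_{\mathcal H^\delta_\infty}: L^p_w(\mathbb R^n,\mathcal H^\delta_\infty)\to L^{p,\infty}_w(\mathbb R^n,\mathcal H^\delta_\infty)$ is bounded, i.e. there is a constant $K>0$ such that for all $f\in L^p_w(\mathbb R^n,\mathcal H^\delta_\infty)$ and all $t\in(0,\infty)$, $$w_{\mathcal H^\delta_\infty}\left(\left\{x\in\mathbb R^n:\ \mathcal M_{\mathcal H^\delta_\infty}f(x)>t\right\}\right)\le\frac{K}{t^p}\int_{\mathbb R^n}|f(x)|^p w(x)\,d\mathcal H^\delta_\infty;$$ (iii) $w\in\mathcal A_{p,\delta}$, i.e. $$\sup_{Q}\left\{\frac1{\mathcal H^\delta_\infty(Q)}\int_Q w(x)\,d\mathcal H^\delta_\infty\right\}\left\{\frac1{\mathcal H^\delta_\infty(Q)}\int_Q w(x)^{-\frac1{p-1}}\,d\mathcal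 H^\delta_\infty\right\}^{p-1}<\infty,$$ where the supremum is over all cubes $Q\subset\mathbb R^n$.
   Context: A cube $Q\subset\mathbb R^n$ is a left-open right-closed cube with sides parallel to the axes; $l(Q)$ is its edge length. For $\delta\in(0,n]$ and $E\subset\mathbb R^n$, the Hausdorff content is $\mathcal H^\delta_\infty(E):=\inf\{\sum_i l(Q_i)^\delta:\ E\subset\bigcup_i Q_i\}$, the infimum over all finite or countable coverings of $E$ by cubes. For $E\subset\mathbb R^n$ and a non-negative function $g$ (no measurability required) the Choquet integral is $\int_E g\,d\mathcal H^\delta_\infty:=\int_0^\infty \mathcal H^\delta_\infty(\{x\in E: g(x)>t\})\,dt$. ''Almost everywhere'' with respect to $\mathcal H^\delta_\infty$ means outside a set of zero $\mathcal H^\delta_\infty$-content. $L^1_{\rm loc}(\mathbb R^n,\mathcal H^\delta_\infty)$ is the set of functions $f$ with $\int_E|f|\,d\mathcal H^\delta_\infty<\infty$ for all compact $E\subset\mathbb R^n$. A capacitary weight is a non-negative function $w\in L^1_{\rm loc}(\mathbb R^n,\mathcal H^\delta_\infty)$ with $w\in(0,\infty)$ $\mathcal H^\delta_\infty$-almost everywhere. For $F\subset\mathbb R^n$, $w_{\mathcal H^\delta_\infty}(F):=\int_F w\,d\mathcal H^\delta_\infty$. $L^p_w(\mathbb R^n,\mathcal H^\delta_\infty)$ is the set of functions $f$ with $\int_{\mathbb R^n}|f|^pw\,d\mathcal H^\delta_\infty<\infty$; $L^{p,\infty}_w(\mathbb R^n,\mathcal H^\delta_\infty)$ is the set of functions $f$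 with $\sup_{t>0}t\,(w_{\mathcal H^\delta_\infty}(\{|f|>t\}))^{1/p}<\infty$. The capacitary maximal operator is $\mathcal M_{\mathcal H^\delta_\infty}f(x):=\sup_{Q\ni x}\frac1{\mathcal H^\delta_\infty(Q)}\int_Q|f(y)|\,d\mathcal H^\delta_\infty\in[0,\infty]$, the supremum over all cubes $Q$ containing $x$. *)

(* Defs.v *)
From HB Require Import structures.
From mathcomp Require Import all_boot all_order all_algebra.
From mathcomp Require Import all_classical all_reals all_analysis.

Set Implicit Arguments.
Unset Strict Implicit.
Unset Printing Implicit Defensive.

Import Order.TTheory GRing.Theory Num.Theory.
Import numFieldNormedType.Exports.

Local Open Scope classical_set_scope.
Local Open Scope ring_scope.
Local Open Scope ereal_scope.

(* The cube with lower corner a and edge length l is the product of the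
   intervals ]a_i, a_i + l], with l > 0 so that it is non-empty. *)
Record cube (R : realType) (n : nat) := Cube {
  corner : 'rV[R]_n;
  edge : R;
  edge_gt0 : (0 < edge)%R
}.

Definition cube_set (R : realType) (n : nat) (Q : cube R n) : set 'rV[R]_n :=
  [set x | forall i : 'I_n,
    (corner Q ord0 i < x ord0 i <= corner Q ord0 i + edge Q)%R].

(* The index set D : set nat lets the coverings be finite (possibly empty) or
   countably infinite. *)
Definition hcontent (R : realType) (n : nat) (delta : R) (E : set 'rV[R]_n) :
    \bar R :=
  ereal_inf [set s | exists (D : set nat) (Q : nat -> cube R n),
    E `<=` \bigcup_(i in D) cube_set (Q i) /\
    s = \esum_(i in D) ((edge (Q i) `^ delta)%R)%:E].

Definition hae (R : realType) (n : nat) (delta : R) (P : 'rV[R]_n -> Prop) :=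
  exists N : set 'rV[R]_n, hcontent delta N = 0 /\ forall x, ~ N x -> P x.

(* The integrand is nonincreasing in t, hence measurable even though g need
   not be. *)
Definition choquet (R : realType) (n : nat) (delta : R) (E : set 'rV[R]_n)
    (g : 'rV[R]_n -> \bar R) : \bar R :=
  \int[@lebesgue_measure R]_(t in `]0%R, +oo[)
    hcontent delta [set x | E x /\ t%:E < g x].

Definition L1loc (R : realType) (n : nat) (delta : R) :
    set ('rV[R]_n -> \bar R) :=
  [set f | forall E : set 'rV[R]_n, compact E ->
    choquet delta E (fun x => `|f x|) < +oo].

Definition capacitary_weight (R : realType) (n : nat) (delta : R)
    (w : 'rV[R]_n -> \bar R) :=
  [/\ forall x, 0 <= w x,
      L1loc delta w
    & hae delta (fun x => 0 < w x < +oo)].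

Definition weighted_content (R : realType) (n : nat) (delta : R)
    (w : 'rV[R]_n -> \bar R) (F : set 'rV[R]_n) : \bar R :=
  choquet delta F w.

Definition Lpw (R : realType) (n : nat) (delta p : R)
    (w : 'rV[R]_n -> \bar R) : set ('rV[R]_n -> \bar R) :=
  [set f | choquet delta setT (fun x => `|f x| `^ p * w x) < +oo].

Definition average (R : realType) (n : nat) (delta : R) (Q : cube R n)
    (g : 'rV[R]_n -> \bar R) : \bar R :=
  (hcontent delta (cube_set Q))^-1 * choquet delta (cube_set Q) g.

Definition maximal (R : realType) (n : nat) (delta : R)
    (f : 'rV[R]_n -> \bar R) (x : 'rV[R]_n) : \bar R :=
  ereal_sup [set average delta Q (fun y => `|f y|) |
             Q in [set Q : cube R n | cube_set Q x]].

(* w ^ (- 1 / (p - 1)) is written (w^-1) ^ (1 / (p - 1)): the inverse of \bar R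
   satisfies 0^-1 = +oo and +oo^-1 = 0, whereas poweR and powR do not have the
   usual values at 0 and +oo for negative exponents. *)
Definition muckenhoupt (R : realType) (n : nat) (delta p : R)
    (w : 'rV[R]_n -> \bar R) :=
  ereal_sup [set average delta Q w *
      (average delta Q (fun x => (w x)^-1 `^ ((p - 1)^-1)%R)) `^ (p - 1)%R |
    Q in [set: cube R n]] < +oo.

(* Main.v *)
(** Write H for the content and J for the dyadic sum of 2^m H(E, g > 2^m), which
    is comparable to the Choquet integral and is subadditive over countable
    suprema, because H is countably subadditive. Nothing else is available: H is
    not additive on disjoint cubes.

    Covering every level set of h by cells of a triadic grid gives J(h) as the
    infimum of sums of 2^m l(P)^delta. On a cell Q, J(Q, h) is then bounded by the
    mass of the cover below Q plus the contribution of one cover cell above Q.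
    Hence J is superadditive, up to a constant, along families of disjoint cells
    that satisfy a Carleson packing condition, and the greedy algorithm of
    Melnikov extracts such families from arbitrary ones.

    For an A_p weight v with dual weight s, cells where v has average at most t
    carry s-averages at least of order t^(-1/(p-1)). Superadditivity of s along a
    packing and the A_p condition carry the bound on the average of v over to the
    saturated cells above. This gives: if J(Q, v) <= J(Q, h) for all Q in a family
    of cells, then J(v) over their union is at most C J(h), that is, the weak
    (1,1) bound for the grid maximal operator weighted by v.

    Interpolation needs the sum over j of 2^(jq) J(v; g > 2^j) to be at most
    C J(g^q v), which is false for general weights. It holds for A_p weights since
    the parts of a cell where v exceeds t times its average, or is below 1/t times
    it, have content decaying like a power of t. Lerner's argument then
    dominates the unweighted grid maximal operator by the composition of the
    maximal operators weighted by s and by v, and every cube lies in a cell of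
    comparable size of one of the 2^n grids shifted by half a period. *)
Require Import Defs.
From HB Require Import structures.
From mathcomp Require Import all_boot all_order all_algebra.
From mathcomp Require Import all_classical all_reals all_analysis.
From mathcomp Require Import measurable_realfun ring lra zify.

Set Implicit Arguments.
Unset Strict Implicit.
Unset Printing Implicit Defensive.

Import Order.TTheory GRing.Theory Num.Theory.
Import numFieldNormedType.Exports.

Local Open Scope classical_set_scope.
Local Open Scope ring_scope.
Local Open Scope ereal_scope.

(** * Sums of extended reals over arbitrary index sets *)

Section Esum.
Context {R : realType}.

Lemma esum_ub (T : choiceType) (A : set T) (a : T -> \bar R) (c : \bar R) :
  (forall s : seq T, uniq s -> {subset s <= A} -> \sum_(i <- s) a i <= c) ->
  \esum_(i in A) a i <= c.
Proof.
move=> H; apply: ge_ereal_sup => _ [X [finX XA] <-].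
rewrite fsbig_finite//=; apply: H; first exact: finmap.fset_uniq.
by move=> i; rewrite in_fset_set// => /set_mem/XA/mem_set.
Qed.

Lemma esum_ge_seq (T : choiceType) (A : set T) (a : T -> \bar R) (s : seq T) :
  uniq s -> {subset s <= A} -> \sum_(i <- s) a i <= \esum_(i in A) a i.
Proof.
move=> us sA; apply: esum_ge; exists [set` s].
  by split; [exact: finite_seq|move=> i /= /sA/set_mem].
rewrite fsbig_finite; last exact: finite_seq.
rewrite le_eqVlt; apply/orP; left; apply/eqP; apply: perm_big.
apply: uniq_perm => // i; rewrite in_fset_set; last exact: finite_seq.
by apply/idP/idP => [/mem_set|/set_mem].
Qed.

Lemma esum_ge1 (T : choiceType) (A : set T) (a : T -> \bar R) (i : T) :
  A i -> a i <= \esum_(i in A) a i.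
Proof.
move=> Ai; have := @esum_ge_seq _ A a [:: i] isT; rewrite big_seq1; apply.
by move=> j; rewrite mem_seq1 => /eqP ->; exact/mem_set.
Qed.

Lemma esum_le_subset (T : choiceType) (A B : set T) (a : T -> \bar R) :
  A `<=` B -> \esum_(i in A) a i <= \esum_(i in B) a i.
Proof.
move=> AB; apply: esum_ub => s us sA; apply: esum_ge_seq => // i /sA.
by move=> /set_mem/AB/mem_set.
Qed.

Lemma esum_ge0_gt0 (T : choiceType) (A : set T) (a : T -> \bar R) :
  (forall i, 0 <= a i) -> \esum_(i in A) a i = 0 -> forall i, A i -> a i = 0.
Proof.
move=> a0 e i Ai; apply/eqP; rewrite eq_le a0 andbT -e; exact: esum_ge1.
Qed.

Lemma esumZl (T : choiceType) (A : set T) (a : T -> \bar R) (c : R) :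
  (0 <= c)%R -> (forall i, 0 <= a i) ->
  \esum_(i in A) (c%:E * a i) = c%:E * \esum_(i in A) a i.
Proof.
rewrite le_eqVlt => /predU1P[<- a0|c0 a0].
  by rewrite mul0e esum1// => i _; rewrite mul0e.
rewrite /esum -ereal_sup_pZl//; congr ereal_sup; apply/seteqP; split => x /=.
  move=> [X XA <-]; exists (\sum_(i \in X) a i); first by exists X.
  by rewrite ge0_mule_fsumr.
move=> [_ [X XA <-] <-]; exists X => //.
by rewrite ge0_mule_fsumr.
Qed.

Lemma esumZr (T : choiceType) (A : set T) (a : T -> \bar R) (c : R) :
  (0 <= c)%R -> (forall i, 0 <= a i) ->
  \esum_(i in A) (a i * c%:E) = (\esum_(i in A) a i) * c%:E.
Proof.
by move=> c0 a0; rewrite muleC -esumZl//; apply: eq_esum => i _; rewrite muleC.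
Qed.

(** Tonelli over the pairs satisfying [P]; typically [P] is containment of one cell in another. *)
Lemma esum_exchange (T1 T2 : choiceType) (A : set T1) (B : set T2)
    (P : T1 -> T2 -> Prop) (a : T1 -> T2 -> \bar R) :
  (forall i j, 0 <= a i j) ->
  \esum_(i in A) \esum_(j in [set j | B j /\ P i j]) a i j =
  \esum_(j in B) \esum_(i in [set i | A i /\ P i j]) a i j.
Proof.
move=> a0; rewrite !esum_esum//.
rewrite (reindex_esum [set k | B k.1 /\ (A k.2 /\ P k.2 k.1)] _
  (fun k : T2 * T1 => (k.2, k.1)))//.
split=> [[j i] /= [Bj [Ai Pij]]//|[j i] [j' i'] _ _ /= [-> ->]//|[i j] /= [Ai [Bj Pij]]].
by exists (j, i).
Qed.

Lemma esum_exchangeT (T1 T2 : choiceType) (A : set T1) (B : set T2)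
    (a : T1 -> T2 -> \bar R) :
  (forall i j, 0 <= a i j) ->
  \esum_(i in A) \esum_(j in B) a i j = \esum_(j in B) \esum_(i in A) a i j.
Proof.
move=> a0; have := @esum_exchange T1 T2 A B (fun _ _ => True) a a0.
have e (T : choiceType) (C : set T) : [set j | C j /\ True] = C.
  by apply/seteqP; split => [x []|x].
by under eq_esum do rewrite e; move=> ->; apply: eq_esum => j _; rewrite e.
Qed.

Lemma esum_subsingleton (T : choiceType) (A : set T) (a : T -> \bar R) (c : \bar R) :
  0 <= c -> (forall i j, A i -> A j -> i = j) -> (forall i, A i -> 0 <= a i <= c) ->
  \esum_(i in A) a i <= c.
Proof.
move=> c0 A1 ac; have [->|/set0P[i Ai]] := eqVneq A set0; first by rewrite esum_set0.
rewrite (_ : A = [set i]); first by rewrite esum_set1; have /andP[] := ac _ Ai.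
by apply/seteqP; split => [j Aj|_ ->//]; exact: A1.
Qed.

End Esum.

(** * Integer powers and geometric series *)

Section Geometric.
Context {R : realType}.

Lemma exprz_floor (b s : R) : (1 < b)%R -> (0 < s)%R ->
  exists m : int, (b ^ m <= s < b ^ (m + 1))%R.
Proof.
move=> b1 s0; have b0 : (0 < b)%R by apply: lt_trans b1.
have lb0 : (0 < ln b)%R by apply: ln_gt0.
exists (Num.floor (ln s / ln b)).
have E (m : int) : (b ^ m)%R = expR (m%:~R * ln b).
  by rewrite -powR_intmul ?(ltW b0)// /powR gt_eqF.
rewrite !E -{2 3}(lnK s0) ler_expR ltr_expR -ler_pdivlMr// -ltr_pdivrMr//.
exact: floor_itv.
Qed.

Lemma nat_geometric_le (r : R) : (0 < r < 1)%R ->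
  \esum_(i in [set: nat]) (r ^+ i)%:E <= ((1 - r)^-1)%:E.
Proof.
move=> /andP[r0 r1].
rewrite -nneseries_esumT; last by move=> i; rewrite lee_fin exprn_ge0// ltW.
apply: lime_le.
  by apply: is_cvg_nneseries => i _ _; rewrite lee_fin exprn_ge0// ltW.
apply: nearW => N; rewrite sumEFin lee_fin big_mkord.
have r1' : (0 < 1 - r)%R by rewrite subr_gt0.
rewrite -[leRHS]mul1r ler_pdivlMr// mulrC -opprB mulNr -subrX1 opprB.
by rewrite lerBlDr lerDl exprn_ge0// ltW.
Qed.

Lemma geometric_up_le (r : R) (j0 : int) : (0 < r < 1)%R ->
  \esum_(j in [set j : int | (j0 <= j)%R]) (r ^ (j - j0))%:E <= ((1 - r)^-1)%:E.
Proof.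
move=> r01; rewrite (reindex_esum [set: nat] _ (fun i => j0 + i%:Z)%R).
  by under eq_esum do rewrite addrAC subrr add0r; exact: nat_geometric_le.
split => [i _ /=|i j _ _ /addrI[]//|j /= jj0]; first by rewrite lerDl.
by exists `|j - j0|%N => //; rewrite /= gez0_abs ?subr_ge0//; lia.
Qed.

Lemma geometric_down_le (r : R) (j0 : int) : (0 < r < 1)%R ->
  \esum_(j in [set j : int | (j <= j0)%R]) (r ^ (j0 - j))%:E <= ((1 - r)^-1)%:E.
Proof.
move=> r01; rewrite (reindex_esum [set: nat] _ (fun i => j0 - i%:Z)%R).
  by under eq_esum do rewrite opprB addrCA subrr addr0; exact: nat_geometric_le.
split => [i _ /=|i j _ _ /addrI/oppr_inj[]//|j /= jj0].
  by rewrite gerDl oppr_le0.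
by exists `|j0 - j|%N => //; rewrite /= gez0_abs ?subr_ge0//; lia.
Qed.

Lemma powR_exprz (b q : R) (j : int) : (0 <= b)%R ->
  ((b ^ j) `^ q = (b `^ q) ^ j)%R.
Proof.
by move=> b0; rewrite -powR_intmul// -(powR_intmul j (powR_ge0 b q)) -!powRrM mulrC.
Qed.

Lemma int_ub_max (P : int -> Prop) (b : int) :
  (exists m, P m) -> (forall m, P m -> (m <= b)%R) ->
  exists m, P m /\ forall m', P m' -> (m' <= m)%R.
Proof.
move=> [m0 Pm0] Pb.
pose Q (i : nat) := `[< P (b - i%:Z)%R >].
have exQ : exists i, Q i.
  exists `|b - m0|%N; apply/asboolP.
  by rewrite gez0_abs ?subr_ge0 ?Pb// opprB addrC subrK.
exists (b - (ex_minn exQ)%:Z)%R; case: ex_minnP => i /asboolP Pi imin; split => //.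
move=> m' Pm'; have : Q `|b - m'|%N.
  by apply/asboolP; rewrite gez0_abs ?subr_ge0 ?Pb// opprB addrC subrK.
move=> /imin; have := Pb _ Pm'; lia.
Qed.

End Geometric.

(** * Hausdorff content: coverings, countable subadditivity and scaling *)

Section HausdorffContent.
Context {R : realType} {n : nat} {delta : R}.
Local Notation X := 'rV[R]_n.
Local Notation H := (@hcontent R n delta).

Lemma hcontent_ge0 (E : set X) : 0 <= H E.
Proof.
apply: le_ereal_inf_tmp => _ [D [Q [_ ->]]].
by apply: esum_ge0 => i _; rewrite lee_fin powR_ge0.
Qed.

Lemma hcontent_le (E F : set X) : E `<=` F -> H E <= H F.
Proof.
move=> EF; apply: le_ereal_inf => _ [D [Q [FQ ->]]]; exists D, Q; split => //.
exact: subset_trans FQ.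
Qed.

(** Coverings in [hcontent] are indexed by [nat]; any other countable index is transported along
    [pickle]. Numbers that code no index get a unit cube, which stays outside the index set. *)
Lemma hcontent_cover (I : countType) (D : set I) (Q : I -> cube R n) (E : set X) :
  E `<=` \bigcup_(i in D) cube_set (Q i) ->
  H E <= \esum_(i in D) ((edge (Q i) `^ delta)%R)%:E.
Proof.
move=> EQ; apply: ereal_inf_lbound.
pose Q' k := if unpickle k is Some i then Q i else Cube (0 : X)%R (@ltr01 R).
exists (pickle @` D), Q'; split.
  move=> x /EQ[i Di Qix]; exists (pickle i); first by exists i.
  by rewrite /Q' pickleK.
rewrite esum_image; last by move=> i j _ _; exact: (pcan_inj pickleK).
by apply: eq_esum => i _; rewrite /Q' pickleK.
Qed.

Lemma hcontent_lt (E : set X) (c : \bar R) : H E < c ->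
  exists (D : set nat) (Q : nat -> cube R n),
    E `<=` \bigcup_(i in D) cube_set (Q i) /\
    \esum_(i in D) ((edge (Q i) `^ delta)%R)%:E < c.
Proof. by move=> /ereal_inf_lt[_ [D [Q [EQ ->]]] Hc]; exists D, Q. Qed.

Lemma esum_epsilon (I : countType) (D : set I) (e : R) : (0 <= e)%R ->
  \esum_(i in D) (e / (2 ^ (pickle i).+1)%:R)%:E <= e%:E.
Proof.
move=> e0; rewrite -(@esum_image _ _ _ D pickle
  (fun k => (e / (2 ^ k.+1)%:R)%:E)); last first.
  by move=> i j _ _; exact: (pcan_inj pickleK).
apply: le_trans (esum_le_subset _ (@subsetT _ _)) _.
rewrite -nneseries_esumT; last by move=> k; rewrite lee_fin divr_ge0.
exact: (epsilon_trick0 xpredT).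
Qed.

(** Covers of the [F i] with excess [e / 2^(k+1)], where [k] is the code of [i], merge into one
    cover indexed by pairs. An infinite sum is dismissed first, so that each content is finite and
    has such a cover. *)
Lemma hcontent_bigcup (I : countType) (D : set I) (F : I -> set X) (E : set X) :
  E `<=` \bigcup_(i in D) F i -> H E <= \esum_(i in D) H (F i).
Proof.
move=> EF; have F0 i : 0 <= H (F i) by exact: hcontent_ge0.
have [->|oo] := eqVneq (\esum_(i in D) H (F i)) +oo; first by rewrite leey.
have fin i : D i -> H (F i) \is a fin_num.
  move=> Di; rewrite ge0_fin_numE//; apply: le_lt_trans (@esum_ge1 _ _ D (fun i => H (F i)) i Di) _.
  by rewrite ltey.
apply/lee_addgt0Pr => e e0.
pose eps (i : I) : R := (e / (2 ^ (pickle i).+1)%:R)%R.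
have eps0 i : (0 < eps i)%R by rewrite divr_gt0// ltr0n expn_gt0.
have /choice[g gP] : forall i, exists DQ : set nat * (nat -> cube R n), D i ->
    F i `<=` \bigcup_(j in DQ.1) cube_set (DQ.2 j) /\
    \esum_(j in DQ.1) ((edge (DQ.2 j) `^ delta)%R)%:E <= H (F i) + (eps i)%:E.
  move=> i; have [Di|nDi] := pselect (D i); last first.
    by exists (set0, fun=> Cube (0 : X)%R (@ltr01 R)) => /nDi.
  have /hcontent_lt[D' [Q' [c1 c2]]] : H (F i) < H (F i) + (eps i)%:E.
    by rewrite lteDl ?fin// lte_fin.
  by exists (D', Q') => _; split => //; exact: ltW.
pose Q (k : I * nat) := (g k.1).2 k.2.
apply: (@le_trans _ _ (\esum_(k in D `*`` (fun i => (g i).1))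
    ((edge (Q k) `^ delta)%R)%:E)).
  apply: (hcontent_cover (D := D `*`` (fun i => (g i).1)) (Q := Q)) => x.
  by move=> /EF[i Di /(gP i Di).1[j Dj Qj]]; exists (i, j).
rewrite -(@esum_esum _ _ _ D (fun i => (g i).1)
  (fun i j => ((edge ((g i).2 j) `^ delta)%R)%:E)); last first.
  by move=> *; rewrite lee_fin powR_ge0.
apply: (@le_trans _ _ (\esum_(i in D) (H (F i) + (eps i)%:E))).
  by apply: le_esum => i Di; exact: (gP i Di).2.
rewrite esumD//; first by rewrite leeD2l// esum_epsilon// ltW.
by move=> i _; rewrite lee_fin ltW.
Qed.

Lemma hcontentU (E F G : set X) : E `<=` F `|` G -> H E <= H F + H G.
Proof.
move=> EFG; apply: le_trans (@hcontent_bigcup bool setT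
  (fun b => if b then F else G) E _) _.
  by move=> x /EFG[Fx|Gx]; [exists true|exists false].
rewrite [X in \esum_(i in X) _](_ : _ = [set` [:: true; false]]); last first.
  by apply/seteqP; split=> [[]|].
rewrite esum_fset//; last by move=> i _; exact: hcontent_ge0.
by rewrite -fsbig_seq//= big_cons big_seq1.
Qed.

Lemma hcontent0 : H set0 = 0.
Proof.
apply/eqP; rewrite eq_le hcontent_ge0 andbT.
apply: le_trans (@hcontent_cover nat set0
  (fun=> Cube (0 : X)%R (@ltr01 R)) set0 _) _ => //.
by rewrite esum_set0.
Qed.

Lemma hcontent_cube (Q : cube R n) : H (cube_set Q) <= ((edge Q `^ delta)%R)%:E.
Proof.
apply: le_trans (@hcontent_cover unit setT (fun=> Q) _ _) _.
  by move=> x Qx; exists tt.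
rewrite (_ : setT = [set tt]); last by apply/seteqP; split=> -[].
by rewrite esum_set1// lee_fin powR_ge0.
Qed.

(** Pulling back a covering of [F] by the similarity multiplies every edge by [r^-1]. *)
Lemma hcontent_affine (r : R) (a : X) (E F : set X) : (0 < r)%R ->
  (forall x, E x -> F (r *: x + a)%R) ->
  H E <= ((r^-1 `^ delta)%R)%:E * H F.
Proof.
move=> r0 EF.
have rd0 : (0 < r^-1 `^ delta)%R by apply: powR_gt0; rewrite invr_gt0.
rewrite -lee_pdivrMl//; apply: le_ereal_inf_tmp => _ [D [Q [FQ ->]]].
rewrite lee_pdivrMl// -esumZl ?(ltW rd0)//; last by move=> i; rewrite lee_fin powR_ge0.
have rQ i : (0 < r^-1 * edge (Q i))%R by rewrite mulr_gt0 ?invr_gt0// edge_gt0.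
apply: le_trans (@hcontent_cover nat D
  (fun i => Cube (r^-1 *: (corner (Q i) - a))%R (rQ i)) E _) _.
  move=> x /EF/FQ[i Di Qi]; exists i => // k; have := Qi k; rewrite !mxE /=.
  rewrite -mulrDr ler_pdivlMl// ltr_pdivrMl// => /andP[h1 h2].
  by rewrite ltrBlDr h1/= addrAC lerBrDr.
apply: le_esum => i _ /=; rewrite -EFinM powRM// ?invr_ge0 ?(ltW r0)//.
exact/ltW/edge_gt0.
Qed.

(** The similarity carrying [P] into [Q] gives it. One cube of positive content thus bounds the
    content of every cube below by a multiple of [edge^delta]. *)
Lemma hcontent_cube_ge (P Q : cube R n) :
  H (cube_set P) <= (((edge P / edge Q) `^ delta)%R)%:E * H (cube_set Q).
Proof.
have r0 : (0 < edge Q / edge P)%R by rewrite divr_gt0// edge_gt0.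
rewrite -[(edge P / edge Q)%R]invf_div.
apply: (@hcontent_affine _ (corner Q - (edge Q / edge P) *: corner P)%R) => // x.
move=> Px k; have := Px k; rewrite !mxE => /andP[h1 h2].
have -> : (edge Q / edge P * x 0 k + (corner Q 0 k - edge Q / edge P * corner P 0 k)
  = corner Q 0 k + edge Q / edge P * (x 0 k - corner P 0 k))%R by ring.
rewrite ltrDl lerD2l mulr_gt0 ?subr_gt0//= mulrAC ler_pdivrMr ?edge_gt0//.
by rewrite ler_pM2l ?edge_gt0// lerBlDl.
Qed.

End HausdorffContent.

(** * Integrals of nonincreasing functions as dyadic sums *)

Section MonotoneIntegral.
Context {R : realType}.
Variable phi : R -> \bar R.
Hypothesis phi_ge0 : forall t, 0 <= phi t.
Hypothesis phi_ni : {homo phi : s t / (s <= t)%R >-> t <= s}.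
Local Notation mu := (@lebesgue_measure R).

Lemma ereal_nonincreasing_measurable (D : set R) :
  measurable D -> measurable_fun D phi.
Proof.
move=> mD; apply: (measurability _ (ErealGenCInfty.measurableE R)) => //.
move=> _ [_ [r ->] <-]; apply: measurableI => //.
apply: is_interval_measurable => s t /=.
rewrite !in_itv/= !andbT => fs ft u /andP[su ut].
by rewrite in_itv/= andbT (le_trans ft)// phi_ni.
Qed.

Definition band (m : int) : set R := `](2 ^ m)%R, (2 ^ (m + 1))%R]%classic.

Lemma band_measurable (m : int) : measurable (band m).
Proof. exact: measurable_itv. Qed.

Lemma band_measure (m : int) : mu (band m) = ((2 ^ m)%R)%:E.
Proof.
rewrite /band lebesgue_measure_itv/= lte_fin ltr_eXz2l ?ltr1n// ltrDl ltr01.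
rewrite -EFinB; congr EFin; rewrite expfzDr// expr1z; ring.
Qed.

Lemma band_disjoint (i j : int) (t : R) : band i t -> band j t -> i = j.
Proof.
rewrite /band /= !in_itv/= => /andP[h1 h2] /andP[h3 h4].
have := lt_le_trans h1 h4; have := lt_le_trans h3 h2.
by rewrite !ltr_eXz2l ?ltr1n//; lia.
Qed.

Lemma band_cover (t : R) : (0 < t)%R -> exists m, band m t.
Proof.
(* Bands are closed on the right and [exprz_floor] gives intervals closed on the left; taking the
   reciprocal exchanges the two. *)
move=> t0; have [m /andP[h1 h2]] : exists m : int, (2 ^ m <= t^-1 < 2 ^ (m + 1))%R.
  by apply: exprz_floor; rewrite ?ltr1n// invr_gt0.
exists (- (m + 1))%R; rewrite /band /= in_itv/=.
rewrite (_ : - (m + 1) + 1 = - m)%R; last by lia.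
rewrite -!invr_expz -[t]invrK ltf_pV2 ?posrE ?invr_gt0 ?exprz_gt0//.
by rewrite h2 lef_pV2 ?posrE ?invr_gt0 ?exprz_gt0.
Qed.

Lemma integral_band : \int[mu]_(t in `]0%R, +oo[) phi t =
  \esum_(m in [set: int]) \int[mu]_(t in band m) phi t.
Proof.
(* The bands are renumbered by [nat] through [pickle]; numbers that code no integer give the empty
   set. *)
pose F (k : nat) := [set t | exists2 m : int, pickle m = k & band m t].
have FE m : F (pickle m) = band m.
  apply/seteqP; split => [t [m' /(pcan_inj pickleK)->]//|t mt]; by exists m.
have F0 k : ~ (exists m : int, pickle m = k) -> F k = set0.
  by move=> nk; apply/seteqP; split => // t [m mk _]; apply: nk; exists m.
have mF k : measurable (F k).
  have [[m <-]|/F0 ->//] := pselect (exists m : int, pickle m = k).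
  by rewrite FE; exact: band_measurable.
rewrite (_ : `]0%R, +oo[%classic = \bigcup_k F k); last first.
  apply/seteqP; split=> [t|t [k _ [m _]]]; rewrite /band /= !in_itv/= andbT.
    by move=> /band_cover[m mt]; exists (pickle m) => //; exists m.
  by move=> /andP[+ _]; apply: lt_trans; rewrite exprz_gt0.
rewrite ge0_integral_bigcup//; last 2 first.
- apply: ereal_nonincreasing_measurable; exact: bigcup_measurable.
- move=> i j _ _ [t [[m <- mt] [m' <- mt']]].
  by rewrite (band_disjoint mt mt').
rewrite nneseries_esumT; last by move=> k; exact: integral_ge0.
transitivity (\esum_(k in [set pickle m | m in [set: int]])
    \int[mu]_(t in F k) phi t).
  rewrite esum_mkcond [RHS]esum_mkcond; apply: eq_esum => k _.
  rewrite in_setT; case: ifPn => // /negP nk; rewrite F0 ?integral_set0// => -[m mk].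
  by apply: nk; apply/mem_set; exists m.
rewrite esum_image; last by move=> i j _ _; exact: (pcan_inj pickleK).
by apply: eq_esum => m _; rewrite FE.
Qed.

Lemma integral_band_le :
  \int[mu]_(t in `]0%R, +oo[) phi t <= \esum_(m in [set: int]) ((2 ^ m)%R)%:E * phi (2 ^ m)%R.
Proof.
rewrite integral_band; apply: le_esum => m _.
rewrite muleC -band_measure -integral_cst; last exact: band_measurable.
apply: ge0_le_integral => //.
- exact: band_measurable.
- apply: ereal_nonincreasing_measurable; exact: band_measurable.
- by move=> t; rewrite /band /= in_itv/= => /andP[+ _] => /ltW/phi_ni.
Qed.

Lemma integral_band_ge :
  \esum_(m in [set: int]) ((2 ^ m)%R)%:E * phi (2 ^ m)%R <=
  2%:E * \int[mu]_(t in `]0%R, +oo[) phi t.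
Proof.
rewrite integral_band -esumZl//; last by move=> m; exact: integral_ge0.
(* On [band m] the function is at least its value at the right end [2^(m+1)], while the band has
   length [2^m]: hence the shifted index and the factor 2. *)
rewrite (reindex_esum [set: int] _ (fun m => m + 1)%R); last first.
  split=> // [m m' _ _ /addIr//|m _]; exists (m - 1)%R => //; exact: subrK.
apply: le_esum => m _.
rewrite [X in X%:E * _]expfzDr// expr1z (mulrC _ 2%R) EFinM -muleA lee_wpmul2l//.
rewrite muleC -band_measure -integral_cst; last exact: band_measurable.
apply: ge0_le_integral => //.
- exact: band_measurable.
- by move=> t _; exact: phi_ge0.
- apply: ereal_nonincreasing_measurable; exact: band_measurable.
- by move=> t; rewrite /band /= in_itv/= => /andP[_ +] => /phi_ni.
Qed.

End MonotoneIntegral.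

(** * The dyadic Choquet sum: subadditivity, scaling and Chebyshev bounds *)

Definition dchoquet (R : realType) (n : nat) (delta : R) (E : set 'rV[R]_n)
    (g : 'rV[R]_n -> \bar R) : \bar R :=
  \esum_(m in [set: int])
    ((2 ^ m)%R)%:E * hcontent delta [set x | E x /\ ((2 ^ m)%R)%:E < g x].

Section DyadicChoquet.
Context {R : realType} {n : nat} {delta : R}.
Local Notation X := 'rV[R]_n.
Local Notation H := (@hcontent R n delta).
Local Notation J := (@dchoquet R n delta).
Implicit Types (E F : set X) (g h : X -> \bar R).

Let level_ge0 E g (m : int) :
  0 <= ((2 ^ m)%R)%:E * H [set x | E x /\ ((2 ^ m)%R)%:E < g x].
Proof. by rewrite mule_ge0 ?hcontent_ge0// lee_fin exprz_ge0. Qed.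

Lemma dchoquet_ge0 E g : 0 <= J E g.
Proof. by apply: esum_ge0 => m _. Qed.

Lemma choquet_le_dchoquet E g : choquet delta E g <= J E g.
Proof.
rewrite /choquet /dchoquet.
apply: (@integral_band_le _ (fun t => H [set x | E x /\ t%:E < g x])) => [t|s t st].
  exact: hcontent_ge0.
apply: hcontent_le => x [Ex tg]; split => //.
by apply: le_lt_trans tg; rewrite lee_fin.
Qed.

Lemma dchoquet_le_choquet E g : J E g <= 2%:E * choquet delta E g.
Proof.
rewrite /choquet /dchoquet.
apply: (@integral_band_ge _ (fun t => H [set x | E x /\ t%:E < g x])) => [t|s t st].
  exact: hcontent_ge0.
apply: hcontent_le => x [Ex tg]; split => //.
by apply: le_lt_trans tg; rewrite lee_fin.
Qed.

(** The hypothesis expresses [g <= sup h i] through positive levels, which is exactly the inclusion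
    of level sets that countable subadditivity of the content needs. *)
Lemma dchoquet_le_sum (I : countType) (D : set I) (F : I -> set X)
    (h : I -> X -> \bar R) E g :
  (forall x s, E x -> (0 < s)%R -> s%:E < g x ->
     exists i, [/\ D i, F i x & s%:E < h i x]) ->
  J E g <= \esum_(i in D) J (F i) (h i).
Proof.
move=> Eg; rewrite esum_exchangeT; last by move=> i m; exact: level_ge0.
apply: le_esum => m _; rewrite esumZl ?exprz_ge0//; last by move=> i; exact: hcontent_ge0.
apply: lee_wpmul2l; first by rewrite lee_fin exprz_ge0.
apply: hcontent_bigcup => x /= [Ex gx].
have p2 : (0 < 2 ^ m :> R)%R by exact: exprz_gt0.
by have [i [Di Fi hi]] := Eg x _ Ex p2 gx; exists i.
Qed.

Lemma dchoquet_le_add E g F1 h1 F2 h2 :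
  (forall x s, E x -> (0 < s)%R -> s%:E < g x ->
     (F1 x /\ s%:E < h1 x) \/ (F2 x /\ s%:E < h2 x)) ->
  J E g <= J F1 h1 + J F2 h2.
Proof.
move=> Eg; rewrite -esumD//; apply: le_esum => m _.
rewrite -ge0_muleDr ?hcontent_ge0// lee_wpmul2l ?lee_fin ?exprz_ge0//.
apply: hcontentU => x [Ex gx].
by apply: (Eg x _ Ex _ gx); exact: exprz_gt0.
Qed.

Lemma dchoquet_le_add_sum (I : countType) (D : set I) (F : I -> set X)
    (h : I -> X -> \bar R) E g F1 h1 :
  (forall x s, E x -> (0 < s)%R -> s%:E < g x ->
     (F1 x /\ s%:E < h1 x) \/ exists i, [/\ D i, F i x & s%:E < h i x]) ->
  J E g <= J F1 h1 + \esum_(i in D) J (F i) (h i).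
Proof.
move=> Eg; rewrite esum_exchangeT; last by move=> i m; exact: level_ge0.
rewrite -esumD//; last by move=> m _; apply: esum_ge0 => i _.
apply: le_esum => m _; rewrite esumZl ?exprz_ge0//; last by move=> i; exact: hcontent_ge0.
rewrite -ge0_muleDr ?hcontent_ge0//; last by apply: esum_ge0 => i _; exact: hcontent_ge0.
apply: lee_wpmul2l; first by rewrite lee_fin exprz_ge0.
apply: (@le_trans _ _ (H [set x | F1 x /\ ((2 ^ m)%R)%:E < h1 x] +
    H (\bigcup_(i in D) [set x | F i x /\ ((2 ^ m)%R)%:E < h i x]))).
  apply: hcontentU => x /= [Ex gx].
  have p2 : (0 < 2 ^ m :> R)%R by exact: exprz_gt0.
  have [?|[i [Di Fi hi]]] := Eg x _ Ex p2 gx; first by left.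
  by right; exists i.
by rewrite leeD2l//; exact: hcontent_bigcup.
Qed.

Lemma dchoquet_le_ae N E g F h : H N = 0 ->
  (forall x s, E x -> (0 < s)%R -> s%:E < g x -> ~ N x -> F x /\ s%:E < h x) ->
  J E g <= J F h.
Proof.
move=> N0 Eg; apply: le_esum => m _.
rewrite lee_wpmul2l ?lee_fin ?exprz_ge0// -[leRHS]adde0 -N0.
apply: hcontentU => x [Ex gx]; have [Nx|nNx] := pselect (N x); [by right|left].
by apply: (Eg x _ Ex _ gx nNx); exact: exprz_gt0.
Qed.

Lemma dchoquet_le E g F h :
  (forall x s, E x -> (0 < s)%R -> s%:E < g x -> F x /\ s%:E < h x) ->
  J E g <= J F h.
Proof.
by move=> Eg; apply: (@dchoquet_le_ae set0) => [|x s Ex s0 sg _];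
  [exact: hcontent0|exact: Eg].
Qed.

Lemma le_dchoquet E F g h : E `<=` F -> (forall x, E x -> g x <= h x) ->
  J E g <= J F h.
Proof.
move=> EF gh; apply: dchoquet_le => x s Ex s0 sg; split; first exact: EF.
by apply: lt_le_trans sg _; exact: gh.
Qed.

Lemma eq_dchoquet E g h : (forall x, E x -> g x = h x) -> J E g = J E h.
Proof.
by move=> gh; apply/eqP; rewrite eq_le; apply/andP; split; apply: le_dchoquet => // x Ex;
  rewrite gh.
Qed.

Lemma dchoquet_shift (k : int) E g :
  J E (fun x => ((2 ^ k)%R)%:E * g x) = ((2 ^ k)%R)%:E * J E g.
Proof.
rewrite -esumZl ?exprz_ge0//.
rewrite /dchoquet (reindex_esum [set: int] _ (fun m => m + k)%R); last first.
  by split=> // [m m' _ _ /addIr//|m _]; exists (m - k)%R => //; exact: subrK.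
apply: eq_esum => m _; rewrite muleA -EFinM -expfzDr// addrC.
congr (_ * H _); apply/seteqP; split => x [Ex gx]; split => //.
  by move: gx; rewrite expfzDr// EFinM lte_pmul2l// lte_fin exprz_gt0.
by rewrite expfzDr// EFinM lte_pmul2l// lte_fin exprz_gt0.
Qed.

Lemma pow2_ceil (c : R) : (0 < c)%R -> exists k : int, (c <= 2 ^ k <= 2 * c)%R.
Proof.
move=> c0; have [m /andP[h1 h2]] := @exprz_floor R 2 c (ltr1n _ 2) c0.
exists (m + 1)%R; rewrite (ltW h2)/= expfzDr// expr1z mulrC.
by rewrite ler_pM2l.
Qed.

(** Powers of 2 pass through [J] exactly by a shift of the levels; [c] is rounded up to one, at the
    cost of a factor 2. *)
Lemma dchoquetZ (c : R) E g : (0 < c)%R -> (forall x, 0 <= g x) ->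
  J E (fun x => c%:E * g x) <= ((2 * c)%R)%:E * J E g.
Proof.
move=> c0 g0; have [k /andP[ck kc]] := pow2_ceil c0.
apply: (@le_trans _ _ (J E (fun x => ((2 ^ k)%R)%:E * g x))).
  by apply: le_dchoquet => // x _; rewrite lee_wpmul2r// lee_fin.
by rewrite dchoquet_shift lee_wpmul2r ?dchoquet_ge0// lee_fin.
Qed.

Lemma dchoquetZ_ge (c : R) E g : (0 < c)%R -> (forall x, 0 <= g x) ->
  c%:E * J E g <= 2%:E * J E (fun x => c%:E * g x).
Proof.
move=> c0 g0; rewrite -lee_pdivlMl//.
have -> : J E g = J E (fun x => (c^-1)%:E * (c%:E * g x)).
  by apply: eq_dchoquet => x _; rewrite muleA -EFinM mulVf ?gt_eqF// mul1e.
apply: le_trans (dchoquetZ _ _ _) _; rewrite ?invr_gt0//.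
  by move=> x; rewrite mule_ge0// lee_fin ltW.
by rewrite mulrC EFinM muleA.
Qed.

Lemma dchoquet_cst (c : R) E : (0 < c)%R ->
  J E (fun=> c%:E) <= ((2 * c)%R)%:E * H E.
Proof.
move=> c0; have [k /andP[ck kc]] := pow2_ceil c0.
(* Levels [m >= k] are empty because [c <= 2^k]. The others form a geometric series with sum
   [2 * 2^(k-1) = 2^k <= 2 * c]. *)
rewrite /dchoquet (esumID [set m : int | (m <= k - 1)%R])//.
rewrite [X in _ + X]esum1 ?adde0; last first.
  move=> m [_ /= mk]; rewrite (_ : [set x | _] = set0) ?hcontent0 ?mule0//.
  apply/seteqP; split => // x [_]; rewrite lte_fin => mc.
  have := lt_le_trans mc ck; rewrite ltr_eXz2l ?ltr1n//; lia.
apply: (@le_trans _ _ (\esum_(m in [set m : int | (m <= k - 1)%R])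
    ((2^-1 ^ (k - 1 - m))%R)%:E * (((2 ^ (k - 1))%R)%:E * H E))).
  rewrite setTI; apply: le_esum => m _; rewrite muleA -EFinM.
  rewrite exprz_inv -expfzDr// opprB subrK.
  rewrite lee_wpmul2l ?lee_fin ?exprz_ge0//; apply: hcontent_le => x [] //.
have k2 : (2 ^ (k - 1) = 2^-1 * 2 ^ k :> R)%R.
  by rewrite expfzDr// -invr_expz expr1z mulrC.
have [Hoo|Hoo] := eqVneq (H E) +oo.
  by rewrite Hoo [leRHS]gt0_muley ?leey// lte_fin mulr_gt0.
have Hfin : H E \is a fin_num by rewrite ge0_fin_numE ?hcontent_ge0// ltey.
rewrite -(fineK Hfin) -EFinM esumZr; last 2 first.
- by rewrite mulr_ge0 ?exprz_ge0// fine_ge0// hcontent_ge0.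
- by move=> m; rewrite lee_fin exprz_ge0// invr_ge0.
apply: (@le_trans _ _ (((1 - 2^-1)^-1)%:E * (2 ^ (k - 1) * fine (H E))%:E)).
  apply: lee_wpmul2r.
    by rewrite lee_fin mulr_ge0 ?exprz_ge0// fine_ge0// hcontent_ge0.
  by apply: geometric_down_le; lra.
rewrite -!EFinM lee_fin mulrA ler_wpM2r ?fine_ge0 ?hcontent_ge0// k2.
have -> : ((1 - 2^-1)^-1 = 2 :> R)%R by field.
by rewrite mulrA divff// mul1r.
Qed.

Lemma dchoquet_chebyshev (s : R) E g : (0 < s)%R ->
  s%:E * H [set x | E x /\ s%:E < g x] <= 2%:E * J E g.
Proof.
move=> s0; have [m /andP[h1 h2]] := @exprz_floor R 2 s (ltr1n _ 2) s0.
apply: (@le_trans _ _ (2%:E * (((2 ^ m)%R)%:E * H [set x | E x /\ ((2 ^ m)%R)%:E < g x]))).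
  have h3 : (s <= 2 * 2 ^ m)%R by rewrite ltW// mulrC -[X in (_ * X)%R]expr1z -expfzDr.
  rewrite muleA -EFinM; apply: lee_pmul; rewrite ?hcontent_ge0 ?lee_fin ?(ltW s0)//.
  apply: hcontent_le => x [Ex sg]; split => //.
  by apply: le_lt_trans sg; rewrite lee_fin.
by rewrite lee_wpmul2l//; exact: (@esum_ge1 _ _ _ (fun m : int =>
  ((2 ^ m)%R)%:E * H [set x | E x /\ ((2 ^ m)%R)%:E < g x])).
Qed.

(** The strict version at [s / 2] covers the non-strict level set and doubles the constant. *)
Lemma dchoquet_chebyshev_le (s : R) E g : (0 < s)%R ->
  s%:E * H [set x | E x /\ s%:E <= g x] <= 4%:E * J E g.
Proof.
move=> s0; have s20 : (0 < s / 2)%R by rewrite divr_gt0.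
have := @dchoquet_chebyshev (s / 2) E g s20.
move=> /(lee_wpmul2l (_ : 0 <= 2%:E)) => /(_ (ler0n _ _)).
rewrite !muleA -!EFinM (_ : 2 * 2 = 4 :> R)%R; last by ring.
apply: le_trans; rewrite (_ : 2 * (s / 2) = s)%R; last by field.
apply: lee_wpmul2l; [by rewrite lee_fin ltW|apply: hcontent_le] => x [Ex sg]; split => //.
by apply: lt_le_trans sg; rewrite lte_fin; lra.
Qed.

Lemma dchoquet_cst_ge (c : R) E : (0 < c)%R -> c%:E * H E <= 4%:E * J E (fun=> c%:E).
Proof.
move=> c0; apply: le_trans (@dchoquet_chebyshev_le c E (fun=> c%:E) c0).
apply: lee_wpmul2l; [by rewrite lee_fin ltW|apply: hcontent_le] => x Ex; split => //=.
Qed.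

Lemma dchoquet_null E g : H E = 0 -> J E g = 0.
Proof.
move=> E0; apply: esum1 => m _; rewrite (_ : H _ = 0) ?mule0//.
by apply/eqP; rewrite eq_le hcontent_ge0 andbT -E0; apply: hcontent_le => x [].
Qed.

End DyadicChoquet.

(* The grid of parameter [alpha] consists of the cubes
   [3^k (m + alpha / 2 + ]0, 1]^n)] with integer [k] and [m]; since 3 is odd,
   the shift by one half is compatible with nesting. *)
Definition cell (n : nat) : Type := (int * 'rV[int]_n)%type.
HB.instance Definition _ n := Countable.on (cell n).

(** * Shifted triadic grids: nesting of cells, and cells against cubes *)

Section Grid.
Context {R : realType} {n : nat}.
Implicit Types (alpha : {ffun 'I_n -> bool}) (P Q : cell n) (k : int).

Lemma side_gt0 k : (0 < 3 ^ k :> R)%R.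
Proof. exact: exprz_gt0. Qed.

Lemma side_mulK k (u : R) : (3 ^ k * u / 3 ^ k = u)%R.
Proof. by rewrite mulrAC divff ?mul1r// gt_eqF// side_gt0. Qed.

Definition cell_cube alpha P : cube R n :=
  Cube (\row_i (3 ^ P.1 * ((P.2 ord0 i)%:~R + (alpha i)%:R / 2)))%R
       (side_gt0 P.1).

Definition cset alpha P : set 'rV[R]_n := cube_set (cell_cube alpha P).

Lemma csetE alpha P (x : 'rV[R]_n) : cset alpha P x <-> forall i : 'I_n,
  ((P.2 ord0 i)%:~R + (alpha i)%:R / 2 < x ord0 i / 3 ^ P.1 <=
   (P.2 ord0 i)%:~R + (alpha i)%:R / 2 + 1)%R.
Proof.
have s0 := side_gt0 P.1.
have s00 : (3 ^ P.1 != 0 :> R)%R by rewrite gt_eqF.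
split => h i; have := h i; rewrite /= !mxE.
  move=> /andP[h1 h2]; rewrite ltr_pdivlMr// ler_pdivrMr// mulrC h1/=.
  by apply: le_trans h2 _; rewrite mulrDl mul1r mulrC.
rewrite ltr_pdivlMr// ler_pdivrMr// => /andP[h1 h2].
rewrite mulrC h1/=; apply: le_trans h2 _.
by rewrite mulrDl mul1r.
Qed.

Lemma cell_at alpha k (x : 'rV[R]_n) : exists P, P.1 = k /\ cset alpha P x.
Proof.
exists (k, \row_i (Num.ceil (x ord0 i / 3 ^ k - (alpha i)%:R / 2) - 1)%R); split => //.
apply/csetE => i; rewrite /= !mxE.
set y := (x ord0 i / 3 ^ k - _)%R.
have := ceil_itv y; rewrite intrD rmorphN1 => /andP[h1 h2].
by apply/andP; split; rewrite /y in h1 h2 *; lra.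
Qed.

(** With an odd ratio, [(2 N + 1) * a / 2] equals [N * a + a / 2], so the endpoints of the long
    interval lie on the lattice of the short ones; a common point [y] then forces nesting. *)
Lemma half_shift_nested (N m m' : int) (a : bool) (y : R) :
  (0 <= N)%R ->
  (m%:~R + a%:R / 2 < y <= m%:~R + a%:R / 2 + 1)%R ->
  ((2 * N + 1)%:~R * (m'%:~R + a%:R / 2) < y <=
   (2 * N + 1)%:~R * (m'%:~R + a%:R / 2 + 1))%R ->
  ((2 * N + 1)%:~R * (m'%:~R + a%:R / 2) <= m%:~R + a%:R / 2 :> R)%R /\
  (m%:~R + a%:R / 2 + 1 <= (2 * N + 1)%:~R * (m'%:~R + a%:R / 2 + 1) :> R)%R.
Proof.
move=> N0 /andP[h1 h2] /andP[h3 h4].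
pose A : int := (a : nat)%:Z.
have E : (a%:R = A%:~R :> R)%R by [].
have e1 : ((2 * N + 1)%:~R * (m'%:~R + a%:R / 2) =
  ((2 * N + 1) * m' + N * A)%:~R + a%:R / 2 :> R)%R.
  by rewrite E !(intrD, intrM); field.
have e2 : ((2 * N + 1)%:~R * (m'%:~R + a%:R / 2 + 1) =
  ((2 * N + 1) * m' + N * A + (2 * N + 1))%:~R + a%:R / 2 :> R)%R.
  by rewrite E !(intrD, intrM); field.
rewrite e1 e2 in h3 h4 *.
have g1 : (((2 * N + 1) * m' + N * A)%:~R < (m + 1)%:~R :> R)%R.
  by rewrite [in ltRHS]intrD; lra.
have g2 : (m%:~R < ((2 * N + 1) * m' + N * A + (2 * N + 1))%:~R :> R)%R by lra.
move: g1 g2; rewrite !ltr_int => g1 g2; split.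
  by rewrite lerD2r ler_int; lia.
rewrite addrAC lerD2r -[X in (_ + X)%R](_ : 1%:~R = 1%R)// -intrD ler_int; lia.
Qed.

Lemma pow3_odd (d : nat) : exists N : int, (0 <= N)%R /\ (3 ^+ d = 2 * N + 1 :> int)%R.
Proof.
elim: d => [|d [N [N0 IH]]]; first by exists 0%R.
exists (3 * N + 1)%R; split; first by lia.
by rewrite exprS IH; lia.
Qed.

Lemma cset_nested alpha P Q x : cset alpha P x -> cset alpha Q x ->
  (P.1 <= Q.1)%R -> cset alpha P `<=` cset alpha Q.
Proof.
move=> Px Qx PQ y Py; apply/csetE => i.
have [d dE] : exists d : nat, Q.1 = (P.1 + d%:Z)%R.
  by exists `|Q.1 - P.1|%N; lia.
have [N [N0 NE]] := pow3_odd d.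
have s0 := side_gt0 P.1; have s00 : (3 ^ P.1 != 0 :> R)%R by rewrite gt_eqF.
have QE : (3 ^ Q.1 = 3 ^ P.1 * (2 * N + 1)%:~R :> R)%R.
  by rewrite dE expfzDr// -NE rmorphXn.
have N1 : (0 < (2 * N + 1)%:~R :> R)%R by rewrite ltr0z; lia.
have /csetE/(_ i) px := Px; have /csetE/(_ i) qx := Qx; have /csetE/(_ i) py := Py.
have E (z a b : R) : (a < z / 3 ^ Q.1 <= b)%R =
    ((2 * N + 1)%:~R * a < z / 3 ^ P.1 <= (2 * N + 1)%:~R * b)%R.
  rewrite QE invfM mulrA ltr_pdivlMr// ler_pdivrMr//.
  by rewrite ![(_ * (2 * N + 1)%:~R)%R]mulrC.
rewrite E in qx; rewrite E.
have [g1 g2] := half_shift_nested N0 px qx.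
by have /andP[p1 p2] := py; rewrite (le_lt_trans g1 p1) (le_trans p2 g2).
Qed.

Lemma cset_inj alpha P Q x : cset alpha P x -> cset alpha Q x -> P.1 = Q.1 -> P = Q.
Proof.
case: P Q => [k m] [k' m'] /csetE/= Px /csetE/= Qx kk; subst k'; congr pair.
apply/rowP => i; suff : m ord0 i = m' ord0 i by []; move: (Px i) (Qx i) => /andP[h1 h2] /andP[h3 h4].
have g1 : ((m ord0 i)%:~R < (m' ord0 i + 1)%:~R :> R)%R by rewrite intrD; lra.
have g2 : ((m' ord0 i)%:~R < (m ord0 i + 1)%:~R :> R)%R by rewrite intrD; lra.
by move: g1 g2; rewrite !ltr_int; lia.
Qed.

Lemma cset_neq0 alpha P : exists x, cset alpha P x.
Proof.
exists (\row_i (3 ^ P.1 * ((P.2 ord0 i)%:~R + (alpha i)%:R / 2 + 1)))%R.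
by apply/csetE => i; rewrite !mxE side_mulK lexx andbT ltrDl.
Qed.

(** Along the coordinate [i0], the points of [P] with parameters [1/3] and [1] are [2/3] of a side
    of [P] apart, too far for a cell of strictly smaller scale. In dimension zero all cells
    coincide, hence the coordinate [i0]. *)
Lemma cset_scale (i0 : 'I_n) alpha P Q :
  cset alpha P `<=` cset alpha Q -> (P.1 <= Q.1)%R.
Proof.
move=> PQ; rewrite leNgt; apply/negP => QP.
have [x Px] := cset_neq0 alpha P; have Qx := PQ _ Px.
have QsP := cset_nested Qx Px (ltW QP).
pose c (t : R) : 'rV[R]_n := (\row_i (3 ^ P.1 * ((P.2 ord0 i)%:~R + (alpha i)%:R / 2 + t)))%R.
have cP t : (0 < t <= 1)%R -> cset alpha P (c t).
  move=> t01; apply/csetE => i; rewrite !mxE side_mulK.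
  by rewrite ltrDl lerD2l.
have s0 := side_gt0 P.1; have s0' := side_gt0 Q.1.
have s3 : (3 * 3 ^ Q.1 <= 3 ^ P.1 :> R)%R.
  by rewrite -[X in (X * _ <= _)%R]expr1z -expfzDr// ler_eXz2l ?ltr1n//; lia.
have /csetE/(_ i0)/andP[_ h1] : cset alpha Q (c 1%R) by apply: PQ; apply: cP; lra.
have /csetE/(_ i0)/andP[h2 _] : cset alpha Q (c 3^-1%R) by apply: PQ; apply: cP; lra.
move: h1 h2; rewrite !mxE ltr_pdivlMr// ler_pdivrMr//.
set u := ((P.2 ord0 i0)%:~R + _)%R; set v := ((Q.2 ord0 i0)%:~R + _)%R.
move=> h1 h2.
have : (3 ^ P.1 * (2 / 3) < 3 ^ Q.1 :> R)%R by lra.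
by move: s3 s0; lra.
Qed.

(** The side [s] satisfies [2 * edge Q < s <= 6 * edge Q]. In each coordinate the edge of [Q] has
    length below [s / 2], so it either fits in an unshifted interval or crosses one lattice point
    and fits in the interval shifted by half a period. *)
Lemma cube_in_cell (Q : cube R n) : exists alpha P,
  cube_set Q `<=` cset alpha P /\ (3 ^ P.1 <= 6 * edge Q)%R.
Proof.
have e0 := edge_gt0 Q.
have l0 : (0 < 2 * edge Q)%R by rewrite mulr_gt0.
have [m /andP[m1 m2]] := @exprz_floor R 3 _ (ltr1n _ 3) l0.
set s := (3 ^ (m + 1))%R in m2; have s0 : (0 < s)%R by exact: side_gt0.
have s6 : (s <= 6 * edge Q)%R.
  by rewrite /s expfzDr// expr1z; lra.
pose f i := Num.floor (corner Q ord0 i / s).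
pose alpha : {ffun 'I_n -> bool} :=
  [ffun i => ~~ ((corner Q ord0 i + edge Q) / s <= (f i + 1)%:~R)%R].
exists alpha, ((m + 1)%R, \row_i f i); split => // x Qx; apply/csetE => i.
have /andP[q1 q2] := Qx i; rewrite /= !mxE /alpha ffunE.
have := floor_itv (corner Q ord0 i / s); rewrite -/(f i) => /andP[f1 f2].
have g1 : (corner Q ord0 i / s < x ord0 i / s)%R by rewrite ltr_pM2r ?invr_gt0.
have g2 : (x ord0 i / s <= (corner Q ord0 i + edge Q) / s)%R.
  by rewrite ler_pM2r ?invr_gt0.
have g3 : (edge Q / s < 2^-1)%R by rewrite ltr_pdivrMr//; lra.
rewrite mulrDl in g2 *; rewrite intrD in f2 *.
rewrite -/s; case: (leP (corner Q ord0 i / s + edge Q / s) ((f i)%:~R + 1%:~R))%R => /= h;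
  apply/andP; split; lra.
Qed.

(** At a scale between [edge Q] and [3 * edge Q], the cube meets at most two consecutive intervals
    in each coordinate; [b] chooses one of them per coordinate. *)
Lemma cube_cell_cover alpha (Q : cube R n) :
  exists P : {ffun 'I_n -> bool} -> cell n,
    cube_set Q `<=` \bigcup_b cset alpha (P b) /\
    forall b, (3 ^ (P b).1 <= 3 * edge Q)%R.
Proof.
have e0 := edge_gt0 Q.
have [m /andP[m1 m2]] := @exprz_floor R 3 _ (ltr1n _ 3) e0.
set s := (3 ^ (m + 1))%R in m2; have s0 : (0 < s)%R by exact: side_gt0.
have s3 : (s <= 3 * edge Q)%R.
  by rewrite /s expfzDr// expr1z; lra.
pose f i := Num.floor (corner Q ord0 i / s - (alpha i)%:R / 2).
exists (fun b : {ffun 'I_n -> bool} =>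
  ((m + 1)%R, \row_i (f i + (b i : nat)%:Z)%R)); split => // x Qx.
exists [ffun i => ~~ (x ord0 i / s <= (f i + 1)%:~R + (alpha i)%:R / 2)%R] => //.
apply/csetE => i; rewrite /= !mxE ffunE.
have /andP[q1 q2] := Qx i.
have := floor_itv (corner Q ord0 i / s - (alpha i)%:R / 2).
rewrite -/(f i) => /andP[f1 f2].
have g1 : (corner Q ord0 i / s < x ord0 i / s)%R by rewrite ltr_pM2r ?invr_gt0.
have g2 : (x ord0 i / s <= (corner Q ord0 i + edge Q) / s)%R.
  by rewrite ler_pM2r ?invr_gt0.
have g3 : (edge Q / s < 1)%R by rewrite ltr_pdivrMr//; lra.
rewrite mulrDl in g2 *; rewrite intrD in f2 *; rewrite intrD.
rewrite -/s; case: (leP (x ord0 i / s) ((f i)%:~R + 1%:~R + (alpha i)%:R / 2))%R => /= h;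
  apply/andP; split; lra.
Qed.

End Grid.

Lemma esum_finType_le (R : realType) (T : finType) (a : T -> \bar R) (c : R) :
  (0 <= c)%R -> (forall b, a b <= c%:E) ->
  \esum_(b in [set: T]) a b <= (#|T|%:R * c)%:E.
Proof.
move=> c0 ac; apply: esum_ub => s us _.
apply: (@le_trans _ _ (\sum_(i <- s) c%:E)); first by apply: lee_sum => i _.
rewrite sumEFin lee_fin big_const_seq count_predT iter_addr_0 -[leLHS]mulr_natl.
rewrite ler_wpM2r// ler_nat; have /card_uniqP <- := us; exact: max_card.
Qed.

(** * Covers of level sets by cells of one grid *)

Section Cells.
Context {R : realType} {n : nat}.
Variables (i0 : 'I_n) (delta : R) (delta_gt0 : (0 < delta)%R).
Variable alpha : {ffun 'I_n -> bool}.
Local Notation X := 'rV[R]_n.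
Local Notation H := (@hcontent R n delta).
Local Notation J := (@dchoquet R n delta).
Local Notation cs := (@cset R n alpha).
Implicit Types (P Q : cell n) (E : set X) (h : X -> \bar R).

Definition lam P : R := ((3 ^ P.1) `^ delta)%R.

Definition subc P Q := cs P `<=` cs Q.

Lemma lam_gt0 P : (0 < lam P)%R.
Proof. by rewrite powR_gt0// side_gt0. Qed.

Lemma lam_ge0 P : (0 <= lam P)%R.
Proof. exact/ltW/lam_gt0. Qed.

Lemma hcontent_cset P : H (cs P) <= (lam P)%:E.
Proof. exact: hcontent_cube. Qed.

Lemma lam_le_scale P Q : (P.1 <= Q.1)%R -> (lam P <= lam Q)%R.
Proof.
move=> PQ; apply: ge0_ler_powR; rewrite ?nnegrE ?exprz_ge0 ?(ltW delta_gt0)//.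
by rewrite ler_eXz2l// ltr1n.
Qed.

Lemma lam_le P Q : subc P Q -> (lam P <= lam Q)%R.
Proof. by move=> /(cset_scale i0)/lam_le_scale. Qed.

Lemma subc_trans Q P P' : subc P Q -> subc Q P' -> subc P P'.
Proof. exact: subset_trans. Qed.

Lemma subc_total x P Q : cs P x -> cs Q x -> subc P Q \/ subc Q P.
Proof.
move=> Px Qx; case: (leP P.1 Q.1) => PQ; [left|right].
  exact: cset_nested Px Qx PQ.
exact: cset_nested Qx Px (ltW PQ).
Qed.

Lemma subc_anti P Q : subc P Q -> subc Q P -> P = Q.
Proof.
move=> PQ QP; have [x Px] := cset_neq0 (R := R) alpha P.
apply: (cset_inj Px (PQ _ Px)); apply/eqP; rewrite eq_le.
by rewrite (cset_scale i0 PQ) (cset_scale i0 QP).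
Qed.

(** A level, the number of a cube in a cover of that level set, and a choice among the cells that
    replace this cube. *)
Definition cover_index := (int * (nat * {ffun 'I_n -> bool}))%type.

Definition level_cover E h (D : set cover_index) (lev : cover_index -> int)
    (cel : cover_index -> cell n) :=
  forall x m, E x -> ((2 ^ m)%R)%:E < h x ->
    exists i, [/\ D i, lev i = m & cs (cel i) x].

Definition cover_mass (D : set cover_index) (lev : cover_index -> int)
    (cel : cover_index -> cell n) : \bar R :=
  \esum_(i in D) (2 ^ lev i * lam (cel i))%:E.

(** The loss in replacing a cube by [2^n] cells with edges at most three times longer. *)
Definition cell_constant : R := (#|{ffun 'I_n -> bool}|%:R * 3 `^ delta)%R.

Lemma cell_constant_gt0 : (0 < cell_constant)%R.
Proof.
rewrite mulr_gt0 ?powR_gt0// ltr0n; apply/card_gt0P.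
by exists [ffun=> true].
Qed.

Lemma level_cover_exists E h (e : R) : J E h < +oo -> (0 < e)%R ->
  exists D lev cel, level_cover E h D lev cel /\
    cover_mass D lev cel <= cell_constant%:E * (J E h + e%:E).
Proof.
move=> Jfin e0.
pose L (m : int) := [set x | E x /\ ((2 ^ m)%R)%:E < h x].
pose eps (m : int) : R := (e / (2 ^ (pickle m).+1)%:R)%R.
have eps0 m : (0 < eps m)%R by rewrite divr_gt0// ltr0n expn_gt0.
have p2 (m : int) : (0 < 2 ^ m :> R)%R by rewrite exprz_gt0.
have HL m : H (L m) \is a fin_num.
  rewrite ge0_fin_numE ?hcontent_ge0//.
  have : ((2 ^ m)%R)%:E * H (L m) < +oo.
    apply: le_lt_trans Jfin.
    exact: (@esum_ge1 _ _ setT (fun m : int => ((2 ^ m)%R)%:E * H (L m)) m).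
  rewrite !ltey; apply: contra => /eqP ->.
  by rewrite gt0_muley// lte_fin.
(* A cover of level [m] enters the mass with the factor [2^m], so its excess is taken to be
   [eps m / 2^m]. *)
have /choice[g gP] : forall m, exists DQ : set nat * (nat -> cube R n),
    L m `<=` \bigcup_(j in DQ.1) cube_set (DQ.2 j) /\
    \esum_(j in DQ.1) ((edge (DQ.2 j) `^ delta)%R)%:E <=
      H (L m) + (eps m / 2 ^ m)%:E.
  move=> m.
  have /hcontent_lt[D' [Q' [c1 c2]]] : H (L m) < H (L m) + (eps m / 2 ^ m)%:E.
    by rewrite lteDl// lte_fin divr_gt0.
  by exists (D', Q'); split => //; exact: ltW.
have /choice[pc pcP] := cube_cell_cover (R := R) alpha.
pose D : set cover_index :=
  [set: int] `*`` (fun m => (g m).1 `*`` (fun=> [set: {ffun 'I_n -> bool}])).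
exists D, fst, (fun i => pc ((g i.1).2 i.2.1) i.2.2); split.
  move=> x m Ex hx; have [j Dj Qj] := (gP m).1 x (conj Ex hx).
  by have [b _ Pb] := (pcP _).1 _ Qj; exists (m, (j, b)).
rewrite /cover_mass /D -(@esum_esum _ _ _ setT
  (fun m => (g m).1 `*`` (fun=> [set: {ffun 'I_n -> bool}]))
  (fun m jb => (2 ^ m * lam (pc ((g m).2 jb.1) jb.2))%:E)); last first.
  by move=> m jb _ _; rewrite lee_fin mulr_ge0 ?lam_ge0// ltW.
apply: (@le_trans _ _ (\esum_(m in [set: int])
   cell_constant%:E * (((2 ^ m)%R)%:E * H (L m) + (eps m)%:E))); last first.
  rewrite esumZl ?(ltW cell_constant_gt0)//; last first.
    by move=> m; rewrite adde_ge0 ?mule_ge0 ?hcontent_ge0// lee_fin ltW.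
  rewrite lee_wpmul2l ?lee_fin ?(ltW cell_constant_gt0)// esumD//; last 2 first.
  - by move=> m _; rewrite mule_ge0 ?hcontent_ge0// lee_fin ltW.
  - by move=> m _; rewrite lee_fin ltW.
  by rewrite leeD2l// esum_epsilon// ltW.
apply: le_esum => m _.
rewrite -(@esum_esum _ _ _ (g m).1 (fun=> [set: {ffun 'I_n -> bool}])
  (fun j b => (2 ^ m * lam (pc ((g m).2 j) b))%:E)); last first.
  by move=> j b _ _; rewrite lee_fin mulr_ge0 ?lam_ge0// ltW.
apply: (@le_trans _ _ (\esum_(j in (g m).1)
    ((cell_constant * 2 ^ m)%:E * ((edge ((g m).2 j) `^ delta)%R)%:E))).
  apply: le_esum => j _; rewrite -EFinM /cell_constant -!mulrA.
  apply: esum_finType_le => [|b].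
    by rewrite !mulr_ge0 ?powR_ge0// ltW.
  rewrite lee_fin mulrCA ler_wpM2l ?(ltW (p2 _))//.
  have l0 := edge_gt0 ((g m).2 j).
  rewrite -powRM// ?(ltW l0)//; apply: ge0_ler_powR.
  - exact: ltW.
  - by rewrite nnegrE exprz_ge0.
  - by rewrite nnegrE mulr_ge0// ltW.
  - exact: (pcP _).2.
rewrite esumZl; last 2 first.
- by rewrite mulr_ge0 ?(ltW cell_constant_gt0)// ltW.
- by move=> j; rewrite lee_fin powR_ge0.
rewrite EFinM -muleA lee_wpmul2l ?lee_fin ?(ltW cell_constant_gt0)//.
apply: (@le_trans _ _ (((2 ^ m)%R)%:E * (H (L m) + (eps m / 2 ^ m)%:E))).
  by rewrite lee_wpmul2l ?lee_fin ?(ltW (p2 _))//; exact: (gP m).2.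
have q0 : (0 <= eps m / 2 ^ m)%R by rewrite divr_ge0// ltW.
rewrite ge0_muleDr ?hcontent_ge0//.
by rewrite -EFinM (_ : 2 ^ m * (eps m / 2 ^ m) = eps m)%R// mulrC divfK ?gt_eqF.
Qed.

(** There are covers of mass close to [cell_constant * J E h], so testing against all covers of
    finite mass suffices. The packing bound, the bound on unions of cells and the layer-cake bound
    are all obtained this way. *)
Lemma le_dchoquet_cover E h (x : \bar R) (C : R) : (0 < C)%R ->
  (forall D lev cel, level_cover E h D lev cel -> cover_mass D lev cel < +oo ->
     x <= C%:E * cover_mass D lev cel) ->
  x <= (C * cell_constant)%:E * J E h.
Proof.
move=> C0 xC; have cc0 := cell_constant_gt0.
have [Joo|Joo] := eqVneq (J E h) +oo.
  by rewrite Joo gt0_muley ?leey// lte_fin mulr_gt0.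
have Jfin : J E h < +oo by rewrite ltey.
apply/lee_addgt0Pr => e e0.
have e'0 : (0 < e / (C * cell_constant))%R by rewrite divr_gt0// mulr_gt0.
have [D [lev [cel [cov mass]]]] := level_cover_exists Jfin e'0.
have Jnum : J E h \is a fin_num by rewrite ge0_fin_numE ?dchoquet_ge0.
apply: (@le_trans _ _ (C%:E * cover_mass D lev cel)).
  apply: xC cov _; apply: le_lt_trans mass _.
  by rewrite -(fineK Jnum) -EFinD -EFinM ltey.
apply: (@le_trans _ _ (C%:E * (cell_constant%:E * (J E h + (e / (C * cell_constant))%:E)))).
  by rewrite lee_wpmul2l// lee_fin ltW.
rewrite muleA -EFinM muleDr// ?fin_num_adde_defl// -EFinM.
by rewrite [X in _ + X%:E <= _](_ : _ = e)//; field; rewrite !gt_eqF.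
Qed.

End Cells.

(** * Localization of covers and superadditivity along Carleson packings *)

Section Packing.
Context {R : realType} {n : nat}.
Variables (i0 : 'I_n) (delta : R) (delta_gt0 : (0 < delta)%R).
Variable alpha : {ffun 'I_n -> bool}.
Local Notation X := 'rV[R]_n.
Local Notation H := (@hcontent R n delta).
Local Notation J := (@dchoquet R n delta).
Local Notation cs := (@cset R n alpha).
Local Notation lam := (@lam R n delta).
Local Notation subc := (@subc R n alpha).
Local Notation level_cover := (@level_cover R n alpha).
Local Notation cover_mass := (@cover_mass R n delta).
Local Notation cell_constant := (@cell_constant R n delta).
Implicit Types (P Q : cell n) (E : set X) (h : X -> \bar R).

Definition cdisjoint (I : Type) (S : set I) (s : I -> cell n) :=
  forall i j x, S i -> S j -> cs (s i) x -> cs (s j) x -> i = j.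

(** Cells are non-empty, so each [F j] lies in at most one member of the disjoint family and is
    counted at most once. *)
Lemma antichain_esum_le (I T : choiceType) (S : set I) (s : I -> cell n)
    (D : set T) (F : T -> cell n) (a : T -> \bar R) :
  cdisjoint S s -> (forall j, 0 <= a j) ->
  \esum_(i in S) \esum_(j in [set j | D j /\ subc (F j) (s i)]) a j <=
  \esum_(j in D) a j.
Proof.
move=> dS a0; rewrite (esum_exchange _ _ (fun i j => subc (F j) (s i))
  (a := fun _ j => a j))//.
apply: le_esum => j _; apply: esum_subsingleton => //.
- move=> i i' /= [Si ji] [Si' ji']; have [x Fx] := cset_neq0 (R := R) alpha (F j).
  by apply: dS Si Si' (ji _ Fx) (ji' _ Fx).
- by move=> i _; rewrite a0 lexx.
Qed.

Definition mass_below (D : set (@cover_index n)) lev cel Q : \bar R :=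
  \esum_(i in [set i | D i /\ subc (cel i) Q]) (2 ^ lev i * lam (cel i))%:E.

Let lev_lam_ge0 (m : int) Q : (0 <= 2 ^ m * lam Q)%R.
Proof. by rewrite mulr_ge0 ?exprz_ge0// lam_ge0. Qed.

Lemma mass_below_ge0 D lev cel Q : 0 <= mass_below D lev cel Q.
Proof. by apply: esum_ge0 => i _; rewrite lee_fin. Qed.

(** A cover cell of level [m] has to account for all values in [[2^m, 2^(m+1)[], hence the constant
    function [2^(m+1)]. *)
Lemma dchoquet_cst_cset (m : int) Q :
  J (cs Q) (fun=> ((2 ^ (m + 1))%R)%:E) <= (4 * (2 ^ m * lam Q))%:E.
Proof.
apply: le_trans (dchoquet_cst _ _) _; first exact: exprz_gt0.
apply: (@le_trans _ _ ((2 * 2 ^ (m + 1))%:E * (lam Q)%:E)).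
  rewrite lee_wpmul2l ?lee_fin ?mulr_ge0 ?exprz_ge0//; exact: hcontent_cset.
rewrite -EFinM lee_fin le_eqVlt; apply/orP; left; apply/eqP.
by rewrite expfzDr// expr1z; ring.
Qed.

(** A cover cell meeting [Q] lies in [Q] or contains it. Those inside give the mass below; among
    those containing [Q], one of highest level dominates all the others, so a single term from above
    remains. *)
Lemma cell_localization E h D lev cel Q :
  level_cover E h D lev cel -> cover_mass D lev cel < +oo -> cs Q `<=` E ->
  J (cs Q) h <= 4%:E * mass_below D lev cel Q \/
  exists i, [/\ D i, subc Q (cel i) &
    J (cs Q) h <= (4 * (2 ^ lev i * lam Q))%:E + 4%:E * mass_below D lev cel Q].
Proof.
move=> cov Mfin QE.
have below : \esum_(i in [set i | D i /\ subc (cel i) Q])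
    J (cs (cel i)) (fun=> ((2 ^ (lev i + 1))%R)%:E) <=
    4%:E * mass_below D lev cel Q.
  rewrite -esumZl//; last by move=> i; rewrite lee_fin.
  apply: le_esum => i _; rewrite -EFinM; exact: dchoquet_cst_cset.
have step x s : cs Q x -> (0 < s)%R -> s%:E < h x ->
    exists i, [/\ D i, cs (cel i) x, (s < 2 ^ (lev i + 1))%R &
      subc (cel i) Q \/ subc Q (cel i)].
  move=> Qx s0 sh; have [m /andP[m1 m2]] := @exprz_floor R 2 s (ltr1n _ 2) s0.
  have [|i [Di im ix]] := cov x m (QE _ Qx).
    by apply: le_lt_trans sh; rewrite lee_fin.
  exists i; split => //; first by rewrite im.
  exact: subc_total ix Qx.
pose Lv (m : int) := exists i, [/\ D i, subc Q (cel i) & lev i = m].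
have [exL|nexL] := pselect (exists m, Lv m); last first.
  left; apply: le_trans below; apply: dchoquet_le_sum => x s Qx s0 sh.
  have [i [Di ix si [iQ|Qi]]] := step x s Qx s0 sh.
    by exists i; split => //; rewrite lte_fin.
  by exfalso; apply: nexL; exists (lev i), i.
right.
have M0 : 0 <= cover_mass D lev cel by apply: esum_ge0 => i _; rewrite lee_fin.
have Mnum : cover_mass D lev cel \is a fin_num by rewrite ge0_fin_numE.
have lQ := @lam_gt0 R n delta Q.
(* A cover cell of level [m] above [Q] has mass at least [2^m * lam Q], so finite total mass bounds
   these levels; adding 1 keeps the bound positive for [exprz_floor]. *)
have c0 : (0 < fine (cover_mass D lev cel) / lam Q + 1)%R.
  by rewrite ltr_wpDl// divr_ge0 ?fine_ge0// ltW.
have [b /andP[_ b2]] := @exprz_floor R 2 _ (ltr1n _ 2) c0.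
have [|m [[i [Di Qi im]] imax]] := @int_ub_max Lv b exL.
  move=> m [i [Di Qi <-]]; rewrite -ltzD1.
  have h1 : (2 ^ lev i * lam Q <= fine (cover_mass D lev cel))%R.
    rewrite -lee_fin fineK//.
    apply: (@le_trans _ _ (2 ^ lev i * lam (cel i))%:E).
      rewrite lee_fin ler_wpM2l ?exprz_ge0//; exact: (lam_le i0 delta_gt0 Qi).
    exact: (@esum_ge1 _ _ D (fun i => (2 ^ lev i * lam (cel i))%:E)).
  have h2 : (2 ^ lev i < 2 ^ (b + 1) :> R)%R.
    apply: le_lt_trans b2; rewrite -lerBlDr ler_pdivlMr//.
    apply: le_trans h1; rewrite ler_wpM2r ?(ltW lQ)//; lra.
  by move: h2; rewrite ltr_eXz2l ?ltr1n//; lia.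
exists i; split => //.
apply: le_trans (leeD (dchoquet_cst_cset (lev i) Q) below).
apply: dchoquet_le_add_sum => x s Qx s0 sh.
have [j [Dj jx sj [jQ|Qj]]] := step x s Qx s0 sh.
  by right; exists j; split => //; rewrite lte_fin.
left; split => //; rewrite lte_fin; apply: lt_le_trans sj _.
rewrite ler_eXz2l ?ltr1n// lerD2r im; apply: imax; by exists j.
Qed.

(** Summing the localization over the family, the masses below add up to at most the mass of the
    cover by disjointness. The terms from above, grouped by cover cell, add up to at most [K] times
    that mass by the packing condition. *)
Lemma packing_dchoquet (I : choiceType) (S : set I) (s : I -> cell n) (K : R) E h :
  (0 <= K)%R -> cdisjoint S s -> (forall i, S i -> cs (s i) `<=` E) ->
  (forall P, \esum_(i in [set i | S i /\ subc (s i) P]) (lam (s i))%:E <=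
     (K * lam P)%:E) ->
  \esum_(i in S) J (cs (s i)) h <= (4 * (K + 1) * cell_constant)%:E * J E h.
Proof.
move=> K0 dS SE pack; apply: (@le_dchoquet_cover R n delta delta_gt0 alpha E h).
  by rewrite mulr_gt0// ltr_wpDl.
move=> D lev cel cov Mfin.
have p2 (m : int) : (0 <= 2 ^ m :> R)%R by rewrite exprz_ge0.
have term i : S i -> J (cs (s i)) h <=
    4%:E * (\esum_(j in [set j | D j /\ subc (s i) (cel j)]) (2 ^ lev j * lam (s i))%:E)
    + 4%:E * mass_below D lev cel (s i).
  move=> Si; have [le|[j [Dj ij le]]] := cell_localization cov Mfin (SE _ Si).
    apply: le_trans le _; rewrite leeDr// mule_ge0//.
    by apply: esum_ge0 => j _; rewrite lee_fin.
  apply: le_trans le _; rewrite leeD2r// EFinM lee_wpmul2l//.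
  exact: (@esum_ge1 _ _ [set j | D j /\ subc (s i) (cel j)]
    (fun j => (2 ^ lev j * lam (s i))%:E)).
apply: (le_trans (le_esum term)).
rewrite esumD; last 2 first.
- by move=> i _; rewrite mule_ge0//; apply: esum_ge0 => j _; rewrite lee_fin.
- by move=> i _; rewrite mule_ge0// mass_below_ge0.
rewrite !esumZl//; last 2 first.
- by move=> i; exact: mass_below_ge0.
- by move=> i; apply: esum_ge0 => j _; rewrite lee_fin.
rewrite -ge0_muleDr; last 2 first.
- by apply: esum_ge0 => i _; apply: esum_ge0 => j _; rewrite lee_fin.
- by apply: esum_ge0 => i _; exact: mass_below_ge0.
rewrite EFinM -muleA lee_wpmul2l// EFinD ge0_muleDl// mul1e leeD//; last first.
  by apply: antichain_esum_le => // j; rewrite lee_fin.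
rewrite (esum_exchange _ _ (fun i j => subc (s i) (cel j))
  (a := fun i j => (2 ^ lev j * lam (s i))%:E)); last by move=> i j; rewrite lee_fin.
rewrite /cover_mass -esumZl//; last by move=> j; rewrite lee_fin.
apply: le_esum => j Dj; under eq_esum do rewrite EFinM.
rewrite esumZl//; last by move=> i; rewrite lee_fin lam_ge0.
by rewrite -EFinM mulrCA EFinM lee_wpmul2l ?lee_fin.
Qed.

(** * Greedy selection of a packing *)

Section Greedy.
Variable QQ : set (cell n).

(** Adding [Q] changes the packing sum only of cells containing [Q], so only these are tested. *)
Let admissible (L : seq (cell n)) Q : Prop := QQ Q /\ forall P, subc Q P ->
  (\sum_(P' <- L | `[< subc P' P >]) lam P' + lam Q <= 2 * lam P)%R.

Let step (L : seq (cell n)) (i : nat) : seq (cell n) :=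
  if (unpickle i : option (cell n)) is Some Q then
    if `[< admissible L Q >] && (Q \notin L) then Q :: L else L
  else L.

Let greedy (i : nat) : seq (cell n) := foldl step [::] (iota 0 i).

Let greedyS i : greedy i.+1 = step (greedy i) i.
Proof. by rewrite /greedy -addn1 iotaD add0n foldl_cat. Qed.

Let greedy_sub i j : (i <= j)%N -> {subset greedy i <= greedy j}.
Proof.
move=> /subnK <-; elim: (j - i)%N => // k IH Q /IH.
rewrite addSn greedyS /step; case: unpickle => // P; case: ifP => // _.
by rewrite inE orbC => ->.
Qed.

Let greedy_inv i : [/\ uniq (greedy i), {subset greedy i <= QQ} &
  forall P, (\sum_(P' <- greedy i | `[< subc P' P >]) lam P' <= 2 * lam P)%R].
Proof.
elim: i => [|i [u sub pack]].
  by split => // P; rewrite big_nil mulr_ge0// lam_ge0.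
rewrite greedyS /step; case: unpickle => // Q.
case: ifP => // /andP[/asboolP[QQQ adm] QL]; split => /=.
- by rewrite QL.
- by move=> P; rewrite in_cons => /predU1P[->|/sub//]; exact/mem_set.
- move=> P; rewrite big_cons; case: asboolP => [/adm|_]; last exact: pack.
  by rewrite addrC.
Qed.

(* The selection is greedy along an enumeration of the cells: a cell is kept as
   long as the packing condition with constant 2 survives, so a cell is
   discarded only because of a cell above it that is already saturated. *)
Lemma greedy_packing : exists S : set (cell n), [/\ S `<=` QQ,
  forall P, \esum_(Q in [set Q | S Q /\ subc Q P]) (lam Q)%:E <= (2 * lam P)%:E &
  forall Q, QQ Q -> ~ S Q -> exists P, subc Q P /\
    (lam P)%:E <= \esum_(Q in [set Q | S Q /\ subc Q P]) (lam Q)%:E].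
Proof.
pose S := [set Q | exists i, Q \in greedy i].
exists S; split.
- by move=> Q [i Qi]; have [_ sub _] := greedy_inv i; exact/set_mem/sub.
- move=> P; apply: esum_ub => s us sS.
  have [N sN] : exists N, {subset s <= greedy N}.
    elim: s us sS => [|Q s IH] /=; first by exists 0%N.
    move=> /andP[_ us] sS; have [|N sN] := IH us.
      by move=> P' P's; apply: sS; rewrite inE P's orbT.
    have /set_mem[[i Qi] _] := sS Q (mem_head _ _).
    exists (maxn i N) => P'; rewrite inE => /predU1P[->|/sN].
      by apply: greedy_sub Qi; exact: leq_maxl.
    by apply: greedy_sub; exact: leq_maxr.
  have [uN _ pack] := greedy_inv N.
  rewrite sumEFin lee_fin; apply: le_trans (pack P).
  rewrite -[leRHS]big_filter.
  have : subpred (mem s) (mem [seq P' <- greedy N | `[< subc P' P >]]).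
    move=> P' P's; rewrite inE mem_filter sN// andbT.
    by apply/asboolP; have /set_mem[] := sS _ P's.
  move=> sub; rewrite [leRHS](bigID (mem s))/= -[X in (_ <= X + _)%R]big_filter.
  rewrite -[leLHS]addr0 lerD ?sumr_ge0// => [|P' _]; last exact: lam_ge0.
  rewrite le_eqVlt; apply/orP; left; apply/eqP; apply: perm_big.
  apply: uniq_perm => //; first by rewrite !filter_uniq.
  move=> P'; rewrite [RHS]mem_filter; apply/idP/andP => [P's|[]//].
  by split => //; exact: sub.
- move=> Q QQQ nSQ; pose i := pickle Q.
  have : ~ admissible (greedy i) Q.
    move=> adm; apply: nSQ; exists i.+1; rewrite greedyS /step pickleK.
    case: ifP => [_|/negbT]; first exact: mem_head.
    by rewrite negb_and negbK => /orP[/asboolPn//|].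
  move=> /not_andP[//|/existsNP[P /not_implyP[QP /negP]]].
  rewrite -ltNge => big; exists P; split => //.
  have [u _ _] := greedy_inv i.
  apply: (@le_trans _ _ (\sum_(P' <- [seq P' <- greedy i | `[< subc P' P >]]) (lam P')%:E)).
    (* Since [lam Q <= lam P], violating the bound [2 * lam P] by adding [Q] means that the sum
       already exceeds [lam P]. *)
    rewrite big_filter sumEFin lee_fin; have := lam_le i0 delta_gt0 QP.
    by move: big; lra.
  apply: esum_ge_seq; first by rewrite filter_uniq.
  move=> P'; rewrite mem_filter => /andP[/asboolP P'P P'g]; apply/mem_set.
  by split => //; exists i.
Qed.

End Greedy.

End Packing.

(** * A_p pairs and weighted contents of unions of cells *)

Section Weights.
Context {R : realType} {n : nat}.
Variables (i0 : 'I_n) (delta : R) (delta_gt0 : (0 < delta)%R).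
Variable alpha : {ffun 'I_n -> bool}.
Local Notation X := 'rV[R]_n.
Local Notation H := (@hcontent R n delta).
Local Notation J := (@dchoquet R n delta).
Local Notation cs := (@cset R n alpha).
Local Notation lam := (@lam R n delta).
Local Notation subc := (@subc R n alpha).
Local Notation cdisjoint := (@cdisjoint R n alpha).
Local Notation cell_constant := (@cell_constant R n delta).
Local Notation mass_below := (@mass_below R n delta alpha).
Local Notation cover_mass := (@cover_mass R n delta).
Implicit Types (P Q : cell n) (E : set X) (h : X -> \bar R).

(** A bound on [lam] bounds the scales since [3^delta > 1]; a member of [F] above [P] of largest
    scale is maximal for inclusion. *)
Lemma max_cell (F : set (cell n)) (B : R) P :
  (forall Q, F Q -> (lam Q <= B)%R) -> F P ->
  exists Q, [/\ F Q, subc P Q & forall Q', F Q' -> subc Q Q' -> Q' = Q].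
Proof.
move=> FB FP; pose S (k : int) := exists Q, [/\ F Q, subc P Q & Q.1 = k].
have B0 : (0 < B)%R by apply: lt_le_trans (FB _ FP); exact: lam_gt0.
have t0 : (1 < 3 `^ delta :> R)%R.
  by rewrite /powR pnatr_eq0/= expR_gt1 mulr_gt0 ?ln_gt0 ?ltr1n.
have [b /andP[_ b2]] := exprz_floor t0 B0.
have exS : exists k, S k by exists P.1, P; split.
have [|k [[Q [FQ PQ Qk]] kmax]] := @int_ub_max S b exS.
  move=> k [Q [FQ PQ <-]]; have := le_lt_trans (FB _ FQ) b2.
  by rewrite /lam powR_exprz// ltr_eXz2l//; lia.
exists Q; split => // Q' FQ' QQ'; apply: (subc_anti i0 _ QQ').
have [x Qx] := cset_neq0 (R := R) alpha Q.
apply: (cset_nested (QQ' _ Qx) Qx); rewrite Qk; apply: kmax.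
by exists Q'; split => //; exact: subc_trans QQ'.
Qed.

Variable kappa : R.
Hypothesis kappa_gt0 : (0 < kappa)%R.
Hypothesis hcontent_cset_ge : forall P, (kappa * lam P)%:E <= H (cs P).

Local Notation avg_le v Q s := (J (cs Q) (fun x => (v x)%:E) <= (s * lam Q)%:E).

(** The A_p condition raised to the power [gamma = 1 / (p - 1)], with averages normalized by [lam]
    and required to be positive and finite. In this form [v] and [sigma] can be exchanged along with
    [gamma] and [gamma^-1]. *)
Definition muckenhoupt_pair (v sigma : X -> R) (gamma A : R) := forall Q, exists V S : R,
  [/\ (0 < V)%R, (0 < S)%R, J (cs Q) (fun x => (v x)%:E) = (V * lam Q)%:E,
      J (cs Q) (fun x => (sigma x)%:E) = (S * lam Q)%:E & (V `^ gamma * S <= A)%R].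

Definition dual_weight (v : X -> R) (gamma : R) (x : X) : R := (v x `^ (- gamma))%R.

(** By Chebyshev, [v > tau = 4 s / kappa] holds on content at most [kappa / 2 * lam Q].
    Subadditivity leaves content at least [kappa / 2 * lam Q] where [v <= tau], that is, where the
    dual weight is at least [tau^(-gamma)]. *)
Lemma dual_average_ge (v : X -> R) (gamma : R) :
  (0 < gamma)%R -> (forall x, 0 < v x)%R ->
  exists2 c : R, (0 < c)%R & forall Q s, (0 < s)%R -> avg_le v Q s ->
    (c * s `^ (- gamma) * lam Q)%:E <= J (cs Q) (fun x => (dual_weight v gamma x)%:E).
Proof.
move=> g0 v0; exists (kappa / 8 * (4 / kappa) `^ (- gamma))%R.
  by rewrite mulr_gt0 ?powR_gt0 ?divr_gt0.
move=> Q s s0 le; have lQ := @lam_gt0 R n delta Q.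
pose tau := (4 / kappa * s)%R; have tau0 : (0 < tau)%R by rewrite mulr_gt0 ?divr_gt0.
have e1 : H [set x | cs Q x /\ tau%:E < (v x)%:E] <= (kappa / 2 * lam Q)%:E.
  rewrite -(@lee_pmul2l _ tau%:E)// ?lte_fin//.
  apply: le_trans (dchoquet_chebyshev _ _ tau0) _.
  apply: (@le_trans _ _ (2%:E * (s * lam Q)%:E)); first by rewrite lee_wpmul2l.
  rewrite -!EFinM lee_fin le_eqVlt; apply/orP; left; apply/eqP.
  by rewrite /tau; field; rewrite gt_eqF.
pose W := [set x | cs Q x /\ (tau `^ (- gamma))%:E <= (dual_weight v gamma x)%:E].
have e2 : (kappa / 2 * lam Q)%:E <= H W.
  have : (kappa * lam Q)%:E <= (kappa / 2 * lam Q)%:E + H W.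
    apply: le_trans (hcontent_cset_ge Q) _; rewrite addeC.
    apply: le_trans (leeD2l (H W) e1).
    apply: hcontentU => x Qx; have [vt|vt] := ltP tau (v x); [right|left].
      by split => //; rewrite lte_fin.
    split => //; rewrite lee_fin /dual_weight !powRN lef_pV2 ?posrE ?powR_gt0//.
    by apply: ge0_ler_powR; rewrite ?nnegrE ?(ltW g0) ?(ltW tau0) ?(ltW (v0 x)).
  rewrite -leeBlDl// -EFinB; apply: le_trans; rewrite lee_fin.
  by rewrite le_eqVlt; apply/orP; left; apply/eqP; field.
have t0 : (0 < tau `^ (- gamma))%R by rewrite powR_gt0.
have := dchoquet_chebyshev_le (delta := delta) (cs Q) (fun x => (dual_weight v gamma x)%:E) t0.
rewrite -/W => e3; rewrite -(@lee_pmul2l _ 4%:E)// ?lte_fin//.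
apply: le_trans e3; apply: (@le_trans _ _ ((tau `^ (- gamma))%:E * (kappa / 2 * lam Q)%:E)).
  have -> : (tau `^ (- gamma) = (4 / kappa) `^ (- gamma) * s `^ (- gamma))%R.
    by rewrite -powRM ?divr_ge0 ?(ltW kappa_gt0) ?(ltW s0).
  rewrite -!EFinM lee_fin le_eqVlt.
  by apply/orP; left; apply/eqP; field.
by rewrite lee_wpmul2l// lee_fin ltW.
Qed.

Section Pair.
Variables (v : X -> R) (gamma A : R).
Hypotheses (v_gt0 : forall x, (0 < v x)%R) (gamma_gt0 : (0 < gamma)%R).
Local Notation sigma := (dual_weight v gamma).
Hypothesis vA : muckenhoupt_pair v sigma gamma A.

(** Insert the lower bound on [S] into [V^gamma * S <= A] and take the root of order [gamma]. *)
Lemma average_le_of_dual (c : R) : (0 < c)%R ->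
  exists2 C : R, (0 < C)%R & forall T s, (0 < s)%R ->
    (c * s `^ (- gamma) * lam T)%:E <= J (cs T) (fun x => (sigma x)%:E) -> avg_le v T (C * s).
Proof.
move=> c0.
have A0 : (0 < A)%R.
  have [V [S [V0 S0 _ _ VS]]] := vA (0%R, 0%R).
  by apply: lt_le_trans VS; rewrite mulr_gt0// powR_gt0.
exists ((A / c) `^ gamma^-1)%R; first by rewrite powR_gt0// divr_gt0.
move=> T s s0; have [V [S [V0 S0 -> -> VS]]] := vA T.
rewrite !lee_fin ler_pM2r ?lam_gt0// ler_pM2r ?lam_gt0// => cS.
have e : (V `^ gamma <= A / c * s `^ gamma)%R.
  rewrite -(ler_pM2r (_ : 0 < c * s `^ (- gamma))%R); last first.
    by rewrite mulr_gt0// powR_gt0.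
  apply: (@le_trans _ _ (V `^ gamma * S)%R); first by rewrite ler_wpM2l ?powR_ge0.
  apply: le_trans VS _; rewrite powRN le_eqVlt; apply/orP; left; apply/eqP.
  by field; rewrite !gt_eqF ?powR_gt0.
have g10 : (0 <= gamma^-1)%R by rewrite invr_ge0 ltW.
have := @ge0_ler_powR _ _ g10 (V `^ gamma)%R (A / c * s `^ gamma)%R
  (powR_ge0 _ _) (mulr_ge0 (ltW (divr_gt0 A0 c0)) (powR_ge0 _ _)) e.
rewrite powRM ?powR_ge0 ?divr_ge0 ?(ltW A0) ?(ltW c0)// -!powRrM mulfV ?gt_eqF//.
by rewrite !powRr1 ?(ltW V0) ?(ltW s0).
Qed.

(** The integral of [sigma] over [T] is at least that over [Q], which is large when [v] has a small
    average on [Q]; the A_p condition on [T] concludes. *)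
Lemma average_le_of_child (M : R) : (0 < M)%R ->
  exists2 C : R, (0 < C)%R & forall Q T s, (0 < s)%R -> subc Q T ->
    (lam T <= M * lam Q)%R -> avg_le v Q s -> avg_le v T (C * s).
Proof.
move=> M0; have [c c0 cP] := dual_average_ge gamma_gt0 v_gt0.
have cM : (0 < c / M)%R by rewrite divr_gt0.
have [C C0 CP] := average_le_of_dual cM.
exists C => // Q T s s0 QT TQ le; apply: CP => //.
apply: (@le_trans _ _ (J (cs Q) (fun x => (sigma x)%:E))); last exact: le_dchoquet.
apply: le_trans (cP _ _ s0 le); rewrite lee_fin.
have -> : (c / M * s `^ (- gamma) * lam T = c * s `^ (- gamma) * (lam T / M))%R by ring.
rewrite ler_wpM2l ?mulr_ge0 ?powR_ge0 ?(ltW c0)//.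
by rewrite ler_pdivrMr// mulrC.
Qed.

(** Each selected cell has a [sigma]-integral of order at least [s^(-gamma) * lam Q]. These add up
    inside [T] by the packing bound, and saturation makes the total of order [s^(-gamma) * lam T],
    to which the A_p condition applies. *)
Lemma average_le_of_saturated : exists2 C : R, (0 < C)%R &
  forall (S : set (cell n)) T s, (0 < s)%R -> cdisjoint S id ->
    (forall P, \esum_(Q in [set Q | S Q /\ subc Q P]) (lam Q)%:E <= (2 * lam P)%:E) ->
    (lam T)%:E <= \esum_(Q in [set Q | S Q /\ subc Q T]) (lam Q)%:E ->
    (forall Q, S Q -> avg_le v Q s) -> avg_le v T (C * s).
Proof.
have [c c0 cP] := dual_average_ge gamma_gt0 v_gt0.
pose K : R := (4 * (2 + 1) * cell_constant)%R.
have K0 : (0 < K)%R by rewrite mulr_gt0 ?cell_constant_gt0// mulr_gt0// addr_gt0.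
have cK : (0 < c / K)%R by rewrite divr_gt0.
have [C C0 CP] := average_le_of_dual cK.
exists C => // S T s s0 dS pack sat le; apply: CP => //.
pose ST := [set Q | S Q /\ subc Q T].
have pk : \esum_(Q in ST) J (cs Q) (fun x => (sigma x)%:E) <=
    K%:E * J (cs T) (fun x => (sigma x)%:E).
  apply: (@packing_dchoquet R n i0 delta delta_gt0 alpha _ ST id 2 (cs T)
    (fun x => (sigma x)%:E)) => //.
  - by move=> Q Q' x [SQ _] [SQ' _]; exact: dS SQ SQ'.
  - by move=> Q [_ QT].
  - move=> P; apply: le_trans (pack P); apply: esum_le_subset => Q [[SQ _] QP].
    by split.
rewrite -(@lee_pmul2l _ K%:E)// ?lte_fin//.
apply: le_trans pk; apply: (@le_trans _ _ (\esum_(Q in ST) (c * s `^ (- gamma))%:E * (lam Q)%:E)).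
  rewrite esumZl; last 2 first.
  - by rewrite mulr_ge0 ?powR_ge0// ltW.
  - by move=> Q; rewrite lee_fin lam_ge0.
  apply: (@le_trans _ _ ((c * s `^ (- gamma))%:E * (lam T)%:E)).
    rewrite -!EFinM lee_fin le_eqVlt; apply/orP; left; apply/eqP.
    by field; rewrite gt_eqF.
  by rewrite lee_wpmul2l// lee_fin mulr_ge0 ?powR_ge0// ltW.
by apply: le_esum => Q [SQ QT]; rewrite -EFinM; apply: cP => //; exact: le.
Qed.

(** A greedy packing [S] of [QQ] has total [lam] at most [2 L], since each of its cells lies in some
    [cel i]. Rejected cells lie in maximal saturated cells, which are disjoint, have averages at
    most [C s], and have total [lam] at most that of [S]. *)
Lemma dchoquet_bigcup_cells : exists2 C : R, (0 < C)%R &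
  forall (QQ : set (cell n)) s (D : set (@cover_index n)) cel, (0 < s)%R ->
    cdisjoint QQ id -> (forall Q, QQ Q -> avg_le v Q s) ->
    (forall Q, QQ Q -> exists i, D i /\ subc Q (cel i)) ->
    \esum_(i in D) (lam (cel i))%:E < +oo ->
    J (\bigcup_(Q in QQ) cs Q) (fun x => (v x)%:E) <=
      (C * s)%:E * \esum_(i in D) (lam (cel i))%:E.
Proof.
have [C C0 CP] := average_le_of_saturated.
exists (2 * (C + 1))%R; first by rewrite mulr_gt0// addr_gt0.
move=> QQ s D cel s0 dQ le QD Lfin; set L := \esum_(i in D) _.
have [S [SQ pack sat]] := @greedy_packing R n i0 delta delta_gt0 alpha QQ.
have dS : cdisjoint S id by move=> P Q x /SQ SP /SQ; exact: dQ.
have lam0 Q : 0 <= (lam Q)%:E by rewrite lee_fin lam_ge0.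
have L0 : 0 <= L by apply: esum_ge0.
have Lnum : L \is a fin_num by rewrite ge0_fin_numE.
have SL : \esum_(Q in S) (lam Q)%:E <= 2%:E * L.
  apply: (@le_trans _ _ (\esum_(Q in S) \esum_(i in [set i | D i /\ subc Q (cel i)]) (lam Q)%:E)).
    apply: le_esum => Q /SQ/QD[i [Di Qi]].
    exact: (@esum_ge1 _ _ [set i | D i /\ subc Q (cel i)] (fun=> (lam Q)%:E) i).
  rewrite (esum_exchange _ _ (fun Q i => subc Q (cel i)) (a := fun Q i => (lam Q)%:E))//.
  rewrite -esumZl//; apply: le_esum => i Di; rewrite -EFinM; exact: pack.
pose Sat := [set P | (lam P)%:E <= \esum_(Q in [set Q | S Q /\ subc Q P]) (lam Q)%:E].
(* Saturated cells have bounded size, so each lies in a maximal one. *)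
have SatB P : Sat P -> (lam P <= fine (2%:E * L))%R.
  move=> SP; rewrite -lee_fin fineK; last by rewrite -(fineK Lnum) -EFinM.
  by apply: le_trans SP (le_trans _ SL); apply: esum_le_subset => Q [].
pose MX := [set P | Sat P /\ forall P', Sat P' -> subc P P' -> P' = P].
have dM : cdisjoint MX id.
  move=> P P' x [SP mP] [SP' mP'] Px P'x; have [PP'|P'P] := subc_total Px P'x.
    by rewrite (mP _ SP' PP').
  by rewrite (mP' _ SP P'P).
have SSum : \esum_(Q in S) J (cs Q) (fun x => (v x)%:E) <= s%:E * (2%:E * L).
  apply: le_trans (lee_wpmul2l _ SL); last by rewrite lee_fin ltW.
  rewrite -esumZl ?(ltW s0)//; apply: le_esum => Q /SQ/le; by rewrite EFinM.
have MSum : \esum_(Q in MX) J (cs Q) (fun x => (v x)%:E) <= (C * s)%:E * (2%:E * L).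
  apply: (@le_trans _ _ (\esum_(T in MX) (C * s)%:E * (lam T)%:E)).
    apply: le_esum => T [ST mT]; rewrite -EFinM; apply: (CP S) => // Q /SQ; exact: le.
  have Cs0 : (0 <= C * s)%R by rewrite mulr_ge0// ltW.
  rewrite esumZl// lee_wpmul2l ?lee_fin//; apply: le_trans SL.
  apply: (@le_trans _ _ (\esum_(T in MX) \esum_(Q in [set Q | S Q /\ subc Q T]) (lam Q)%:E)).
    by apply: le_esum => T [].
  exact: antichain_esum_le.
apply: (@le_trans _ _ (J (\bigcup_(Q in S) cs Q) (fun x => (v x)%:E) +
    J (\bigcup_(Q in MX) cs Q) (fun x => (v x)%:E))).
  apply: dchoquet_le_add => x t [Q QQQ Qx] t0 tv.
  have [SQ'|nSQ] := pselect (S Q); first by left; split => //; exists Q.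
  have [P [QP SP]] := sat Q QQQ nSQ.
  have [T [ST PT mT]] := max_cell SatB SP.
  by right; split => //; exists T; [split|apply: PT; exact: QP].
apply: (@le_trans _ _ (s%:E * (2%:E * L) + (C * s)%:E * (2%:E * L))).
  apply: leeD.
    apply: le_trans SSum; apply: dchoquet_le_sum => x t [Q SQ' Qx] _ tv; by exists Q.
  apply: le_trans MSum; apply: dchoquet_le_sum => x t [Q SQ' Qx] _ tv; by exists Q.
rewrite -(fineK Lnum) -!EFinM -EFinD lee_fin le_eqVlt; apply/orP; left; apply/eqP.
by ring.
Qed.

(* Cells whose average of [h] comes from cover cells below them are summed
   directly; the others are sorted by the level of the cover cell above them,
   and each level is thinned to a packing. *)
Lemma dchoquet_bigcup_le : exists2 C : R, (0 < C)%R &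
  forall (QQ : set (cell n)) h, cdisjoint QQ id ->
    (forall Q, QQ Q -> J (cs Q) (fun x => (v x)%:E) <= J (cs Q) h) ->
    J (\bigcup_(Q in QQ) cs Q) (fun x => (v x)%:E) <= C%:E * J setT h.
Proof.
have [C C0 CP] := dchoquet_bigcup_cells.
exists ((8 + 8 * C) * cell_constant)%R.
  by rewrite mulr_gt0 ?cell_constant_gt0// addr_gt0// mulr_gt0.
move=> QQ h dQ Qh.
apply: (@le_dchoquet_cover R n delta delta_gt0 alpha setT h).
  by rewrite addr_gt0// mulr_gt0.
move=> D lev cel cov Mfin.
pose A0 := [set Q | QQ Q /\ J (cs Q) (fun x => (v x)%:E) <= 8%:E * mass_below D lev cel Q].
pose B (m : int) := [set Q | QQ Q /\ avg_le v Q (8 * 2 ^ m) /\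
  exists i, [/\ D i, lev i = m & subc Q (cel i)]].
have split_QQ Q : QQ Q -> A0 Q \/ exists m, B m Q.
  move=> QQQ; have [le|[i [Di Qi le]]] := cell_localization i0 delta_gt0 cov Mfin (@subsetT _ (cs Q)).
    left; split => //; apply: le_trans (Qh _ QQQ) (le_trans le _).
    by rewrite lee_wpmul2r ?mass_below_ge0// lee_fin ler_nat.
  (* The larger of the two terms of the localization absorbs the other, turning 4 + 4 into the 8 of
     [A0] and [B]. *)
  have [ab|ba] := leP ((2 ^ lev i * lam Q)%:E) (mass_below D lev cel Q).
    left; split => //; apply: le_trans (Qh _ QQQ) (le_trans le _).
    apply: (@le_trans _ _ (4%:E * mass_below D lev cel Q + 4%:E * mass_below D lev cel Q)).
      by rewrite leeD2r// EFinM lee_wpmul2l.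
    rewrite -ge0_muleDl// -EFinD lee_wpmul2r ?mass_below_ge0// lee_fin; lra.
  right; exists (lev i); split => //; split; last by exists i.
  apply: le_trans (Qh _ QQQ) (le_trans le _).
  apply: (@le_trans _ _ (4%:E * (2 ^ lev i * lam Q)%:E + 4%:E * (2 ^ lev i * lam Q)%:E)).
    by rewrite EFinM leeD2l// lee_wpmul2l// ltW.
  rewrite -EFinM -EFinD lee_fin le_eqVlt; apply/orP; left; apply/eqP; ring.
have lam0 Q : 0 <= (lam Q)%:E by rewrite lee_fin lam_ge0.
have p2 (m : int) : (0 < 2 ^ m :> R)%R by rewrite exprz_gt0.
have massE : cover_mass D lev cel =
    \esum_(m in [set: int]) ((2 ^ m)%R)%:E * \esum_(i in [set i | D i /\ m = lev i]) (lam (cel i))%:E.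
  transitivity (\esum_(i in D) \esum_(m in [set m : int | setT m /\ m = lev i])
      (2 ^ m * lam (cel i))%:E).
    apply: eq_esum => i Di; rewrite (_ : [set m | _] = [set lev i]).
      by rewrite esum_set1// lee_fin mulr_ge0 ?lam_ge0// ltW.
    by apply/seteqP; split => [m []|m].
  rewrite -(esum_exchange _ _ (fun m i => m = lev i) (a := fun m i => (2 ^ m * lam (cel i))%:E)).
    by apply: eq_esum => m _; rewrite -esumZl ?(ltW (p2 m)).
  by move=> m i; rewrite lee_fin mulr_ge0 ?lam_ge0// ltW.
pose L (m : int) := \esum_(i in [set i | D i /\ m = lev i]) (lam (cel i))%:E.
have L0 m : 0 <= L m by apply: esum_ge0.
have Lfin m : L m < +oo.
  have : ((2 ^ m)%R)%:E * L m < +oo.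
    apply: le_lt_trans Mfin; rewrite massE.
    exact: (@esum_ge1 _ _ setT (fun m : int => ((2 ^ m)%R)%:E * L m)).
  rewrite !ltey; apply: contra => /eqP ->.
  by rewrite gt0_muley// lte_fin.
have M0 : 0 <= cover_mass D lev cel.
  by apply: esum_ge0 => i _; rewrite lee_fin mulr_ge0 ?lam_ge0// ltW.
apply: (@le_trans _ _ (J (\bigcup_(Q in A0) cs Q) (fun x => (v x)%:E) +
    \esum_(m in [set: int]) J (\bigcup_(Q in B m) cs Q) (fun x => (v x)%:E))).
  apply: dchoquet_le_add_sum => x t [Q QQQ Qx] _ tv.
  have [AQ|[m BQ]] := split_QQ Q QQQ; first by left; split => //; exists Q.
  by right; exists m; split => //; exists Q.
rewrite EFinD ge0_muleDl// ?lee_fin ?mulr_ge0 ?(ltW C0)//; apply: leeD.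
  apply: (@le_trans _ _ (\esum_(Q in A0) J (cs Q) (fun x => (v x)%:E))).
    by apply: dchoquet_le_sum => x t [Q AQ Qx] _ tv; exists Q.
  apply: (@le_trans _ _ (\esum_(Q in A0) (8%:E * mass_below D lev cel Q))).
    by apply: le_esum => Q [].
  rewrite esumZl//; last by move=> Q; exact: mass_below_ge0.
  rewrite lee_wpmul2l//; apply: antichain_esum_le.
    by move=> P Q x [QP _] [QQQ _]; exact: dQ.
  by move=> i; rewrite lee_fin mulr_ge0 ?lam_ge0// ltW.
rewrite massE -esumZl ?mulr_ge0 ?(ltW C0)//; last first.
  by move=> m; rewrite mule_ge0 ?L0// lee_fin ltW.
apply: le_esum => m _.
have -> : (8 * C)%:E * (((2 ^ m)%R)%:E * L m) = (C * (8 * 2 ^ m))%:E * L m.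
  by rewrite muleA -EFinM; congr (_%:E * _); ring.
apply: CP => //.
- by rewrite mulr_gt0.
- by move=> P Q x [QP _] [QQQ _]; exact: dQ.
- by move=> Q [_ []].
- by move=> Q [_ [_ [i [Di im Qi]]]]; exists i; split.
- exact: Lfin.
Qed.

End Pair.

End Weights.

(** Split at the index [k] with [y * b^k <= 1 < y * b^(k+1)]: below it the first argument of the
    minimum decays geometrically, above it the second does, with bounds independent of [y]. *)
Lemma esum_min_geometric (R : realType) (b gamma : R) : (1 < b)%R -> (0 < gamma)%R ->
  exists2 C : R, (0 < C)%R & forall y, (0 < y)%R ->
    \esum_(j in [set: int])
      (Num.min (y * b ^ j)%R ((y * b ^ j) `^ (- gamma))%R)%:E <= C%:E.
Proof.
move=> b1 g0; have b0 : (0 < b)%R by exact: lt_trans b1.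
have bg1 : (1 < b `^ gamma)%R by rewrite /powR gt_eqF// expR_gt1 mulr_gt0// ln_gt0.
have r1 : (0 < b^-1 < 1)%R by rewrite invr_gt0 b0 invf_lt1.
have r2 : (0 < (b `^ gamma)^-1 < 1)%R by rewrite invr_gt0 invf_lt1 ?bg1 ?powR_gt0.
exists ((1 - b^-1)^-1 + (1 - (b `^ gamma)^-1)^-1)%R.
  by rewrite addr_gt0// invr_gt0 subr_gt0; [case/andP: r1|case/andP: r2].
move=> y y0; have y'0 : (0 < y^-1)%R by rewrite invr_gt0.
have [k /andP[k1 k2]] := exprz_floor b1 y'0.
have pos j : (0 <= y * b ^ j)%R by rewrite mulr_ge0 ?(ltW y0)// exprz_ge0// ltW.
rewrite (esumID [set j : int | (j <= k)%R]); last first.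
  by move=> j _; rewrite lee_fin le_min pos powR_ge0.
rewrite EFinD !setTI; apply: leeD.
  apply: le_trans (geometric_down_le k r1); apply: le_esum => j jk.
  rewrite lee_fin ge_min; apply/orP; left.
  rewrite exprz_inv opprB -{1}(subrK k j) expfzDr ?gt_eqF// mulrCA ler_piMr//.
    by rewrite exprz_ge0// ltW.
  by rewrite -ler_pdivlMl// mulr1.
have -> : ~` [set j : int | (j <= k)%R] = [set j : int | (k + 1 <= j)%R].
  by apply/seteqP; split => j /=; rewrite lezD1 ltNge => /negP.
apply: le_trans (geometric_up_le (k + 1)%R r2); apply: le_esum => j kj.
rewrite lee_fin ge_min; apply/orP; right.
rewrite -powRN -powR_exprz ?(ltW b0)//.
have h : (b ^ (j - (k + 1)) <= y * b ^ j)%R.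
  rewrite -{2}(subrK (k + 1)%R j) [in leRHS]expfzDr ?gt_eqF// mulrCA ler_peMr//.
    by rewrite exprz_ge0// ltW.
  by rewrite -ler_pdivrMl// mulr1 ltW.
rewrite !powRN lef_pV2 ?posrE ?powR_gt0 ?mulr_gt0 ?exprz_gt0//.
by apply: ge0_ler_powR; rewrite ?nnegrE ?exprz_ge0 ?pos ?(ltW g0) ?(ltW b0).
Qed.

(** * Weak and strong bounds for the weighted grid maximal operator *)

Section Maximal.
Context {R : realType} {n : nat}.
Variables (i0 : 'I_n) (delta : R) (delta_gt0 : (0 < delta)%R).
Variable alpha : {ffun 'I_n -> bool}.
Local Notation X := 'rV[R]_n.
Local Notation H := (@hcontent R n delta).
Local Notation J := (@dchoquet R n delta).
Local Notation cs := (@cset R n alpha).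
Local Notation lam := (@lam R n delta).
Local Notation subc := (@subc R n alpha).
Local Notation cdisjoint := (@cdisjoint R n alpha).
Local Notation cell_constant := (@cell_constant R n delta).
Local Notation cover_mass := (@cover_mass R n delta).
Implicit Types (P Q : cell n) (E : set X) (g h : X -> \bar R).

Variable kappa : R.
Hypothesis kappa_gt0 : (0 < kappa)%R.
Hypothesis hcontent_cset_ge : forall P, (kappa * lam P)%:E <= H (cs P).
Variables (v : X -> R) (gamma A : R).
Hypotheses (v_gt0 : forall x, (0 < v x)%R) (gamma_gt0 : (0 < gamma)%R).
Local Notation sigma := (dual_weight v gamma).
Hypothesis vA : muckenhoupt_pair delta alpha v sigma gamma A.

Local Notation Jv E := (J E (fun x => (v x)%:E)).

Let theta : R := (3 `^ delta)%R.

Let theta_gt1 : (1 < theta)%R.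
Proof. by rewrite /theta /powR pnatr_eq0/= expR_gt1 mulr_gt0 ?ln_gt0 ?ltr1n. Qed.

Let theta_gt0 : (0 < theta)%R.
Proof. exact: lt_trans theta_gt1. Qed.

Let lamE P : lam P = (theta ^ P.1)%R.
Proof. by rewrite /lam powR_exprz. Qed.

(* The siblings of the cells of an infinite increasing chain are packed, and
   each of them has weighted content comparable to that of its parent, so the
   weighted contents along the chain cannot stay bounded. *)
Lemma ancestors_scale_bounded (B : R) P :
  exists b : int, forall Q, subc P Q -> Jv (cs Q) <= B%:E -> (Q.1 <= b)%R.
Proof.
have intSr (k : int) (j : nat) : (k + j.+1%:Z = k + j%:Z + 1)%R by lia.
apply: contrapT => nb.
have big (b : int) : exists Q, [/\ subc P Q, Jv (cs Q) <= B%:E & (b < Q.1)%R].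
  apply: contrapT => nQ; apply: nb; exists b => Q PQ QB.
  by rewrite leNgt; apply/negP => bQ; apply: nQ; exists Q.
have [x Px] := cset_neq0 (R := R) alpha P.
(* [a j] is the ancestor of [P] by [j] generations; [s j] below is a sibling of it, inside the same
   parent [a j.+1]. *)
have /choice[a aP] : forall j : nat, exists Q, Q.1 = (P.1 + j%:Z)%R /\ cs Q x.
  by move=> j; exact: cell_at.
have aa i j : (i <= j)%N -> subc (a i) (a j).
  move=> ij; have [ei xi] := aP i; have [ej xj] := aP j.
  by apply: cset_nested xi xj _; rewrite ei ej; lia.
have Pa j : subc P (a j).
  by have [ej xj] := aP j; apply: cset_nested Px xj _; rewrite ej; lia.
have aB j : Jv (cs (a j)) <= B%:E.
  have [Q [PQ QB jQ]] := big (P.1 + j%:Z)%R.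
  have [ej xj] := aP j; apply: le_trans QB; apply: le_dchoquet => //.
  by apply: cset_nested xj (PQ _ Px) _; rewrite ej ltW.
have /choice[s sP] : forall j : nat, exists Q, [/\ Q.1 = (P.1 + j%:Z)%R,
    subc Q (a j.+1) & forall y, cs Q y -> ~ cs (a j) y].
  move=> j; have [ej xj] := aP j; have [ej1 xj1] := aP j.+1.
  have [y [yj1 yj]] : exists y, cs (a j.+1) y /\ ~ cs (a j) y.
    apply: contrapT => ny; have /(cset_scale i0) : subc (a j.+1) (a j).
      by move=> y ya; apply: contrapT => nya; apply: ny; exists y.
    by rewrite ej ej1; lia.
  have [Q [eQ yQ]] := cell_at alpha (P.1 + j%:Z)%R y.
  exists Q; split => //; first by apply: cset_nested yQ yj1 _; rewrite eQ ej1; lia.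
  move=> z zQ za; apply: yj; suff <- : Q = a j by [].
  by apply: cset_inj zQ za _; rewrite eQ ej.
have sdisj i j y : (i < j)%N -> cs (s i) y -> ~ cs (s j) y.
  move=> ij si sj; have [_ sub _] := sP i; have [_ _ dis] := sP j.
  by apply: (dis _ sj); apply: (aa _ _ ij); exact: sub.
pose r := (theta^-1)%R.
have r01 : (0 < r < 1)%R by rewrite invr_gt0 theta_gt0 invf_lt1.
(* There is one sibling per scale, so those inside a cell [T] have total [lam] at most [K * lam T],
   a geometric series of ratio [r]. *)
pose K : R := ((1 - r)^-1)%R.
have K0 : (0 <= K)%R by rewrite invr_ge0 subr_ge0 ltW//; case/andP: r01.
have [C C0 CP] := average_le_of_child kappa_gt0 hcontent_cset_ge v_gt0 gamma_gt0 vA theta_gt0.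
have [V0 [_ [V00 _ V0E _ _]]] := vA P.
(* The parent of [s j] contains [P], so its weighted content is at least that of [P];
   [average_le_of_child] passes this on to [s j]. *)
pose c := (V0 * lam P / (C * theta))%R.
have c0 : (0 < c)%R by rewrite divr_gt0// mulr_gt0// lam_gt0.
have sc j : c%:E <= Jv (cs (s j)).
  have [es sub _] := sP j; have [ea _] := aP j.+1.
  have [V [_ [V0' _ VE _ _]]] := vA (s j).
  have lamle : (lam (a j.+1) = theta * lam (s j))%R.
    have -> : lam (a j.+1) = (theta ^ (P.1 + j%:Z + 1))%R.
      by rewrite lamE ea intSr.
    by rewrite lamE es [LHS]expfzDr ?gt_eqF// expr1z mulrC.
  have := CP (s j) (a j.+1) V V0' sub.
  rewrite lamle VE !lexx => /(_ isT isT) h.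
  have : (V0 * lam P)%:E <= (C * V * (theta * lam (s j)))%:E.
    by apply: le_trans h; rewrite -V0E; apply: le_dchoquet => //; exact: Pa.
  rewrite !lee_fin => h'; rewrite ler_pdivrMr ?mulr_gt0//.
  by apply: le_trans h' _; rewrite le_eqVlt; apply/orP; left; apply/eqP; ring.
(* The first [N] siblings lie in [a N], of weighted content at most [B], so [N * c] stays bounded,
   which is absurd for large [N]. *)
have total (N : nat) : (N%:R * c)%:E <= (4 * (K + 1) * cell_constant * B)%:E.
  have pk : \esum_(j in [set j : nat | (j < N)%N]) Jv (cs (s j)) <=
      (4 * (K + 1) * cell_constant)%:E * Jv (cs (a N)).
    apply: (packing_dchoquet i0 delta_gt0) => //.
    - move=> i j y _ _ yi yj; have [ij|ij|//] := ltngtP i j.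
        by case: (sdisj i j y ij yi yj).
      by case: (sdisj j i y ij yj yi).
    - move=> j jN; have [_ sub _] := sP j; apply: subset_trans sub _; exact: aa.
    - move=> T; apply: (@le_trans _ _ (\esum_(j in [set j : nat | (P.1 + j%:Z <= T.1)%R])
        (lam (s j))%:E)).
        apply: esum_le_subset => j /= [_ /(cset_scale i0)].
        by have [-> _ _] := sP j.
      apply: (@le_trans _ _ ((lam T)%:E * \esum_(j in [set j : nat | (P.1 + j%:Z <= T.1)%R])
        (r ^ (T.1 - (P.1 + j%:Z)))%:E)).
        rewrite -esumZl; last 2 first.
        - exact: lam_ge0.
        - by move=> j; rewrite lee_fin exprz_ge0// ltW//; case/andP: r01.
        apply: le_esum => j _; have [e _ _] := sP j.
        rewrite -EFinM lee_fin !lamE e /r exprz_inv opprB -expfzDr ?gt_eqF//.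
        by rewrite addrCA subrr addr0.
      rewrite mulrC EFinM lee_wpmul2l ?lee_fin ?lam_ge0//.
      rewrite -(@esum_image _ _ _ _ (fun j : nat => (P.1 + j%:Z)%R)
        (fun k => (r ^ (T.1 - k))%:E)); last by move=> i j _ _ /addrI[].
      apply: le_trans (geometric_down_le T.1 r01).
      by apply: esum_le_subset => k [j jT <-].
  have KK : (0 <= 4 * (K + 1) * cell_constant)%R.
    by rewrite mulr_ge0 ?(ltW (@cell_constant_gt0 R n delta))// mulr_ge0// addr_ge0.
  rewrite [leRHS]EFinM; apply: le_trans (lee_wpmul2l _ (aB N)); last by rewrite lee_fin.
  apply: le_trans pk; apply: (@le_trans _ _ (\sum_(j <- iota 0 N) Jv (cs (s j)))).
    apply: (@le_trans _ _ (\sum_(j <- iota 0 N) c%:E)).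
      rewrite sumEFin lee_fin big_const_seq count_predT iter_addr_0 size_iota.
      by rewrite -[leRHS]mulr_natl.
    by apply: lee_sum => j _.
  apply: esum_ge_seq; first exact: iota_uniq.
  by move=> j; rewrite mem_iota add0n => jN; exact/mem_set.
pose M := (4 * (K + 1) * cell_constant * B)%R.
have := total (Num.trunc (M / c)).+1.
rewrite lee_fin -/M -ler_pdivlMr// leNgt => /negP; apply.
exact: truncnS_gt.
Qed.

(** Disjointness is obtained by passing to maximal cells. They exist when [J setT h] is finite: all
    cells of [QQ] then have weighted content at most this value, which bounds the scales above each
    cell. *)
Lemma dchoquet_bigcup_le_all : exists2 C : R, (0 < C)%R &
  forall (QQ : set (cell n)) h,
    (forall Q, QQ Q -> Jv (cs Q) <= J (cs Q) h) ->
    Jv (\bigcup_(Q in QQ) cs Q) <= C%:E * J setT h.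
Proof.
have [C C0 CP] := dchoquet_bigcup_le i0 delta_gt0 kappa_gt0 hcontent_cset_ge v_gt0 gamma_gt0 vA.
exists C => // QQ h Qh; have [hoo|hoo] := eqVneq (J setT h) +oo.
  by rewrite hoo gt0_muley ?leey// lte_fin.
have hfin : J setT h \is a fin_num by rewrite ge0_fin_numE ?dchoquet_ge0// ltey.
pose MX := [set Q | QQ Q /\ forall Q', QQ Q' -> subc Q Q' -> Q' = Q].
have below P : QQ P -> exists Q, MX Q /\ subc P Q.
  move=> QP; have [b bP] := ancestors_scale_bounded (fine (J setT h)) P.
  pose F := [set Q | QQ Q /\ subc P Q].
  have [Q||Q [[QQQ PQ] _ Qm]] := @max_cell R n i0 delta delta_gt0 alpha F (theta ^ b)%R P.
  - move=> [QQQ PQ]; rewrite lamE ler_eXz2l//; apply: bP => //.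
    by rewrite fineK//; apply: le_trans (Qh _ QQQ) _; exact: le_dchoquet.
  - by split.
  - exists Q; split => //; split => // Q' QQQ' QQ'; apply: Qm => //; split => //.
    exact: subc_trans QQ'.
apply: (@le_trans _ _ (Jv (\bigcup_(Q in MX) cs Q))).
  apply: le_dchoquet => // x [P /below[Q [MQ PQ]] Px].
  by exists Q => //; exact: PQ.
apply: CP => [P Q x [QP mP] [QQQ mQ] Px Qx|Q [QQQ _]]; last exact: Qh.
have [PQ|QP'] := subc_total Px Qx; first by rewrite -(mP _ QQQ PQ).
by rewrite (mQ _ QP QP').
Qed.

(** [fine] serves to invert the weighted content of a cell, a positive real by the A_p
    hypothesis. *)
Definition weighted_maximal g (x : X) : \bar R :=
  ereal_sup [set (fine (Jv (cs Q)))^-1%:E * J (cs Q) (fun y => g y * (v y)%:E) |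
    Q in [set Q | cs Q x]].

Lemma lt_weighted_maximal (t : R) g x : t%:E < weighted_maximal g x <->
  exists Q, cs Q x /\ t%:E * Jv (cs Q) < J (cs Q) (fun y => g y * (v y)%:E).
Proof.
have E Q : (t%:E < (fine (Jv (cs Q)))^-1%:E * J (cs Q) (fun y => g y * (v y)%:E)) =
    (t%:E * Jv (cs Q) < J (cs Q) (fun y => g y * (v y)%:E)).
  have [V [S [V0 S0 -> _ _]]] := vA Q; rewrite /=.
  have W0 : (0 < V * lam Q)%R by rewrite mulr_gt0// lam_gt0.
  by rewrite lte_pdivlMl// muleC.
split=> [/ereal_sup_gt[_ [Q Qx <-]]|[Q [Qx]]].
  by rewrite E => h; exists Q.
by rewrite -E => h; apply: lt_le_trans h _; apply: ereal_sup_ubound; exists Q.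
Qed.

Lemma weighted_maximal_ge Q g x : cs Q x ->
  J (cs Q) (fun y => g y * (v y)%:E) <= weighted_maximal g x * Jv (cs Q).
Proof.
move=> Qx; have [V [S [V0 S0 VE _ _]]] := vA Q.
have W0 : (0 < V * lam Q)%R by rewrite mulr_gt0// lam_gt0.
rewrite VE -lee_pdivrMr// muleC.
have := @ereal_sup_ubound R [set (fine (Jv (cs Q)))^-1%:E * J (cs Q) (fun y => g y * (v y)%:E) |
    Q in [set Q | cs Q x]] _ (ex_intro2 _ _ Q Qx erefl).
by rewrite VE.
Qed.

Lemma weighted_maximal_ge0 g x : 0 <= weighted_maximal g x.
Proof.
have [Q [_ Qx]] := cell_at alpha 0%R x.
apply: (@le_trans _ _ ((fine (Jv (cs Q)))^-1%:E * J (cs Q) (fun y => g y * (v y)%:E))).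
  by rewrite mule_ge0 ?dchoquet_ge0// lee_fin invr_ge0 fine_ge0// dchoquet_ge0.
by apply: ereal_sup_ubound; exists Q.
Qed.

(** The bound on unions of cells is applied to [h = 2^k g v] with [1 / t <= 2^k <= 2 / t]; a power
    of 2 passes through [J] on each cell without loss. *)
Lemma weighted_maximal_weak : exists2 C : R, (0 < C)%R &
  forall g t, (forall x, 0 <= g x) -> (0 < t)%R ->
    Jv [set x | t%:E < weighted_maximal g x] <=
      (C / t)%:E * J setT (fun x => g x * (v x)%:E).
Proof.
have [C C0 CP] := dchoquet_bigcup_le_all.
exists (C * 2)%R; first by rewrite mulr_gt0.
move=> g t g_ge0 t0; have t'0 : (0 < t^-1)%R by rewrite invr_gt0.
have [k /andP[k1 k2]] := pow2_ceil t'0.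
pose h x := ((2 ^ k)%R)%:E * (g x * (v x)%:E).
pose QQ := [set Q | t%:E * Jv (cs Q) < J (cs Q) (fun y => g y * (v y)%:E)].
apply: (@le_trans _ _ (Jv (\bigcup_(Q in QQ) cs Q))).
  by apply: le_dchoquet => // x /lt_weighted_maximal[Q [Qx Qt]]; exists Q.
apply: (@le_trans _ _ (C%:E * J setT h)).
  apply: CP => Q /ltW Qt; rewrite /h dchoquet_shift.
  rewrite -lee_pdivlMl// in Qt; apply: le_trans Qt _.
  by rewrite lee_wpmul2r ?dchoquet_ge0// lee_fin.
rewrite /h dchoquet_shift muleA -EFinM lee_wpmul2r ?dchoquet_ge0// lee_fin -mulrA.
by rewrite ler_wpM2l// ltW.
Qed.

(* Summing over the levels of [g] costs nothing because an A_p weight is, up to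
   sets of small relative content, constant on every cell. *)
Lemma weighted_layer_cake (q : R) : (0 < q)%R -> exists2 C : R, (0 < C)%R &
  forall g, (forall x, 0 <= g x) ->
    \esum_(j in [set: int]) ((2 `^ q) ^ j)%:E * Jv [set x | ((2 ^ j)%R)%:E < g x] <=
    C%:E * J setT (fun x => g x `^ q * (v x)%:E).
Proof.
move=> q0; set b := (2 `^ q)%R.
have b1 : (1 < b)%R by rewrite /b /powR pnatr_eq0/= expR_gt1 mulr_gt0 ?ln_gt0 ?ltr1n.
have b0 : (0 < b)%R by exact: lt_trans b1.
have [C C0 CP] := esum_min_geometric b1 gamma_gt0.
have A0 : (0 < A)%R.
  have [V [S [V0 S0 _ _ VS]]] := vA (0%R, 0%R).
  by apply: lt_le_trans VS; rewrite mulr_gt0// powR_gt0.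
pose C1 : R := (2 + 16 * A * 2 `^ gamma)%R.
have C10 : (0 < C1)%R by rewrite addr_gt0// !mulr_gt0// powR_gt0.
exists ((2 * C1 * C) * cell_constant)%R.
  by rewrite mulr_gt0 ?cell_constant_gt0// !mulr_gt0.
move=> g g_ge0.
apply: (@le_dchoquet_cover R n delta delta_gt0 alpha setT).
  by rewrite !mulr_gt0.
move=> D lev cel cov Mfin.
have p2 (m : int) : (0 < 2 ^ m :> R)%R by rewrite exprz_gt0.
have pb (m : int) : (0 < b ^ m :> R)%R by rewrite exprz_gt0.
(* [y i j] compares [b^j] times the average of [v] on a cover cell with the level of the cell. The
   contribution to level [j] decays as [y i j] moves away from 1. *)
pose y i j : R := let V := (fine (Jv (cs (cel i))) / lam (cel i))%R in (V / 2 ^ lev i * b ^ j)%R.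
pose F i (j : int) := [set x | cs (cel i) x /\ (v x < 2 ^ (lev i + 1) * (b ^ j)^-1)%R].
pose u i (j : int) x : \bar R := (Num.min (2 ^ (lev i + 1)) (b ^ j * v x))%:E.
have level j : ((b ^ j)%R)%:E * Jv [set x | ((2 ^ j)%R)%:E < g x] <=
    2%:E * \esum_(i in D) J (F i j) (u i j).
  apply: (@le_trans _ _ (2%:E * J [set x | ((2 ^ j)%R)%:E < g x] (fun x => ((b ^ j)%R)%:E * (v x)%:E))).
    by apply: dchoquetZ_ge => // x; rewrite lee_fin ltW.
  rewrite lee_wpmul2l//; apply: dchoquet_le_sum => x s /= gx s0.
  rewrite -EFinM lte_fin => sx.
  have bv0 : (0 < b ^ j * v x)%R by rewrite mulr_gt0.
  (* The cover is used at the level of [b^j * v x], not of [s], so that [v x < 2^(m+1) / b^j] and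
     [x] lies in [F i j]. *)
  have [m /andP[m1 m2]] := @exprz_floor R 2 _ (ltr1n _ 2) bv0.
  have [//||i [Di im ix]] := cov x m.
    apply: (@le_lt_trans _ _ ((b ^ j)%:E * (v x)%:E)); first by rewrite -EFinM lee_fin.
    rewrite lte_pmul2r ?lte_fin// /b -powR_exprz// -poweR_EFin.
    case: (g x) gx (g_ge0 x) => [gr| |//] gx gge.
      rewrite !poweR_EFin lte_fin gt0_ltr_powR// ?nnegrE ?(ltW (p2 _))//.
    by rewrite poweRyr ?gt_eqF// poweR_EFin ltry.
  exists i; split => //.
    by split => //; rewrite ltr_pdivlMr// im mulrC.
  by rewrite /u lte_fin lt_min sx andbT im; exact: lt_trans m2.
have term i j : J (F i j) (u i j) <=
    (C1 * (2 ^ lev i * lam (cel i)))%:E * (Num.min (y i j) ((y i j) `^ (- gamma)))%:E.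
  have [V [S [V0 S0 VE SE VS]]] := vA (cel i).
  have l0 := @lam_gt0 R n delta (cel i).
  have yE : y i j = (V / 2 ^ lev i * b ^ j)%R.
    by rewrite /y VE /= mulfK// gt_eqF.
  have y0 : (0 < y i j)%R by rewrite yE mulr_gt0// divr_gt0.
  have w0 : (0 < 2 ^ lev i * lam (cel i))%R by rewrite mulr_gt0.
  (* Bounding [u] by [b^j v] gives the factor [y]. In [le2], [u] is bounded by a constant and the
     content of [F i j], where [v] is small and [sigma] large, by Chebyshev for [sigma]; the A_p
     condition turns this into [y^(-gamma)]. *)
  have le1 : J (F i j) (u i j) <= (2 * (2 ^ lev i * lam (cel i)) * y i j)%:E.
    apply: (@le_trans _ _ (J (cs (cel i)) (fun x => ((b ^ j)%R)%:E * (v x)%:E))).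
      apply: le_dchoquet => [x []//|x _].
      by rewrite /u -EFinM lee_fin ge_min lexx orbT.
    apply: le_trans (dchoquetZ _ _ _) _ => //.
      by move=> x; rewrite lee_fin ltW.
    rewrite VE -EFinM lee_fin yE le_eqVlt; apply/orP; left; apply/eqP.
    by field; rewrite gt_eqF.
  have le2 : J (F i j) (u i j) <=
      (16 * A * 2 `^ gamma * (2 ^ lev i * lam (cel i)) * (y i j) `^ (- gamma))%:E.
    apply: (@le_trans _ _ (J (F i j) (fun=> ((2 ^ (lev i + 1))%R)%:E))).
      by apply: le_dchoquet => // x _; rewrite /u lee_fin ge_min lexx.
    apply: le_trans (dchoquet_cst _ _) _ => //.
    pose s := (2 ^ (lev i + 1) * (b ^ j)^-1)%R.
    have s0 : (0 < s)%R by rewrite mulr_gt0// invr_gt0.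
    have sg0 : (0 < s `^ (- gamma))%R by rewrite powR_gt0.
    have FH : H (F i j) <= (s `^ gamma * (4 * (S * lam (cel i))))%:E.
      have := dchoquet_chebyshev_le (delta := delta) (cs (cel i)) (fun x => (sigma x)%:E) sg0.
      rewrite SE -EFinM muleC -lee_pdivlMr// => ch.
      apply: (@le_trans _ _ (H [set x | cs (cel i) x /\ (s `^ (- gamma))%:E <= (sigma x)%:E])).
        apply: hcontent_le => x [ix vx]; split => //.
        rewrite lee_fin /dual_weight !powRN lef_pV2 ?posrE ?powR_gt0//.
        by apply: ge0_ler_powR; rewrite ?nnegrE ?(ltW gamma_gt0) ?(ltW (v_gt0 x)) ?(ltW s0) ?(ltW vx).
      apply: le_trans ch _; rewrite -EFinM lee_fin powRN invrK le_eqVlt.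
      by apply/orP; left; apply/eqP; ring.
    apply: (@le_trans _ _ ((2 * 2 ^ (lev i + 1))%:E * (s `^ gamma * (4 * (S * lam (cel i))))%:E)).
      by rewrite lee_wpmul2l// lee_fin mulr_ge0// ltW.
    rewrite -EFinM lee_fin.
    have sE : (s `^ gamma = 2 `^ gamma * (y i j) `^ (- gamma) * V `^ gamma)%R.
      rewrite powRN -powR_inv1 ?powR_ge0// -powRrM mulrN1 -[(- gamma)%R]mulN1r powRrM powR_inv1 ?(ltW y0)//.
      rewrite -!powRM ?mulr_ge0 ?invr_ge0 ?(ltW y0) ?(ltW V0)//; congr (_ `^ _)%R.
      rewrite yE /s expfzDr// expr1z; field.
      by rewrite !gt_eqF.
    rewrite sE.
    have -> : (2 * 2 ^ (lev i + 1) * (2 `^ gamma * y i j `^ (- gamma) * V `^ gamma *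
       (4 * (S * lam (cel i)))) = (16 * 2 `^ gamma * (2 ^ lev i * lam (cel i)) * y i j `^ (- gamma)) * (V `^ gamma * S))%R.
      by rewrite expfzDr// expr1z; ring.
    have -> : (16 * A * 2 `^ gamma * (2 ^ lev i * lam (cel i)) * y i j `^ (- gamma) =
      (16 * 2 `^ gamma * (2 ^ lev i * lam (cel i)) * y i j `^ (- gamma)) * A)%R by ring.
    by rewrite ler_wpM2l// !mulr_ge0 ?powR_ge0 ?(ltW l0) ?(ltW (p2 _)).
  have T0 : (0 <= 16 * A * 2 `^ gamma)%R by rewrite !mulr_ge0 ?powR_ge0 ?(ltW A0).
  rewrite -EFinM; case: (leP (y i j) _) => _.
    apply: le_trans le1 _; rewrite lee_fin ler_wpM2r ?(ltW y0)// ler_wpM2r ?(ltW w0)//.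
    by rewrite /C1 lerDl.
  apply: le_trans le2 _; rewrite lee_fin ler_wpM2r ?powR_ge0// ler_wpM2r ?(ltW w0)//.
  by rewrite /C1 lerDr.
have min0 i j : 0 <= (Num.min (y i j) ((y i j) `^ (- gamma)))%:E.
  rewrite lee_fin le_min powR_ge0 andbT /y !mulr_ge0 ?invr_ge0 ?(ltW (pb _)) ?(ltW (p2 _)) ?lam_ge0//.
  by rewrite fine_ge0// dchoquet_ge0.
have w0 i : (0 <= C1 * (2 ^ lev i * lam (cel i)))%R.
  by rewrite !mulr_ge0 ?(ltW C10) ?(ltW (p2 _)) ?lam_ge0.
apply: (@le_trans _ _ (\esum_(j in [set: int]) (2%:E * \esum_(i in D) J (F i j) (u i j)))).
  by apply: le_esum => j _; exact: level.
rewrite esumZl//; last by move=> j; apply: esum_ge0 => i _; exact: dchoquet_ge0.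
rewrite -mulrA EFinM -muleA lee_wpmul2l//.
(* For a fixed cover cell, [y i j] is a geometric progression in [j], so the sum over [j] is a
   multiple of the mass of the cell. *)
rewrite esum_exchangeT; last by move=> i j; exact: dchoquet_ge0.
have wm0 i : (0 <= 2 ^ lev i * lam (cel i))%R by rewrite mulr_ge0 ?lam_ge0// ltW.
rewrite /cover_mass -esumZl ?mulr_ge0 ?(ltW C0) ?(ltW C10)//.
apply: le_esum => i Di.
apply: (@le_trans _ _ (\esum_(j in [set: int]) ((C1 * (2 ^ lev i * lam (cel i)))%:E *
    (Num.min (y i j) ((y i j) `^ (- gamma)))%:E))).
  by apply: le_esum => j _; exact: term.
rewrite esumZl//.
have [V [S [V0 S0 VE SE VS]]] := vA (cel i).
have l0 := @lam_gt0 R n delta (cel i).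
have V'0 : (0 < fine (Jv (cs (cel i))) / lam (cel i) / 2 ^ lev i)%R.
  by rewrite VE /= !divr_gt0// mulr_gt0.
apply: le_trans (lee_wpmul2l _ (CP _ V'0)) _; first by rewrite lee_fin.
by rewrite -!EFinM lee_fin le_eqVlt; apply/orP; left; apply/eqP; ring.
Qed.

Local Notation M := weighted_maximal.

(** Marcinkiewicz interpolation: at level [2^k] the weak bound is applied to the part of [g] above
    [2^(k-1)], this part is cut into dyadic levels, and [weighted_layer_cake] sums what remains. *)
Lemma weighted_maximal_strong (q : R) : (1 < q)%R -> exists2 C : R, (0 < C)%R &
  forall g, (forall x, 0 <= g x) ->
    J setT (fun x => M g x `^ q * (v x)%:E) <=
    C%:E * J setT (fun x => g x `^ q * (v x)%:E).
Proof.
move=> q1; have q0 : (0 < q)%R by exact: lt_trans q1.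
have [C1 C10 weak] := weighted_maximal_weak.
have [C2 C20 layer] := weighted_layer_cake q0.
set b := (2 `^ q)%R in layer.
pose rho := (b / 2)%R.
have rho1 : (1 < rho)%R.
  rewrite ltr_pdivlMr// mul1r -[ltLHS](@powRr1 _ 2)// /b.
  by rewrite /powR pnatr_eq0/= ltr_expR ltr_pM2r// ln_gt0// ltr1n.
have rho0 : (0 < rho)%R by exact: lt_trans rho1.
have b0 : (0 < b)%R by rewrite powR_gt0.
have b1 : (1 < b)%R by rewrite /b /powR pnatr_eq0/= expR_gt1 mulr_gt0 ?ln_gt0 ?ltr1n.
have r01 : (0 < rho^-1 < 1)%R by rewrite invr_gt0 rho0 invf_lt1.
pose D := ((1 - rho^-1)^-1)%R.
have D0 : (0 < D)%R by rewrite invr_gt0 subr_gt0; case/andP: r01.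
exists (8 * b * C1 * rho * D * C2)%R; first by rewrite !mulr_gt0.
move=> g g_ge0.
have p2 (m : int) : (0 < 2 ^ m :> R)%R by rewrite exprz_gt0.
have pb (m : int) : (0 < b ^ m :> R)%R by rewrite exprz_gt0.
have pr (m : int) : (0 < rho ^ m :> R)%R by rewrite exprz_gt0.
pose a j := Jv [set x | ((2 ^ j)%R)%:E < g x].
have a0 j : 0 <= a j by exact: dchoquet_ge0.
pose F k := [set x | ((2 ^ k)%R)%:E < M g x].
have vge0 x : 0 <= (v x)%:E by rewrite lee_fin ltW.
have step1 : J setT (fun x => M g x `^ q * (v x)%:E) <=
    \esum_(k in [set: int]) J (F k) (fun x => ((b ^ (k + 1))%R)%:E * (v x)%:E).
  apply: dchoquet_le_sum => x s _ s0 sM.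
  have sv0 : (0 < s / v x)%R by rewrite divr_gt0.
  (* With [r^q * v x = s], the assumption on [s] becomes [r < M g x], and the dyadic level is read
     off from [r]. *)
  pose r := ((s / v x) `^ q^-1)%R; have r0 : (0 < r)%R by rewrite powR_gt0.
  have rq : (r `^ q = s / v x)%R by rewrite -powRrM mulVf ?gt_eqF// powRr1// ltW.
  have rM : r%:E < M g x.
    rewrite ltNge; apply/negP => Mr.
    have : s%:E <= s%:E by [].
    rewrite leNgt => /negP; apply; apply: lt_le_trans sM _.
    have -> : s%:E = (r `^ q)%:E * (v x)%:E.
      by rewrite -EFinM rq divfK// gt_eqF.
    rewrite lee_wpmul2r// -poweR_EFin; apply: gt0_ler_poweR => //; first exact: ltW.
      by rewrite in_itv/= leey andbT weighted_maximal_ge0.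
    by rewrite in_itv/= leey andbT lee_fin ltW.
  have [k /andP[k1 k2]] := @exprz_floor R 2 _ (ltr1n _ 2) r0.
  exists k; split => //; first by apply: le_lt_trans rM; rewrite lee_fin.
  rewrite -EFinM lte_fin -ltr_pdivrMr// -rq /b -powR_exprz//.
  by apply: gt0_ltr_powR => //; rewrite nnegrE ltW.
pose gt k x := if ((2 ^ (k - 1))%R)%:E < g x then g x else 0.
have gt_ge0 k x : 0 <= gt k x by rewrite /gt; case: ifP.
have step2 k : Jv (F k) <= (C1 / 2 ^ (k - 1))%:E * J setT (fun x => gt k x * (v x)%:E).
  apply: le_trans (weak (gt k) _ (gt_ge0 k) (p2 _)).
  apply: le_dchoquet => // x /lt_weighted_maximal[Q [Qx Qk]].
  apply/lt_weighted_maximal; exists Q; split => //.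
  have [V [S [V0 S0 VE _ _]]] := vA Q.
  have le : J (cs Q) (fun y => g y * (v y)%:E) <=
      J (cs Q) (fun y => ((2 ^ (k - 1))%R)%:E * (v y)%:E) +
      J (cs Q) (fun y => gt k y * (v y)%:E).
    apply: dchoquet_le_add => y s Qy s0 sg; rewrite /gt.
    case: (ltP ((2 ^ (k - 1))%R)%:E (g y)) => h; [right|left]; split => //.
    by apply: lt_le_trans sg _; rewrite lee_wpmul2r.
  (* The part of [g] below [2^(k-1)] uses exactly half of [2^k] times the weighted content of [Q];
     the other half is left for [gt k]. *)
  have := lt_le_trans Qk le; rewrite dchoquet_shift VE -!EFinM.
  have -> : (2 ^ k * (V * lam Q))%:E =
      (2 ^ (k - 1) * (V * lam Q))%:E + (2 ^ (k - 1) * (V * lam Q))%:E.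
    rewrite -EFinD; congr _%:E; rewrite -{1}(subrK 1%R k) expfzDr// expr1z; ring.
  by rewrite lteD2lE.
have step3 k : J setT (fun x => gt k x * (v x)%:E) <=
    \esum_(j in [set j : int | setT j /\ (k - 1 <= j)%R]) (2 ^ (j + 1))%:E * a j.
  apply: (@le_trans _ _ (\esum_(j in [set j : int | setT j /\ (k - 1 <= j)%R])
      J [set x | ((2 ^ j)%R)%:E < g x] (fun x => ((2 ^ (j + 1))%R)%:E * (v x)%:E))).
    apply: dchoquet_le_sum => x s _ s0; rewrite /gt; case: ifP => [kg sg|_].
      have sv0 : (0 < s / v x)%R by rewrite divr_gt0.
      have svg : (s / v x)%:E < g x.
        rewrite -(@lte_pmul2r _ (v x)%:E)// ?lte_fin// -EFinM divfK//.
        by rewrite gt_eqF.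
      (* Small values are charged to level [k - 1], which [g x] exceeds wherever [gt k] is non-zero;
         larger ones to their own dyadic level. *)
      have [le|gt'] := leP (s / v x)%R (2 ^ (k - 1))%R.
        exists (k - 1)%R; split => //=.
        rewrite -EFinM lte_fin -ltr_pdivrMr//; apply: le_lt_trans le _.
        by rewrite ltr_eXz2l ?ltr1n// ltrDl.
      have [m /andP[m1 m2]] := @exprz_floor R 2 _ (ltr1n _ 2) sv0.
      exists m; split => /=.
      - split => //; rewrite -ltzD1; have := lt_trans gt' m2.
        by rewrite ltr_eXz2l ?ltr1n.
      - by apply: le_lt_trans svg; rewrite lee_fin.
      - by rewrite -EFinM lte_fin -ltr_pdivrMr.
    by rewrite mul0e lte_fin ltNge (ltW s0).
  by apply: le_esum => j _; rewrite dchoquet_shift.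
pose e k j : R := (2 * b ^ (k + 1) * (C1 / 2 ^ (k - 1)) * 2 ^ (j + 1))%R.
have e0 k j : (0 <= e k j)%R.
  by rewrite !mulr_ge0 ?invr_ge0 ?(ltW (pb _)) ?(ltW (p2 _)) ?(ltW C10).
apply: (le_trans step1).
apply: (@le_trans _ _ (\esum_(k in [set: int])
    \esum_(j in [set j : int | setT j /\ (k - 1 <= j)%R]) (e k j)%:E * a j)).
  apply: le_esum => k _; apply: le_trans (dchoquetZ _ _ _) _ => //.
  apply: le_trans (lee_wpmul2l _ (step2 k)) _.
    by rewrite lee_fin mulr_ge0// ltW.
  have c0 : (0 <= C1 / 2 ^ (k - 1))%R by rewrite divr_ge0 ?(ltW C10) ?(ltW (p2 _)).
  apply: le_trans (lee_wpmul2l _ (lee_wpmul2l _ (step3 k))) _.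
  - by rewrite lee_fin mulr_ge0// ltW.
  - by rewrite lee_fin.
  have ja j : 0 <= (2 ^ (j + 1))%:E * a j by rewrite mule_ge0// lee_fin ltW.
  rewrite -esumZl// -esumZl ?mulr_ge0 ?(ltW (pb _))//; last first.
    by move=> j; rewrite mule_ge0 ?lee_fin.
  by apply: le_esum => j _; rewrite !muleA -!EFinM.
rewrite (esum_exchange _ _ (fun k j : int => (k - 1 <= j)%R) (a := fun k j => (e k j)%:E * a j)); last first.
  by move=> k j; rewrite mule_ge0// lee_fin.
rewrite EFinM -muleA.
apply: le_trans (lee_wpmul2l _ (layer g g_ge0)); last first.
  by rewrite lee_fin !mulr_ge0 ?(ltW b0) ?(ltW C10) ?(ltW rho0) ?(ltW D0).
rewrite -esumZl; last 2 first.
- by rewrite !mulr_ge0 ?(ltW b0) ?(ltW C10) ?(ltW rho0) ?(ltW D0).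
- by move=> j; rewrite mule_ge0 ?dchoquet_ge0 ?lee_fin ?(ltW (pb _)).
apply: le_esum => j _; rewrite muleA -EFinM.
have aoo : 0 <= a j by [].
apply: (@le_trans _ _ ((\esum_(k in [set k : int | setT k /\ (k - 1 <= j)%R]) (e k j)%:E) * a j)).
  case: (a j) aoo => [aj|_|//].
    by rewrite lee_fin => aj0; rewrite esumZr// => k; rewrite lee_fin.
  (* If [a j] is infinite the right-hand side must be shown infinite; the term [k = j + 1] makes its
     first factor positive. *)
  have ej : 0 < \esum_(k in [set k : int | setT k /\ (k - 1 <= j)%R]) (e k j)%:E.
    apply: (@lt_le_trans _ _ (e (j + 1)%R j)%:E).
      by rewrite lte_fin !mulr_gt0 ?invr_gt0.
    apply: (@esum_ge1 _ _ [set k : int | setT k /\ (k - 1 <= j)%R] (fun k => (e k j)%:E)).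
    by split => //=; rewrite addrK.
  by rewrite [leRHS]gt0_muley ?leey.
rewrite lee_wpmul2r//.
(* Since [b = 2 * rho], [e k j] is a constant times [b^j * rho^(k - j - 1)]; the series over
   [k <= j + 1] converges because [q > 1] gives [rho > 1]. *)
apply: (@le_trans _ _ (\esum_(k in [set k : int | (k <= j + 1)%R])
    (8 * b * C1 * rho * b ^ j)%:E * ((rho^-1) ^ (j + 1 - k))%:E)).
  have -> : [set k : int | setT k /\ (k - 1 <= j)%R] = [set k : int | (k <= j + 1)%R].
    by apply/seteqP; split => k /=; rewrite lerBlDr; [case|].
  apply: le_esum => k _; rewrite -EFinM lee_fin /e exprz_inv opprB.
  have bE (m : int) : (b ^ m = 2 ^ m * rho ^ m)%R.
    by rewrite -expfzMl /rho mulrC divfK.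
  have h1 : (b ^ (k + 1) = 2 ^ k * rho ^ k * b)%R by rewrite expfzDr ?gt_eqF// expr1z bE.
  have h2 : (2 ^ (k - 1) = 2 ^ k / 2 :> R)%R by rewrite expfzDr// -invr_expz expr1z.
  have h3 : (2 ^ (j + 1) = 2 ^ j * 2 :> R)%R by rewrite expfzDr// expr1z.
  have h5 : (rho ^ (k - (j + 1)) = rho ^ k / (rho ^ j * rho))%R.
    by rewrite expfzDr ?gt_eqF// -invr_expz expfzDr ?gt_eqF// expr1z.
  rewrite h1 h2 h3 h5 (bE j) le_eqVlt; apply/orP; left; apply/eqP.
  by field; rewrite !gt_eqF.
rewrite esumZl; last 2 first.
- by rewrite !mulr_ge0 ?(ltW b0) ?(ltW C10) ?(ltW rho0) ?(ltW (pb _)).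
- by move=> k; rewrite lee_fin exprz_ge0// invr_ge0 ltW.
apply: le_trans (lee_wpmul2l _ (geometric_down_le (j + 1)%R r01)) _.
  by rewrite lee_fin !mulr_ge0 ?(ltW b0) ?(ltW C10) ?(ltW rho0) ?(ltW (pb _)).
by rewrite -EFinM lee_fin le_eqVlt -/D; apply/orP; left; apply/eqP; ring.
Qed.

End Maximal.

(** * Lerner's argument for the unweighted grid maximal operator *)

Section CellMaximal.
Context {R : realType} {n : nat}.
Variables (i0 : 'I_n) (delta : R) (delta_gt0 : (0 < delta)%R).
Variable alpha : {ffun 'I_n -> bool}.
Local Notation X := 'rV[R]_n.
Local Notation H := (@hcontent R n delta).
Local Notation J := (@dchoquet R n delta).
Local Notation cs := (@cset R n alpha).
Local Notation lam := (@lam R n delta).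
Local Notation subc := (@subc R n alpha).
Local Notation cdisjoint := (@cdisjoint R n alpha).
Local Notation cell_constant := (@cell_constant R n delta).
Local Notation cover_mass := (@cover_mass R n delta).
Implicit Types (P Q : cell n) (E : set X) (g h : X -> \bar R).

Lemma dual_weightK (v : X -> R) (gamma : R) : (0 < gamma)%R ->
  (forall x, 0 < v x)%R -> dual_weight (dual_weight v gamma) gamma^-1 = v.
Proof.
move=> g0 v0; apply/funext => x; rewrite /dual_weight -powRrM mulrNN mulfV ?gt_eqF//.
by rewrite powRr1// ltW.
Qed.

Lemma muckenhoupt_pair_dual (v : X -> R) (gamma A : R) : (0 < gamma)%R ->
  (forall x, 0 < v x)%R ->
  muckenhoupt_pair delta alpha v (dual_weight v gamma) gamma A ->
  muckenhoupt_pair delta alpha (dual_weight v gamma)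
    (dual_weight (dual_weight v gamma) gamma^-1) gamma^-1 (A `^ gamma^-1).
Proof.
move=> g0 v0 vA Q; have [V [S [V0 S0 VE SE VS]]] := vA Q.
exists S, V; split => //; first by rewrite dual_weightK.
have -> : (S `^ gamma^-1 * V = (V `^ gamma * S) `^ gamma^-1)%R.
  rewrite powRM ?powR_ge0 ?(ltW S0)// -powRrM mulfV ?gt_eqF// powRr1 ?(ltW V0)//.
  by rewrite mulrC.
apply: ge0_ler_powR => //; rewrite ?invr_ge0 ?(ltW g0)// nnegrE.
  by rewrite mulr_ge0 ?powR_ge0// ltW.
by apply: le_trans VS; rewrite mulr_ge0 ?powR_ge0// ltW.
Qed.

Lemma ereal_le_of_lt (m B : \bar R) : 0 <= B ->
  (forall t : R, (0 < t)%R -> t%:E < m -> t%:E <= B) -> m <= B.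
Proof.
case: B => [r| |]//; last by move=> _ _; rewrite leey.
rewrite lee_fin => r0 H; case: m H => [m| |] H; last by rewrite leNye.
  rewrite lee_fin leNgt; apply/negP => rm.
  have h1 : (0 < (r + m) / 2)%R by lra.
  have h2 : ((r + m) / 2 < m)%R by lra.
  by have := H _ h1; rewrite lte_fin lee_fin => /(_ h2); lra.
have h1 : (0 < r + 1)%R by lra.
by have := H _ h1 (ltry _); rewrite lee_fin => h2; exfalso; lra.
Qed.

Variable kappa : R.
Hypothesis kappa_gt0 : (0 < kappa)%R.
Hypothesis hcontent_cset_ge : forall P, (kappa * lam P)%:E <= H (cs P).
Variables (w : X -> R) (p A : R).
Hypotheses (w_gt0 : forall x, (0 < w x)%R) (p_gt1 : (1 < p)%R).
Let gamma := ((p - 1)^-1)%R.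
Local Notation sigma := (dual_weight w gamma).
Hypothesis wA : muckenhoupt_pair delta alpha w sigma gamma A.

Definition cell_maximal (f : X -> \bar R) (x : X) : \bar R :=
  ereal_sup [set ((lam Q)^-1)%:E * J (cs Q) f | Q in [set Q | cs Q x]].

Lemma cell_maximal_ge0 f x : 0 <= cell_maximal f x.
Proof.
have [Q [_ Qx]] := cell_at alpha 0%R x.
apply: (@le_trans _ _ (((lam Q)^-1)%:E * J (cs Q) f)).
  by rewrite mule_ge0 ?dchoquet_ge0// lee_fin invr_ge0 lam_ge0.
by apply: ereal_sup_ubound; exists Q.
Qed.

Let gamma_gt0 : (0 < gamma)%R.
Proof. by rewrite invr_gt0 subr_gt0. Qed.

Let sigma_gt0 x : (0 < sigma x)%R.
Proof. by rewrite powR_gt0. Qed.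

Local Notation Mw := (weighted_maximal delta alpha w).
Local Notation Ms := (weighted_maximal delta alpha sigma).

(* Lerner's pointwise bound: two successive weighted maximal operators, for the
   dual weight and for the weight, dominate the unweighted one. *)
Lemma cell_maximal_le (f F K : X -> \bar R) (x : X) : (forall y, 0 <= f y) ->
  F = (fun y => f y * ((sigma y)^-1)%:E) ->
  K = (fun y => Ms F y `^ (p - 1)%R * ((w y)^-1)%:E) ->
  cell_maximal f x <= ((4 / kappa * A `^ gamma^-1)%:E * Mw K x) `^ gamma.
Proof.
move=> f0 FE KE; apply: ge_ereal_sup => _ [Q Qx <-].
have sA := muckenhoupt_pair_dual gamma_gt0 w_gt0 wA.
have [V [S [V0 S0 VE SE VS]]] := wA Q.
have l0 := @lam_gt0 R n delta Q.
have M0 : 0 <= Mw K x by exact: weighted_maximal_ge0.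
have cc0 : (0 <= 4 / kappa)%R by rewrite divr_ge0// ltW.
(* The average of [f] may be infinite, so it is tested against the reals below it. *)
have m_le (t : R) : (0 < t)%R -> t%:E < ((S * lam Q)^-1)%:E * J (cs Q) f ->
    t%:E <= ((4 / kappa * V)%:E * Mw K x) `^ gamma.
  move=> t0; rewrite lte_pdivlMl ?mulr_gt0// => tf.
  (* As [f = F * sigma], the [sigma]-weighted average of [F] over [Q] exceeds [t], whence
     [Ms F >= t] on all of [Q]. *)
  have G y : cs Q y -> t%:E <= Ms F y.
    move=> Qy; have := weighted_maximal_ge sA F Qy.
    rewrite (_ : J _ _ = J (cs Q) f); last first.
      apply: eq_dchoquet => z _; rewrite FE -muleA -EFinM mulVf ?gt_eqF//.
      by rewrite mule1.
    move=> h; have := lt_le_trans tf h; rewrite SE muleC => h'.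
    have := ltW h'; rewrite lee_pmul2r// lte_fin mulr_gt0//.
  (* [K * w = (Ms F)^(p-1)] is at least [t^(p-1)] on [Q], whose content is at least
     [kappa * lam Q]. *)
  have e1 : (t `^ (p - 1) * (kappa * lam Q))%:E <= 4%:E * J (cs Q) (fun y => K y * (w y)%:E).
    have tp0 : (0 < t `^ (p - 1))%R by rewrite powR_gt0.
    apply: (@le_trans _ _ (4%:E * J (cs Q) (fun=> (t `^ (p - 1))%:E))).
      apply: le_trans (dchoquet_cst_ge _ tp0).
      by rewrite EFinM lee_wpmul2l// lee_fin ltW.
    rewrite lee_wpmul2l//; apply: le_dchoquet => // y Qy.
    rewrite KE -muleA -EFinM mulVf ?gt_eqF// mule1 -poweR_EFin.
    have p10 : (0 <= p - 1)%R by rewrite subr_ge0 ltW.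
    apply: (gt0_ler_poweR p10); last exact: G.
      by rewrite in_itv/= leey andbT lee_fin ltW.
    by rewrite in_itv/= leey andbT weighted_maximal_ge0.
  have e2 : (t `^ (p - 1))%:E <= (4 / kappa * V)%:E * Mw K x.
    have h := weighted_maximal_ge wA K Qx.
    have c4 : 0 <= 4%:E :> \bar R by rewrite lee_fin.
    have := le_trans e1 (lee_wpmul2l c4 h).
    rewrite VE => h2.
    have kl : (0 < kappa * lam Q)%R by rewrite mulr_gt0.
    rewrite -(@lee_pmul2r _ (kappa * lam Q)%:E)// ?lte_fin// -EFinM.
    apply: le_trans h2 _; rewrite muleCA -EFinM muleC.
    rewrite [leRHS]muleAC -EFinM.
    by rewrite (_ : 4 * (V * lam Q) = 4 / kappa * V * (kappa * lam Q))%R//; field; rewrite gt_eqF.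
  have -> : t%:E = ((t `^ (p - 1))%:E) `^ gamma.
    rewrite poweR_EFin -powRrM mulfV ?powRr1 ?(ltW t0)//.
    by rewrite subr_eq0 gt_eqF.
  apply: (gt0_ler_poweR (ltW gamma_gt0)); last exact: e2.
    by rewrite in_itv/= leey andbT lee_fin powR_ge0.
  by rewrite in_itv/= leey andbT mule_ge0// lee_fin mulr_ge0// ltW.
have m_le' : ((S * lam Q)^-1)%:E * J (cs Q) f <= ((4 / kappa * V)%:E * Mw K x) `^ gamma.
  by apply: ereal_le_of_lt m_le; exact: poweR_ge0.
apply: (@le_trans _ _ (S%:E * ((4 / kappa * V)%:E * Mw K x) `^ gamma)).
  apply: le_trans (lee_wpmul2l _ m_le'); last by rewrite lee_fin ltW.
  rewrite muleA -EFinM invfM mulrA divff ?gt_eqF// mul1r//.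
(* Moved inside the power, [S] becomes [S^(1/gamma)], and [S^(1/gamma) * V <= A^(1/gamma)] is the
   A_p condition. *)
have -> : S%:E = ((S `^ gamma^-1)%:E) `^ gamma.
  by rewrite poweR_EFin -powRrM mulVf ?gt_eqF// powRr1// ltW.
have kV : (0 <= 4 / kappa * V)%R by rewrite mulr_ge0// ltW.
rewrite -poweRM ?lee_fin ?powR_ge0 ?mule_ge0 ?lee_fin//.
have A0 : (0 < A)%R by apply: lt_le_trans VS; rewrite mulr_gt0// powR_gt0.
apply: (gt0_ler_poweR (ltW gamma_gt0)).
- by rewrite in_itv/= leey andbT !mule_ge0 ?lee_fin ?powR_ge0.
- by rewrite in_itv/= leey andbT mule_ge0 ?lee_fin ?(mulr_ge0 cc0) ?powR_ge0.
rewrite muleA -EFinM lee_wpmul2r// lee_fin.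
rewrite mulrCA ler_wpM2l//.
have -> : (S `^ gamma^-1 * V = (V `^ gamma * S) `^ gamma^-1)%R.
  rewrite powRM ?powR_ge0 ?(ltW S0)// -powRrM mulfV ?gt_eqF// powRr1 ?(ltW V0)//.
  by rewrite mulrC.
apply: ge0_ler_powR => //.
- by rewrite invr_ge0 ltW.
- by rewrite nnegrE mulr_ge0 ?powR_ge0// ltW.
- by rewrite nnegrE ltW.
Qed.

(** The strong bound is used for [Mw] with the conjugate exponent [gamma * p = p / (p - 1)] and for
    [Ms] with exponent [p]. They fit together because [K^(gamma p) * w = (Ms F)^p * sigma] and
    [F^p * sigma = f^p * w]. *)
Lemma cell_maximal_strong : exists2 C : R, (0 < C)%R & forall f, (forall x, 0 <= f x) ->
  J setT (fun x => cell_maximal f x `^ p * (w x)%:E) <=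
  C%:E * J setT (fun x => f x `^ p * (w x)%:E).
Proof.
have p0 : (0 < p)%R by exact: lt_trans p_gt1.
have p10 : (p - 1 != 0)%R by rewrite subr_eq0 gt_eqF.
have q1 : (1 < gamma * p)%R.
  by rewrite /gamma mulrC ltr_pdivlMr ?subr_gt0// mul1r gtrBl.
have q0 : (0 < gamma * p)%R by exact: lt_trans q1.
have sA := muckenhoupt_pair_dual gamma_gt0 w_gt0 wA.
have g'0 : (0 < gamma^-1)%R by rewrite invr_gt0.
have [C2 C20 w_strong] := weighted_maximal_strong i0 delta_gt0 kappa_gt0 hcontent_cset_ge
  w_gt0 gamma_gt0 wA q1.
have [C3 C30 s_strong] := weighted_maximal_strong i0 delta_gt0 kappa_gt0 hcontent_cset_ge
  sigma_gt0 g'0 sA p_gt1.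
have A0 : (0 < A)%R.
  have [V [S [V0 S0 _ _ VS]]] := wA (0%R, 0%R).
  by apply: lt_le_trans VS; rewrite mulr_gt0// powR_gt0.
pose c := (4 / kappa * A `^ gamma^-1)%R.
have c0 : (0 < c)%R by rewrite mulr_gt0 ?divr_gt0 ?powR_gt0.
have cq0 : (0 < c `^ (gamma * p))%R by rewrite powR_gt0.
exists (2 * c `^ (gamma * p) * C2 * C3)%R; first by rewrite !mulr_gt0.
move=> f f0.
pose F y := f y * ((sigma y)^-1)%:E.
pose K y := Ms F y `^ (p - 1)%R * ((w y)^-1)%:E.
have Mw0 y : 0 <= Mw K y by exact: weighted_maximal_ge0.
have Ms0 y : 0 <= Ms F y by exact: weighted_maximal_ge0.
have wi0 y : (0 <= (w y)^-1)%R by rewrite invr_ge0 ltW.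
have si0 y : (0 <= (sigma y)^-1)%R by rewrite invr_ge0 ltW.
have K0 y : 0 <= K y by rewrite mule_ge0 ?poweR_ge0 ?lee_fin.
have F0 y : 0 <= F y by rewrite mule_ge0 ?lee_fin.
apply: (@le_trans _ _ (J setT (fun x => (c `^ (gamma * p))%:E * (Mw K x `^ (gamma * p) * (w x)%:E)))).
  apply: le_dchoquet => // x _; rewrite muleA lee_wpmul2r ?lee_fin ?(ltW (w_gt0 x))//.
  rewrite -poweR_EFin -poweRM ?lee_fin ?(ltW c0)// poweRrM.
  apply: (gt0_ler_poweR (ltW p0)); last exact: (cell_maximal_le _ f0 erefl erefl).
    by rewrite in_itv/= leey andbT cell_maximal_ge0.
  by rewrite in_itv/= leey andbT poweR_ge0.
apply: le_trans (dchoquetZ _ cq0 _) _.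
  by move=> x; rewrite mule_ge0 ?poweR_ge0// lee_fin ltW.
have nn : (0 <= 2 * c `^ (gamma * p))%R by rewrite mulr_ge0// ltW.
apply: le_trans (lee_wpmul2l _ (w_strong K K0)) _; first by rewrite lee_fin.
rewrite [leRHS](_ : _ = (2 * c `^ (gamma * p))%:E * (C2%:E * (C3%:E *
  J setT (fun x => f x `^ p * (w x)%:E)))); last by rewrite !muleA -!EFinM.
rewrite lee_wpmul2l ?lee_fin// lee_wpmul2l ?lee_fin ?(ltW C20)//.
have -> : J setT (fun x => K x `^ (gamma * p) * (w x)%:E) =
    J setT (fun x => Ms F x `^ p * (sigma x)%:E).
  apply: eq_dchoquet => x _; rewrite /K poweRM ?poweR_ge0 ?lee_fin//.
  rewrite -poweRrM mulrA mulfV// mul1r -muleA poweR_EFin -EFinM; congr (_ * _%:E).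
  rewrite -powR_inv1 ?(ltW (w_gt0 x))// -powRrM -{2}[w x]powRr1 ?(ltW (w_gt0 x))//.
  rewrite -powRD; last by rewrite (gt_eqF (w_gt0 x)) implybT.
  by congr (_ `^ _)%R; rewrite /gamma; field.
apply: le_trans (s_strong F F0) _.
rewrite lee_wpmul2l ?lee_fin ?(ltW C30)//.
rewrite le_eqVlt; apply/orP; left; apply/eqP; apply: eq_dchoquet => x _.
rewrite /F poweRM ?lee_fin// -muleA poweR_EFin -EFinM; congr (_ * _%:E).
rewrite /dual_weight -powRN -!powRrM -powRD; last by rewrite (gt_eqF (w_gt0 x)) implybT.
rewrite (_ : _ + _ = 1)%R ?powRr1 ?(ltW (w_gt0 x))//.
by rewrite /gamma; field.
Qed.

End CellMaximal.

Lemma lt_poweR (R : realType) (r q : R) (y : \bar R) : (0 <= r)%R -> (0 < q)%R ->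
  r%:E < y -> (r `^ q)%:E < y `^ q.
Proof.
move=> r0 q0; case: y => [y| |//]; last by move=> _; rewrite poweRyr ?gt_eqF// ltry.
rewrite !lte_fin => ry; apply: gt0_ltr_powR => //.
by rewrite nnegrE (le_trans r0)// ltW.
Qed.

Lemma le_poweR (R : realType) (q : R) (x y : \bar R) : (0 <= q)%R -> 0 <= x ->
  x <= y -> x `^ q <= y `^ q.
Proof.
move=> q0 x0 xy; have y0 : 0 <= y by exact: le_trans xy.
by apply: (gt0_ler_poweR q0) xy; rewrite in_itv/= leey andbT.
Qed.

Lemma powR_split1 (R : realType) (a p : R) : (0 < a)%R ->
  (a `^ p = a `^ (p - 1) * a)%R.
Proof.
move=> a0; rewrite -[X in (_ = _ * X)%R](powRr1 (ltW a0)) -powRD ?subrK//.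
by rewrite (gt_eqF a0) implybT.
Qed.

(** * From the strong bound to the weak bound and to A_p, for positive real weights *)

Section RealWeights.
Context {R : realType} {n : nat}.
Variables (delta p : R) (p_gt1 : (1 < p)%R).
Local Notation X := 'rV[R]_n.
Local Notation H := (@hcontent R n delta).
Local Notation J := (@dchoquet R n delta).
Local Notation cs := (@cset R n).
Local Notation lam := (@lam R n delta).
Variable kappa : R.
Hypothesis kappa_gt0 : (0 < kappa)%R.
Hypothesis hcontent_cube_lb : forall Q : cube R n,
  (kappa * edge Q `^ delta)%:E <= H (cube_set Q).
Variable w : X -> R.
Hypothesis w_gt0 : forall x, (0 < w x)%R.
Let gamma := ((p - 1)^-1)%R.
Local Notation sigma := (dual_weight w gamma).
Local Notation wE := (fun x => (w x)%:E).

Let p1_gt0 : (0 < p - 1)%R. Proof. by rewrite subr_gt0. Qed.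
Let gamma_gt0 : (0 < gamma)%R. Proof. by rewrite invr_gt0. Qed.
Let p_gt0 : (0 < p)%R. Proof. exact: lt_trans p_gt1. Qed.

Lemma choquet_ge0 E (g : X -> \bar R) : 0 <= choquet delta E g.
Proof. by apply: integral_ge0 => t _; exact: hcontent_ge0. Qed.

(** If [J] vanished, all dyadic level sets would be null, and they exhaust [E]. *)
Lemma dchoquet_gt0 E (v : X -> \bar R) : (forall x, E x -> 0 < v x) -> 0 < H E ->
  0 < J E v.
Proof.
move=> v0 HE; rewrite lt_neqAle dchoquet_ge0 andbT eq_sym; apply/eqP => J0.
have L0 (m : int) : H [set x | E x /\ ((2 ^ m)%R)%:E < v x] = 0.
  have pos (i : int) : 0 <= ((2 ^ i)%R)%:E * H [set x | E x /\ ((2 ^ i)%R)%:E < v x].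
    by rewrite mule_ge0 ?hcontent_ge0// lee_fin exprz_ge0.
  have /eqP := esum_ge0_gt0 pos J0 (i := m) I.
  by rewrite mule_eq0 gt_eqF ?lte_fin ?exprz_gt0// => /eqP.
have := @hcontent_bigcup R n delta int setT
  (fun m => [set x | E x /\ ((2 ^ m)%R)%:E < v x]) E.
rewrite esum1// => h; have : H E <= 0.
  apply: h => x Ex.
  have [r [r0 rv]] : exists r : R, (0 < r)%R /\ r%:E < v x.
    case: (v x) (v0 x Ex) => [y| |//].
      by rewrite lte_fin => y0; exists (y / 2)%R; rewrite lte_fin; split; lra.
    by move=> _; exists 1%R; rewrite ltry; split.
  have [m /andP[m1 _]] := @exprz_floor R 2 r (ltr1n _ 2) r0.
  by exists m => //; split => //; apply: le_lt_trans rv; rewrite lee_fin.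
by rewrite leNgt HE.
Qed.

Lemma strong_implies_weak :
  (exists K : R, (0 < K)%R /\
     forall f : X -> \bar R, Lpw delta p wE f ->
       choquet delta setT (fun x => maximal delta f x `^ p * (w x)%:E)
         <= K%:E * choquet delta setT (fun x => `|f x| `^ p * (w x)%:E)) ->
  exists K : R, (0 < K)%R /\
     forall f : X -> \bar R, Lpw delta p wE f ->
       forall t : R, (0 < t)%R ->
         weighted_content delta wE [set x | t%:E < maximal delta f x]
           <= (K / t `^ p)%:E *
              choquet delta setT (fun x => `|f x| `^ p * (w x)%:E).
Proof.
(* One factor 2 comes from scaling by [t^p], the other from passing from [J] back to the Choquet
   integral. *)
move=> [K [K0 KP]]; exists (4 * K)%R; split; first by rewrite mulr_gt0.
move=> f fL t t0; have tp0 : (0 < t `^ p)%R by rewrite powR_gt0.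
rewrite /weighted_content; apply: le_trans (choquet_le_dchoquet _ _) _.
rewrite mulrC EFinM -muleA -(@lee_pmul2l _ (t `^ p)%:E)// ?lte_fin//.
rewrite muleA -EFinM mulfV ?gt_eqF// mul1e.
apply: le_trans (dchoquetZ_ge _ tp0 _) _; first by move=> x; rewrite lee_fin ltW.
apply: (@le_trans _ _ (2%:E * (2%:E * (K%:E * choquet delta setT (fun x => `|f x| `^ p * (w x)%:E))))).
  rewrite lee_wpmul2l//; apply: le_trans (lee_wpmul2l _ (KP f fL)) => //.
  apply: le_trans (dchoquet_le_choquet _ _); apply: le_dchoquet => // x tx.
  rewrite lee_wpmul2r ?lee_fin ?(ltW (w_gt0 x))// -poweR_EFin.
  by apply: le_poweR; rewrite ?lee_fin ?(ltW t0) ?(ltW p_gt0) ?(ltW tx).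
by rewrite !muleA -!EFinM (_ : 2 * 2 * K = 4 * K)%R//; ring.
Qed.

Lemma inv_poweRE :
  (fun x => ((w x)%:E)^-1 `^ ((p - 1)^-1)%R) = (fun x => (sigma x)%:E).
Proof.
apply/funext => x; rewrite inver gt_eqF// poweR_EFin /dual_weight.
by rewrite -(powR_inv1 (ltW (w_gt0 x))) -powRrM mulN1r.
Qed.

(** The test function is [sigma] on [Q], truncated at [N] because its integral is not yet known to
    be finite. The weak bound at half its average bounds the integral of [w] over [Q], and then that
    of the truncation uniformly in [N]. *)
Lemma weak_implies_muckenhoupt :
  (exists K : R, (0 < K)%R /\
     forall f : X -> \bar R, Lpw delta p wE f ->
       forall t : R, (0 < t)%R ->
         weighted_content delta wE [set x | t%:E < maximal delta f x]
           <= (K / t `^ p)%:E *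
              choquet delta setT (fun x => `|f x| `^ p * (w x)%:E)) ->
  muckenhoupt delta p wE.
Proof.
move=> [K [K0 KP]]; pose B : R := (4 * K * 2 `^ p)%R.
have B0 : (0 < B)%R by rewrite !mulr_gt0// powR_gt0.
apply: (@le_lt_trans _ _ (2 `^ (p - 1) * B)%:E); last exact: ltry.
apply: ge_ereal_sup => _ [Q _ <-]; rewrite /average.
rewrite inv_poweRE.
have Hpos : 0 < H (cube_set Q).
  apply: lt_le_trans (hcontent_cube_lb Q).
  by rewrite lte_fin mulr_gt0// powR_gt0// edge_gt0.
have Hfin : H (cube_set Q) \is a fin_num.
  rewrite ge0_fin_numE ?(ltW Hpos)//.
  by apply: le_lt_trans (hcontent_cube Q) _; exact: ltry.
rewrite -(fineK Hfin) in Hpos *; set h := fine _ in Hpos *.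
have h0 : (0 < h)%R by rewrite -lte_fin.
have HE : H (cube_set Q) = h%:E by rewrite /h fineK.
rewrite inver gt_eqF//.
have s0 x : (0 < sigma x)%R by rewrite powR_gt0.
pose f N (x : X) : \bar R := if x \in cube_set Q then (Num.min (sigma x) N)%:E else 0.
have f_ge0 N x : (0 < N)%R -> 0 <= f N x.
  by move=> N0; rewrite /f; case: ifP => // _; rewrite lee_fin le_min !ltW.
have f_abs N x : (0 < N)%R -> `|f N x| = f N x by move=> N0; rewrite gee0_abs ?f_ge0.
have fQ N x : cube_set Q x -> f N x = (Num.min (sigma x) N)%:E.
  by move=> Qx; rewrite /f mem_set.
(* On [Q] this is [f^(p-1) * w <= sigma^(p-1) * w = 1]. *)
have fp N x : (0 < N)%R -> `|f N x| `^ p * (w x)%:E <= f N x.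
  move=> N0; rewrite f_abs// /f; case: ifP => [_|_]; last first.
    by rewrite poweR0r ?gt_eqF// mul0e.
  set m := Num.min _ _; have m0 : (0 < m)%R by rewrite lt_min s0.
  rewrite poweR_EFin -EFinM lee_fin powR_split1// mulrAC ler_piMl ?(ltW m0)//.
  apply: (@le_trans _ _ (sigma x `^ (p - 1) * w x)%R).
    rewrite ler_wpM2r ?(ltW (w_gt0 x))//; apply: ge0_ler_powR; rewrite ?nnegrE ?(ltW p1_gt0) ?(ltW m0) ?(ltW (s0 x))//.
    by rewrite /m ge_min lexx.
  rewrite /dual_weight -powRrM mulNr mulVf ?gt_eqF// powRN powRr1 ?(ltW (w_gt0 x))//.
  by rewrite mulVf// gt_eqF.
pose sN N := fine (choquet delta (cube_set Q) (f N)).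
have sNE N : (0 < N)%R -> choquet delta (cube_set Q) (f N) = (sN N)%:E.
  move=> N0; rewrite /sN fineK// ge0_fin_numE ?choquet_ge0//.
  apply: le_lt_trans (choquet_le_dchoquet _ _) _.
  apply: (@le_lt_trans _ _ (J (cube_set Q) (fun=> N%:E))).
    by apply: le_dchoquet => // x Qx; rewrite fQ// lee_fin ge_min lexx orbT.
  by apply: le_lt_trans (dchoquet_cst _ N0) _; rewrite HE -EFinM ltry.
have sN_gt0 N : (0 < N)%R -> (0 < sN N)%R.
  move=> N0; rewrite -lte_fin -sNE//.
  rewrite -(@lte_pmul2l _ 2%:E)// ?lte_fin// mule0.
  apply: lt_le_trans (dchoquet_le_choquet _ _); apply: dchoquet_gt0; last by rewrite HE.
  by move=> x Qx; rewrite fQ// lte_fin lt_min s0.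
have key N : (0 < N)%R -> choquet delta (cube_set Q) wE <=
    (B * h `^ p / sN N `^ (p - 1))%:E.
  move=> N0; have s0' := sN_gt0 _ N0.
  (* Half the average of [f N] over [Q], so that the maximal function is strictly larger than [t] on
     [Q]. *)
  pose t := (sN N / h / 2)%R; have t0 : (0 < t)%R by rewrite !divr_gt0.
  have fL : Lpw delta p wE (f N).
    rewrite /Lpw /=; apply: le_lt_trans (choquet_le_dchoquet _ _) _.
    apply: (@le_lt_trans _ _ (J (cube_set Q) (f N))).
      apply: dchoquet_le => x s _ s0'' sf; have sf' := lt_le_trans sf (fp N x N0).
      split => //; move: sf'; rewrite /f; case: ifPn => [/set_mem//|_].
      by rewrite lte_fin ltNge (ltW s0'').
    by apply: le_lt_trans (dchoquet_le_choquet _ _) _; rewrite sNE// -EFinM ltry.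
  have Qsub : cube_set Q `<=` [set x | t%:E < maximal delta (f N) x].
    move=> x Qx /=; apply: (@lt_le_trans _ _ (average delta Q (fun y => `|f N y|))).
      rewrite /average HE inver gt_eqF//.
      rewrite (_ : (fun y => _) = f N); last by apply/funext => y; rewrite f_abs.
      rewrite sNE// -EFinM lte_fin /t mulrC.
      by have : (0 < h^-1 * sN N)%R by [rewrite mulr_gt0// invr_gt0]; lra.
    by apply: ereal_sup_ubound; exists Q.
  have step := KP (f N) fL t t0; rewrite /weighted_content in step.
  apply: le_trans (choquet_le_dchoquet _ _) _.
  apply: (@le_trans _ _ (J [set x | t%:E < maximal delta (f N) x] wE)).
    exact: le_dchoquet.
  apply: le_trans (dchoquet_le_choquet _ _) _.
  apply: le_trans (lee_wpmul2l _ step) _ => //.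
  have fle : choquet delta setT (fun x => `|f N x| `^ p * (w x)%:E) <= 2%:E * (sN N)%:E.
    apply: le_trans (choquet_le_dchoquet _ _) _; rewrite -sNE//.
    apply: le_trans (dchoquet_le_choquet _ _).
    apply: dchoquet_le => x s _ s0'' sf; have sf' := lt_le_trans sf (fp N x N0).
    split => //; move: sf'; rewrite /f; case: ifPn => [/set_mem//|_].
    by rewrite lte_fin ltNge (ltW s0'').
  have Kt0 : 0 <= (K / t `^ p)%:E by rewrite lee_fin divr_ge0 ?powR_ge0// ltW.
  apply: le_trans (lee_wpmul2l _ (lee_wpmul2l Kt0 fle)) _ => //.
  rewrite -!EFinM lee_fin le_eqVlt; apply/orP; left; apply/eqP.
  have tE : (t `^ p = sN N `^ (p - 1) * sN N / h `^ p / 2 `^ p)%R.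
    have tE0 : (sN N `^ p = t `^ p * (h `^ p * 2 `^ p))%R.
      rewrite -powRM ?(ltW h0)// -powRM ?(ltW t0) ?mulr_ge0 ?(ltW h0)//.
      by congr (_ `^ _)%R; rewrite /t; field; rewrite gt_eqF.
    by rewrite -powR_split1// tE0; field; rewrite !gt_eqF ?powR_gt0.
  rewrite tE /B; field.
  by rewrite !gt_eqF ?powR_gt0.
have W0 : 0 < choquet delta (cube_set Q) wE.
  rewrite -(@lte_pmul2l _ 2%:E)// ?lte_fin// mule0.
  apply: lt_le_trans (dchoquet_le_choquet _ _).
  by apply: dchoquet_gt0 => [x _|]; rewrite ?lte_fin// HE.
have Wfin : choquet delta (cube_set Q) wE \is a fin_num.
  rewrite ge0_fin_numE ?(ltW W0)//.
  by apply: le_lt_trans (key 1%R ltr01) _; exact: ltry.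
rewrite -(fineK Wfin) in W0 key *; set W := fine _ in W0 key *.
rewrite lte_fin in W0.
pose D := (h * (B * h / W) `^ gamma)%R.
have D0 : (0 <= B * h / W)%R by rewrite divr_ge0 ?mulr_ge0 ?ltW.
have sD N : (0 < N)%R -> (sN N <= D)%R.
  move=> N0; have s0' := sN_gt0 _ N0; have := key _ N0.
  rewrite lee_fin ler_pdivlMr ?powR_gt0// => le.
  have le' : (sN N `^ (p - 1) <= (B * h `^ p / W))%R by rewrite ler_pdivlMr// mulrC.
  have : (sN N `^ (p - 1) `^ gamma <= (B * h `^ p / W) `^ gamma)%R.
    have B'0 : (0 <= B * h `^ p)%R by rewrite mulr_ge0 ?powR_ge0// ltW.
    apply: ge0_ler_powR le'; first exact: ltW.
      by rewrite nnegrE powR_ge0.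
    by rewrite nnegrE divr_ge0// ltW.
  rewrite -powRrM mulfV ?gt_eqF// powRr1 ?(ltW s0')// => le3.
  apply: le_trans le3 _; rewrite le_eqVlt; apply/orP; left; apply/eqP.
  have -> : (B * h `^ p / W = h `^ (p - 1) * (B * h / W))%R.
    by rewrite powR_split1//; ring.
  by rewrite powRM ?powR_ge0// -powRrM mulfV ?gt_eqF// powRr1// ltW.
(* Instead of a monotone limit in [N]: a finite partial sum involves finitely many levels, and
   truncating above all of them does not change it. *)
have JD : J (cube_set Q) (fun x => (sigma x)%:E) <= (2 * D)%:E.
  apply: esum_ub => s us _.
  have [N [N0 sN']] : exists N : R, (0 < N)%R /\ forall m, m \in s -> (2 ^ m < N)%R.
    elim: s {us} => [|m s [N [N0 IH]]]; first by exists 1%R; split.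
    exists (Num.max N (2 ^ m + 1)%R); split; first by rewrite lt_max N0.
    move=> m'; rewrite inE lt_max => /predU1P[->|/IH ->//].
    by rewrite ltrDl ltr01 orbT.
  apply: (@le_trans _ _ (J (cube_set Q) (f N))); last first.
    apply: le_trans (dchoquet_le_choquet _ _) _; rewrite sNE// -EFinM lee_fin.
    by rewrite ler_pM2l// sD.
  apply: le_trans (@esum_ge_seq _ _ setT _ s us _); last by move=> m _; exact/mem_set.
  rewrite big_seq [leRHS]big_seq; apply: lee_sum => m ms.
  rewrite lee_wpmul2l ?lee_fin ?exprz_ge0//; apply: hcontent_le => x [Qx mx].
  split => //; rewrite fQ// lte_fin lt_min sN'// andbT.
  by rewrite -lte_fin.
have cD : choquet delta (cube_set Q) (fun x => (sigma x)%:E) <= (2 * D)%:E.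
  exact: le_trans (choquet_le_dchoquet _ _) JD.
apply: (@le_trans _ _ ((h^-1 * W)%:E * ((h^-1 * (2 * D))%:E `^ (p - 1)))).
  rewrite -EFinM lee_wpmul2l//; first by rewrite lee_fin mulr_ge0 ?invr_ge0 ?ltW.
  apply: le_poweR; first exact: ltW.
    by rewrite mule_ge0 ?choquet_ge0// lee_fin invr_ge0 ltW.
  by rewrite [leRHS]EFinM lee_wpmul2l// lee_fin invr_ge0 ltW.
rewrite poweR_EFin -EFinM lee_fin.
have -> : (h^-1 * (2 * D) = 2 * (B * h / W) `^ gamma)%R.
  by rewrite /D; field; rewrite gt_eqF.
rewrite powRM ?powR_ge0// -powRrM mulVf ?gt_eqF// powRr1//.
rewrite le_eqVlt; apply/orP; left; apply/eqP; field.
by rewrite !gt_eqF.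
Qed.

End RealWeights.

(** * From A_p to the strong bound over all cubes, for positive real weights *)

Section MuckenhouptStrong.
Context {R : realType} {n : nat}.
Variables (i0 : 'I_n) (delta p : R).
Hypotheses (delta_gt0 : (0 < delta)%R) (p_gt1 : (1 < p)%R).
Local Notation X := 'rV[R]_n.
Local Notation H := (@hcontent R n delta).
Local Notation J := (@dchoquet R n delta).
Local Notation cs := (@cset R n).
Local Notation lam := (@lam R n delta).
Variable kappa : R.
Hypothesis kappa_gt0 : (0 < kappa)%R.
Hypothesis hcontent_cube_lb : forall Q : cube R n,
  (kappa * edge Q `^ delta)%:E <= H (cube_set Q).
Variable w : X -> R.
Hypothesis w_gt0 : forall x, (0 < w x)%R.
Let gamma := ((p - 1)^-1)%R.
Local Notation sigma := (dual_weight w gamma).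
Local Notation wE := (fun x => (w x)%:E).

Let p1_gt0 : (0 < p - 1)%R. Proof. by rewrite subr_gt0. Qed.
Let gamma_gt0 : (0 < gamma)%R. Proof. by rewrite invr_gt0. Qed.
Let p_gt0 : (0 < p)%R. Proof. exact: lt_trans p_gt1. Qed.

(** The content of a cell is at most [lam], so a normalized [J] is at most twice the average; the
    factors 2 and the power [gamma] give the constant. *)
Lemma muckenhoupt_pair_of_muckenhoupt : muckenhoupt delta p wE ->
  exists A, forall alpha, muckenhoupt_pair delta alpha w sigma gamma A.
Proof.
rewrite /muckenhoupt (inv_poweRE p w_gt0) => Boo.
set B := ereal_sup _ in Boo.
have BQ Q : average delta Q wE * average delta Q (fun x => (sigma x)%:E) `^ (p - 1) <= B.
  by apply: ereal_sup_ubound; exists Q.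
have avg0 Q g : 0 <= average delta Q g.
  by rewrite mule_ge0 ?inve_ge0 ?hcontent_ge0 ?choquet_ge0.
have B0 : 0 <= B.
  apply: le_trans (BQ (Cube (0 : X)%R (@ltr01 R))).
  by rewrite mule_ge0 ?poweR_ge0.
have Bfin : B \is a fin_num by rewrite ge0_fin_numE.
exists (2 `^ gamma * 2 * (fine B) `^ gamma)%R => alpha P.
pose Q : cube R n := cell_cube alpha P.
have l0 := @lam_gt0 R n delta P.
have Hlb : (kappa * lam P)%:E <= H (cs alpha P) by exact: hcontent_cube_lb.
have Hub : H (cs alpha P) <= (lam P)%:E by exact: hcontent_cube.
have Hpos : 0 < H (cs alpha P).
  by apply: lt_le_trans Hlb; rewrite lte_fin mulr_gt0.
have Hfin : H (cs alpha P) \is a fin_num.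
  by rewrite ge0_fin_numE ?(ltW Hpos)//; apply: le_lt_trans Hub _; exact: ltry.
pose h := fine (H (cs alpha P)).
have HE : H (cs alpha P) = h%:E by rewrite /h fineK.
have h0 : (0 < h)%R by rewrite -lte_fin -HE.
have hl : (h <= lam P)%R by rewrite -lee_fin -HE.
have avgE g : average delta Q g = (h^-1)%:E * choquet delta (cs alpha P) g.
  by rewrite /average -/(cset alpha P) HE inver gt_eqF.
have Jle g : J (cs alpha P) g <= (2 * lam P)%:E * average delta Q g.
  apply: le_trans (dchoquet_le_choquet _ _) _.
  rewrite avgE muleA -EFinM lee_wpmul2r ?choquet_ge0// lee_fin.
  by rewrite -mulrA ler_peMr// ler_pdivlMr// mul1r.
have pos g : (forall x, 0 < g x) -> 0 < average delta Q g.
  move=> g0; have J0 : 0 < J (cs alpha P) g by apply: dchoquet_gt0.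
  have := lt_le_trans J0 (Jle g); rewrite -[X in X < _](mule0 (2 * lam P)%:E).
  by rewrite lte_pmul2l// lte_fin mulr_gt0.
have a0 : 0 < average delta Q wE by apply: pos => x; rewrite lte_fin.
have b0 : 0 < average delta Q (fun x => (sigma x)%:E).
  by apply: pos => x; rewrite lte_fin powR_gt0.
(* Both averages are positive, so an infinite one would make the product infinite; the convention
   [0 * +oo = 0] cannot hide it. *)
have [a [b [aE bE a_gt0 b_gt0 abB]]] : exists a b : R,
    [/\ average delta Q wE = a%:E, average delta Q (fun x => (sigma x)%:E) = b%:E,
        (0 < a)%R, (0 < b)%R & (a * b `^ (p - 1) <= fine B)%R].
  have := BQ Q; rewrite -(fineK Bfin); move: (fine B) a0 b0 => B' a0 b0.
  move: a0 b0; case: (average delta Q wE) => [a| |]//; case: (average delta Q _) => [b| |]//.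
  - by rewrite !lte_fin poweR_EFin -EFinM lee_fin => a0 b0 abB; exists a, b.
  - by move=> a0 _; rewrite poweRyr ?gt_eqF// gt0_muley.
  - by move=> _ b0; rewrite gt0_mulye// poweR_gt0.
  - by move=> _ _; rewrite poweRyr ?gt_eqF.
have Jreal g (c : R) : (forall x, 0 < g x) -> average delta Q g = c%:E ->
    exists V : R, [/\ J (cs alpha P) g = (V * lam P)%:E, (0 < V)%R & (V <= 2 * c)%R].
  move=> g0 cE; have J0 : 0 < J (cs alpha P) g by apply: dchoquet_gt0.
  have := Jle g; move: J0; rewrite cE; case: (J (cs alpha P) g) => [V| |]//.
  rewrite lte_fin -EFinM lee_fin => V0 Vc; exists (V / lam P)%R; split.
  - by rewrite divfK// gt_eqF.
  - by rewrite divr_gt0.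
  - by rewrite ler_pdivrMr// mulrAC.
have [|V [VE V0 Va]] := Jreal _ _ _ aE; first by move=> x; rewrite lte_fin.
have [|S [SE S0 Sb]] := Jreal _ _ _ bE.
  by move=> x; rewrite lte_fin powR_gt0.
exists V, S; split => //.
move: (fine B) (fine_ge0 B0) abB => B' B'0 abB.
apply: (@le_trans _ _ ((2 * a) `^ gamma * (2 * b))%R).
  apply: ler_pM => //; rewrite ?powR_ge0 ?(ltW S0)//.
  by apply: ge0_ler_powR; rewrite ?nnegrE ?(ltW gamma_gt0) ?(ltW V0) ?mulr_ge0 ?(ltW a_gt0).
have -> : ((2 * a) `^ gamma * (2 * b) = 2 `^ gamma * 2 * (a * b `^ (p - 1)) `^ gamma)%R.
  rewrite !powRM ?powR_ge0 ?(ltW a_gt0)// -powRrM mulfV ?gt_eqF// powRr1 ?(ltW b_gt0)//.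
  by ring.
rewrite ler_wpM2l ?mulr_ge0 ?powR_ge0//.
apply: ge0_ler_powR => //; first exact: ltW.
by rewrite nnegrE mulr_ge0 ?powR_ge0// ltW.
Qed.

Lemma maximal_ge0 (f : X -> \bar R) x : 0 <= maximal delta f x.
Proof.
have r0 : (0 < 2 :> R)%R by [].
apply: (@le_trans _ _ (average delta (Cube (x - const_mx 1)%R r0) (fun y => `|f y|))).
  by rewrite mule_ge0 ?inve_ge0 ?hcontent_ge0 ?choquet_ge0.
apply: ereal_sup_ubound; exists (Cube (x - const_mx 1)%R r0) => // i /=.
by rewrite !mxE; apply/andP; split; lra.
Qed.

(** The maximal function is at most [c] times the largest of the [2^n] grid maximal functions, and
    their strong bounds are added. *)
Lemma muckenhoupt_implies_strong : muckenhoupt delta p wE ->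
  exists K : R, (0 < K)%R /\
     forall f : X -> \bar R, Lpw delta p wE f ->
       choquet delta setT (fun x => maximal delta f x `^ p * (w x)%:E)
         <= K%:E * choquet delta setT (fun x => `|f x| `^ p * (w x)%:E).
Proof.
move=> /muckenhoupt_pair_of_muckenhoupt[A wA].
have lb alpha P : (kappa * lam P)%:E <= H (cs alpha P) by exact: hcontent_cube_lb.
have /choice[C CP] : forall alpha, exists C : R, (0 < C)%R /\
    forall f : X -> \bar R, (forall x, 0 <= f x) ->
    J setT (fun x => cell_maximal delta alpha f x `^ p * (w x)%:E) <=
    C%:E * J setT (fun x => f x `^ p * (w x)%:E).
  move=> alpha; have [C C0 CP] := cell_maximal_strong i0 delta_gt0 kappa_gt0
    (lb alpha) w_gt0 p_gt1 (wA alpha).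
  by exists C.
pose Cs := (1 + \sum_alpha C alpha)%R.
have Cs0 : (0 < Cs)%R.
  by rewrite ltr_pwDl// sumr_ge0// => alpha _; rewrite ltW//; exact: (CP alpha).1.
have CCs alpha : (C alpha <= Cs)%R.
  rewrite /Cs (bigD1 alpha)//= addrCA lerDl addr_ge0// sumr_ge0// => beta _.
  by rewrite ltW//; exact: (CP beta).1.
(* A cell containing [Q] with side at most [6 * edge Q] has [lam] at most [6^delta / kappa] times
   the content of [Q]. *)
pose c := (6 `^ delta / kappa)%R.
have c0 : (0 < c)%R by rewrite divr_gt0// powR_gt0.
have cp0 : (0 < c `^ p)%R by rewrite powR_gt0.
pose N : R := (#|{ffun 'I_n -> bool}|%:R)%R.
have N0 : (0 < N)%R.
  by rewrite ltr0n; apply/card_gt0P; exists [ffun=> true].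
exists (2 * (N * (2 * c `^ p * Cs)))%R; split.
  by rewrite !mulr_gt0.
move=> f fL; pose g x := `|f x|.
have g0 x : 0 <= g x by exact: abse_ge0.
have Jfin : J setT (fun x => g x `^ p * (w x)%:E) \is a fin_num.
  rewrite ge0_fin_numE ?dchoquet_ge0//.
  apply: le_lt_trans (dchoquet_le_choquet _ _) _.
  by rewrite lte_mul_pinfty.
set I := J setT (fun x => g x `^ p * (w x)%:E) in Jfin *.
have cube_le (Q : cube R n) x : cube_set Q x -> exists alpha,
    average delta Q g <= c%:E * cell_maximal delta alpha g x.
  move=> Qx; have [alpha [P [QP Ps]]] := cube_in_cell Q.
  exists alpha; have e0 := edge_gt0 Q.
  have ed0 : (0 < edge Q `^ delta)%R by rewrite powR_gt0.
  have l0 := @lam_gt0 R n delta P.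
  have lP : (lam P <= 6 `^ delta * edge Q `^ delta)%R.
    rewrite -powRM ?(ltW e0)//; apply: ge0_ler_powR => //; first exact: ltW.
      by rewrite nnegrE exprz_ge0.
    by rewrite nnegrE mulr_ge0// ltW.
  apply: (@le_trans _ _ (c%:E * (((lam P)^-1)%:E * J (cs alpha P) g))); last first.
    rewrite lee_wpmul2l ?lee_fin ?(ltW c0)//; apply: ereal_sup_ubound.
    by exists P => //; exact: QP.
  rewrite /average muleA -EFinM.
  have Hlb := hcontent_cube_lb Q; have Hub := hcontent_cube (delta := delta) Q.
  have Hpos : 0 < H (cube_set Q).
    by apply: lt_le_trans Hlb; rewrite lte_fin mulr_gt0.
  have Hfin : H (cube_set Q) \is a fin_num.
    by rewrite ge0_fin_numE ?(ltW Hpos)//; apply: le_lt_trans Hub _; exact: ltry.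
  rewrite -(fineK Hfin) in Hlb Hpos *; set h := fine _ in Hlb Hpos *.
  rewrite !lte_fin ?lee_fin in Hlb Hpos; rewrite inver gt_eqF//.
  apply: lee_pmul; rewrite ?choquet_ge0// ?lee_fin.
  - by rewrite invr_ge0 ltW.
  - rewrite -[leLHS]mul1r ler_pdivrMr// mulrAC ler_pdivlMr// mul1r.
    apply: (le_trans lP); rewrite /c mulrAC ler_pdivlMr// -mulrA.
    by rewrite ler_wpM2l ?powR_ge0// mulrC.
  - apply: le_trans (choquet_le_dchoquet _ _) _; exact: le_dchoquet.
apply: le_trans (choquet_le_dchoquet _ _) _.
have Jsum : J setT (fun x => maximal delta f x `^ p * (w x)%:E) <=
    (N * (2 * c `^ p * Cs * fine I))%:E.
  apply: (@le_trans _ _ (\esum_(alpha in [set: {ffun 'I_n -> bool}])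
      J setT (fun x => (c `^ p)%:E * (cell_maximal delta alpha g x `^ p * (w x)%:E)))).
    apply: dchoquet_le_sum => x s _ s0 sM.
    have sv0 : (0 < s / w x)%R by rewrite divr_gt0.
    (* With [r^p * w x = s] the assumption becomes [r < maximal delta f x], so one cube has average
       above [r]; that cube selects the grid. *)
    pose r := ((s / w x) `^ p^-1)%R; have r0 : (0 < r)%R by rewrite powR_gt0.
    have rq : (r `^ p = s / w x)%R by rewrite -powRrM mulVf ?gt_eqF// powRr1// ltW.
    have sE : s%:E = (r `^ p)%:E * (w x)%:E by rewrite -EFinM rq divfK// gt_eqF.
    have rM : r%:E < maximal delta f x.
      rewrite ltNge; apply/negP => Mr.
      have : s%:E <= s%:E by [].
      rewrite leNgt => /negP; apply; apply: lt_le_trans sM _.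
      rewrite sE lee_wpmul2r ?lee_fin ?(ltW (w_gt0 x))// -poweR_EFin.
      by apply: le_poweR => //; [exact: ltW|exact: maximal_ge0].
    have /ereal_sup_gt[_ [Q Qx <-] rQ] := rM.
    have [alpha le] := cube_le Q x Qx.
    exists alpha; split => //; rewrite sE muleA lte_pmul2r ?lte_fin//.
    rewrite -!poweR_EFin -poweRM ?lee_fin ?(ltW c0) ?cell_maximal_ge0//.
    by apply: lt_poweR; [exact: ltW|exact: p_gt0|exact: lt_le_trans le].
  apply: esum_finType_le => [|alpha].
    by rewrite !mulr_ge0 ?(ltW cp0) ?(ltW Cs0)// fine_ge0// dchoquet_ge0.
  apply: le_trans (dchoquetZ _ cp0 _) _.
    by move=> x; rewrite mule_ge0 ?poweR_ge0// lee_fin ltW.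
  rewrite [leRHS](_ : _ = (2 * c `^ p)%:E * (Cs%:E * I)); last first.
    by rewrite -[in RHS](fineK Jfin) -!EFinM; congr _%:E; ring.
  rewrite lee_wpmul2l ?lee_fin ?mulr_ge0 ?(ltW cp0)//.
  apply: le_trans ((CP alpha).2 g g0) _.
  by rewrite lee_wpmul2r ?dchoquet_ge0// lee_fin.
apply: (le_trans Jsum).
have cI : I <= 2%:E * choquet delta setT (fun x => g x `^ p * (w x)%:E).
  exact: dchoquet_le_choquet.
rewrite [leRHS](_ : _ = (N * (2 * c `^ p * Cs))%:E * (2%:E * choquet delta setT (fun x => g x `^ p * (w x)%:E))); last first.
  by rewrite muleA -EFinM; congr (_%:E * _); ring.
apply: le_trans (lee_wpmul2l _ cI); last by rewrite lee_fin !mulr_ge0 ?(ltW N0) ?(ltW cp0) ?(ltW Cs0).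
by rewrite -(fineK Jfin) -EFinM lee_fin le_eqVlt; apply/orP; left; apply/eqP; ring.
Qed.

End MuckenhouptStrong.

(** * Null sets, reduction to positive real weights, and the equivalence *)

Lemma choquet_ae (R : realType) (n : nat) (delta : R) (N E : set 'rV[R]_n)
    (g h : 'rV[R]_n -> \bar R) :
  hcontent delta N = 0 -> (forall x, ~ N x -> g x = h x) ->
  choquet delta E g = choquet delta E h.
Proof.
move=> N0 gh; rewrite /choquet; congr integral; apply/funext => t.
have le (u v : 'rV[R]_n -> \bar R) : (forall x, ~ N x -> u x = v x) ->
    hcontent delta [set x | E x /\ t%:E < u x] <=
    hcontent delta [set x | E x /\ t%:E < v x].
  move=> uv; rewrite -[leRHS]adde0 -N0; apply: hcontentU => x /= [Ex tu].
  by have [Nx|nNx] := pselect (N x); [right|left; split => //; rewrite -uv].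
by apply/eqP; rewrite eq_le !le// => x nNx; rewrite gh.
Qed.

(** Countably many unit cells cover the space, and each of them is null by similarity with [Q0]. *)
Lemma hcontent_eq0 (R : realType) (n : nat) (delta : R) (Q0 : cube R n)
    (E : set 'rV[R]_n) :
  hcontent delta (cube_set Q0) = 0 -> hcontent delta E = 0.
Proof.
move=> Q00; apply/eqP; rewrite eq_le hcontent_ge0 andbT.
pose alpha : {ffun 'I_n -> bool} := [ffun=> true].
apply: (@le_trans _ _ (\esum_(P in [set: cell n]) hcontent delta (@cset R n alpha P))).
  by apply: hcontent_bigcup => x _; have [P [_ Px]] := cell_at alpha 0%R x; exists P.
rewrite esum1// => P _; apply/eqP; rewrite eq_le hcontent_ge0 andbT.
by apply: le_trans (hcontent_cube_ge (cell_cube alpha P) Q0) _; rewrite Q00 mule0.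
Qed.

Theorem theorem1p1 (R : realType) (n : nat) (delta p : R)
    (w : 'rV[R]_n -> \bar R)
    (delta_gt0 : (0 < delta)%R) (delta_le_n : (delta <= n%:R)%R)
    (p_gt1 : (1 < p)%R) (w_weight : capacitary_weight delta w) :
  [<-> exists K : R, (0 < K)%R /\
         forall f : 'rV[R]_n -> \bar R, Lpw delta p w f ->
           choquet delta setT (fun x => maximal delta f x `^ p * w x)
             <= K%:E * choquet delta setT (fun x => `|f x| `^ p * w x);
       exists K : R, (0 < K)%R /\
         forall f : 'rV[R]_n -> \bar R, Lpw delta p w f ->
           forall t : R, (0 < t)%R ->
             weighted_content delta w [set x | t%:E < maximal delta f x]
               <= (K / t `^ p)%:E *
                  choquet delta setT (fun x => `|f x| `^ p * w x);
       muckenhoupt delta p w].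
Proof.
(* [0 < delta <= n] forces positive dimension and provides a coordinate. *)
have [i0] : exists i0 : 'I_n, True.
  case: n delta_le_n {w w_weight} => [|m] le; last by exists ord0.
  by have := lt_le_trans delta_gt0 le; rewrite ltxx.
move=> _; pose Q0 : cube R n := Cube (0 : 'rV[R]_n)%R (@ltr01 R).
have Q0fin : hcontent delta (cube_set Q0) \is a fin_num.
  rewrite ge0_fin_numE ?hcontent_ge0//.
  by apply: le_lt_trans (hcontent_cube Q0) _; exact: ltry.
(* If the unit cube had zero content, all contents and integrals would vanish;
   this spares proving that it does not. *)
have [H0|Hn0] := eqVneq (hcontent delta (cube_set Q0)) 0.
  have ch0 (E : set 'rV[R]_n) g : choquet delta E g = 0.
    apply/eqP; rewrite eq_le choquet_ge0 andbT.
    have J0 : dchoquet delta E g = 0 by apply: dchoquet_null; apply: hcontent_eq0 H0.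
    by rewrite -J0; exact: choquet_le_dchoquet.
  tfae => _.
  - by exists 1%R; split => // f _ t t0; rewrite /weighted_content !ch0 mule0.
  - apply: (@le_lt_trans _ _ 0); last exact: ltry.
    by apply: ge_ereal_sup => _ [Q _ <-]; rewrite /average ch0 mule0 mul0e.
  - by exists 1%R; split => // f _; rewrite !ch0 mule0.
pose kappa := fine (hcontent delta (cube_set Q0)).
have kappa_gt0 : (0 < kappa)%R.
  by rewrite -lte_fin /kappa fineK// lt_neqAle hcontent_ge0 andbT eq_sym.
have lb (Q : cube R n) : (kappa * edge Q `^ delta)%:E <= hcontent delta (cube_set Q).
  have e0 := edge_gt0 Q.
  have := hcontent_cube_ge (delta := delta) Q0 Q; rewrite -(fineK Q0fin) -/kappa /= div1r.
  rewrite -powR_inv1 ?(ltW e0)// -powRrM mulN1r powRN.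
  by rewrite lee_pdivlMl ?powR_gt0// mulrC EFinM.
case: w_weight => w_ge0 _ [N [N0 NP]].
(* [w'] is real and positive everywhere and differs from [w] only inside the null set [N], so every
   Choquet integral in the three statements is unchanged. *)
pose w' x : R := if 0 < w x < +oo then fine (w x) else 1%R.
have w'_gt0 x : (0 < w' x)%R.
  by rewrite /w'; case: ifP => // /andP[w0 woo]; rewrite fine_gt0// w0 woo.
have ww' x : ~ N x -> w x = (w' x)%:E.
  move=> /NP wx; rewrite /w' wx fineK//; case/andP: wx => w0 woo.
  by rewrite ge0_fin_numE// ltW.
have eL (u : 'rV[R]_n -> \bar R) : choquet delta setT (fun x => u x * w x) =
    choquet delta setT (fun x => u x * (w' x)%:E).
  by apply: choquet_ae N0 _ => x /ww' ->.
have eL1 f := eL (fun x => `|f x| `^ p).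
have eL2 f := eL (fun x => maximal delta f x `^ p).
have eLpw f : Lpw delta p w f = Lpw delta p (fun x => (w' x)%:E) f.
  by rewrite /Lpw /= eL1.
have eW F : weighted_content delta w F = weighted_content delta (fun x => (w' x)%:E) F.
  exact: choquet_ae N0 ww'.
have eA Q : average delta Q w = average delta Q (fun x => (w' x)%:E).
  by rewrite /average (choquet_ae _ N0 ww').
have eAV Q : average delta Q (fun x => (w x)^-1 `^ ((p - 1)^-1)%R) =
    average delta Q (fun x => ((w' x)%:E)^-1 `^ ((p - 1)^-1)%R).
  rewrite /average; congr (_ * _); apply: choquet_ae N0 _ => x nNx.
  by rewrite ww'.
have eM : muckenhoupt delta p w = muckenhoupt delta p (fun x => (w' x)%:E).
  have eI : [set average delta Q w *
        (average delta Q (fun x => (w x)^-1 `^ ((p - 1)^-1)%R)) `^ (p - 1)%R |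
        Q in [set: cube R n]] =
      [set average delta Q (fun x => (w' x)%:E) *
        (average delta Q (fun x => ((w' x)%:E)^-1 `^ ((p - 1)^-1)%R)) `^ (p - 1)%R |
        Q in [set: cube R n]].
    by apply: eq_imagel => Q _; rewrite eA eAV.
  exact: (congr1 (fun A : set (\bar R) => ereal_sup A < +oo) eI).
have le_subst (a a' b b' : \bar R) (c : R) :
    a = a' -> b = b' -> a <= c%:E * b -> a' <= c%:E * b' by move=> -> ->.
rewrite eM; tfae.
- move=> [K [K0 KP]].
  have [|K' [K'0 K'P]] := @strong_implies_weak R n delta p p_gt1 w' w'_gt0.
    exists K; split; [exact: K0|move=> f fL].
    refine (le_subst _ _ _ _ _ (eL2 f) (eL1 f) (KP f _)).
    by rewrite eLpw.
  exists K'; split; [exact: K'0|move=> f fL t t0].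
  refine (le_subst _ _ _ _ _ (esym (eW _)) (esym (eL1 f)) (K'P f _ t t0)).
  by rewrite -eLpw.
- move=> [K [K0 KP]]; apply: (weak_implies_muckenhoupt p_gt1 kappa_gt0 lb w'_gt0).
  exists K; split; [exact: K0|move=> f fL t t0].
  refine (le_subst _ _ _ _ _ (eW _) (eL1 f) (KP f _ t t0)).
  by rewrite eLpw.
- move=> /(muckenhoupt_implies_strong i0 delta_gt0 p_gt1 kappa_gt0 lb w'_gt0)[K [K0 KP]].
  exists K; split; [exact: K0|move=> f fL].
  refine (le_subst _ _ _ _ _ (esym (eL2 f)) (esym (eL1 f)) (KP f _)).
  by rewrite -eLpw.
Qed.
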